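(* Let $p\ge1$ be an integer and let $a_n^{(0)}>0$, $b_n^{(0)}\in\mathbb{R}$ satisfy $a_{n+p}^{(0)}=a_n^{(0)}$, $b_{n+p}^{(0)}=b_n^{(0)}$ for all $n$. Let $\{a_n,b_n\}_{n=1}^\infty$ be Jacobi parameters with $$\lim_{n\to\infty}\bigl(|a_n-a_n^{(0)}|+|b_n-b_n^{(0)}|\bigr)=0,\qquad \sum_{n=1}^\infty\bigl(|a_{n+p}-a_n|+|b_{n+p}-b_n|\bigr)<\infty .$$ Then, on any closed interval which is a subset of the interior of the bands of $\{a_n^{(0)},b_n^{(0)}\}$, there is uniform clock behavior for $\{a_n,b_n\}$, with density of states $-\frac{1}{\pi p}\frac{d\gamma}{dE}$.
   Context: Jacobi parameters are bounded sequences $a_n>0$, $b_n\in\mathbb{R}$ ($n\ge 1$). The orthonormal polynomials are defined by $p_{-1}=0$, $p_0=1$, $xp_n=a_{n+1}p_{n+1}+b_{n+1}p_n+a_np_{n-1}$, $n\ge0$. Let $\nu_n$ be the probability measure giving weight $1/n$ to each of the $n$ (real, simple) zeros of $p_n$; the density of states $\nu$ is the weak limit of $\nu_n$. There is uniform clock behavior on $[\alpha,\beta]$ if $d\nu/dE$ is continuous and nonvanishing on $[\alpha,\beta]$ and $$\lim_{n\to\infty}\ \sup\Bigl\{\Bigl|\,n|E-E'|-\Bigl(\frac{d\nu}{dE}(E)\Bigr)^{-1}\Bigr| \ :\ E,E'\text{ are successive zeros of }p_n\text{ in }[\alpha,\beta]\Bigr\}=0 .$$ Bands: let $\Delta(E)$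 be the discriminant (trace of the one-period transfer matrix) of the $p$-periodic equation $a_n^{(0)}u_{n+1}+(b_n^{(0)}-E)u_n+a_{n-1}^{(0)}u_{n-1}=0$. The set $\Delta^{-1}([-2,2])$ is a union of $p$ closed bands $B_1,\dots,B_p$, where $\Delta^{-1}((-2,2))=\bigcup_j B_j^{\mathrm{int}}$ is a disjoint union of $p$ open intervals; two bands may touch at a single point (a closed gap). The interior of the bands means $\bigcup_{j=1}^pB_j^{\mathrm{int}}$ (so points where two bands touch are removed). On each $B_j^{\mathrm{int}}$ there is a Floquet solution with $u_{n+p}=e^{i\gamma(E)}u_n$, where $\gamma$ is a smooth real function with $2\cos\gamma(E)=\Delta(E)$, chosen so that $d\gamma/dE<0$. *)

(* Defs.v *)
From HB Require Import structures.
From mathcomp Require Import all_boot all_order all_algebra.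
From mathcomp Require Import polyrcf complex.
From mathcomp Require Import all_classical all_reals all_analysis.

Set Implicit Arguments.
Unset Strict Implicit.
Unset Printing Implicit Defensive.

Import Order.TTheory GRing.Theory Num.Theory.
Import numFieldNormedType.Exports.

Local Open Scope classical_set_scope.
Local Open Scope ring_scope.
Local Open Scope complex_scope.

(* Jacobi parameters a_n, b_n are indexed by n >= 1; the values a 0 and b 0 of
   the sequences below are irrelevant. *)
Definition jacobi_parameters (R : realType) (a b : nat -> R) : Prop :=
  (forall n, 0 < a n.+1) /\
  (exists M, forall n, `|a n.+1| <= M /\ `|b n.+1| <= M).

(* (p_n, p_{n-1}), with p_{-1} = 0; in particular a 0 only ever multiplies 0. *)
Fixpoint orthopoly_pair (R : realType) (a b : nat -> R) (n : nat) :
    {poly R} * {poly R} :=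
  if n is m.+1 then
    let: (q, q') := orthopoly_pair a b m in
    ((a m.+1)^-1 *: (('X - (b m.+1)%:P) * q - a m *: q'), q)
  else (1, 0).

Definition orthopoly (R : realType) (a b : nat -> R) (n : nat) : {poly R} :=
  (orthopoly_pair a b n).1.

(* The sorted, duplicate-free list of the real zeros of p_n. *)
Definition zeros (R : realType) (a b : nat -> R) (n : nat) : seq R :=
  rootsR (orthopoly a b n).

Definition zero_measure (R : realType) (a b : nat -> R) (n : nat) :
    {measure set (measurableTypeR R) -> \bar R} :=
  mscale (n%:R^-1)%:nng
    (msum (fun i => \d_((zeros a b n)`_i : measurableTypeR R))
          (size (zeros a b n))).

Definition weak_limit (R : realType)
    (mu : nat -> {measure set (measurableTypeR R) -> \bar R})
    (nu : probability (measurableTypeR R) R) : Prop :=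
  forall f : R -> R, continuous f -> bounded_fun f ->
    (fun n => \int[mu n]_x f x) @ \oo --> \int[nu]_x f x.

Definition density_of_states (R : realType) (a b : nat -> R)
    (nu : probability (measurableTypeR R) R) : Prop :=
  weak_limit (zero_measure a b) nu.

Definition has_density_on (R : realType)
    (nu : probability (measurableTypeR R) R) (D : set R) (rho : R -> R) : Prop :=
  forall A : set (measurableTypeR R), measurable A -> A `<=` D ->
    nu A = (\int[lebesgue_measure]_(x in A) (rho x)%:E)%E.

(* Symmetric in E and E'. *)
Definition successive_zeros_in (R : realType) (q : {poly R}) (D : set R)
    (E E' : R) : Prop :=
  [/\ D E, D E', root q E, root q E' & E != E'] /\
  (forall x, Num.min E E' < x < Num.max E E' -> ~~ root q x).

(* For fixed n the supremum is over a finite set; [sup set0 = 0] covers the n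
   for which p_n has fewer than two zeros in [alpha, beta]. *)
Definition uniform_clock_behavior (R : realType) (a b : nat -> R)
    (alpha beta : R) (rho : R -> R) : Prop :=
  exists nu : probability (measurableTypeR R) R,
    [/\ density_of_states a b nu,
        has_density_on nu `[alpha, beta] rho,
        {within `[alpha, beta], continuous rho},
        (forall E, E \in `[alpha, beta] -> rho E != 0) &
        (fun n => sup [set r | exists E E',
             successive_zeros_in (orthopoly a b n) `[alpha, beta] E E' /\
             r = `| n%:R * `|E - E'| - (rho E)^-1 | ]) @ \oo --> (0 : R)].

(* (u_{n+1}, u_n)^T = step n *m (u_n, u_{n-1})^T for solutions of
   a_n u_{n+1} + (b_n - E) u_n + a_{n-1} u_{n-1} = 0. *)
Definition transfer_step (R : realType) (a b : nat -> R) (E : R) (n : nat) :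
    'M[R]_2 :=
  block_mx ((E - b n) / a n)%:M (- (a n.-1 / a n))%:M
           1%:M                 0 : 'M[R]_(1 + 1).

Fixpoint transfer_matrix (R : realType) (a b : nat -> R) (E : R) (n : nat) :
    'M[R]_2 :=
  if n is m.+1 then transfer_step a b E n *m transfer_matrix a b E m
  else 1%:M.

Definition discriminant (R : realType) (a b : nat -> R) (p : nat) (E : R) : R :=
  \tr (transfer_matrix a b E p).

(* The union of the open bands; a point where two bands touch has
   discriminant 2 or -2 and is excluded. *)
Definition bands_interior (R : realType) (a b : nat -> R) (p : nat) : set R :=
  [set E | -2 < discriminant a b p E < 2].

Definition floquet_solution (R : realType) (a b : nat -> R) (p : nat) (E : R)
    (theta : R) (u : nat -> R[i]) : Prop :=
  [/\ exists n, u n != 0,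
      forall n, (a n.+1)%:C * u n.+2 + (b n.+1 - E)%:C * u n.+1
                + (a n)%:C * u n = 0 &
      forall n, u (n + p)%N = (cos theta +i* sin theta) * u n].

Definition floquet_phase (R : realType) (a b : nat -> R) (p : nat)
    (gamma : R -> R) : Prop :=
  forall E, bands_interior a b p E ->
    [/\ forall k, derivable (gamma^`(k)%classic) E 1,
        exists u, floquet_solution a b p E (gamma E) u,
        2 * cos (gamma E) = discriminant a b p E &
        gamma^`()%classic E < 0].

(* Main.v *)
Require Import Defs.
From HB Require Import structures.
From mathcomp Require Import all_boot all_order all_algebra.
From mathcomp Require Import polyrcf.
From mathcomp Require Import ring lra zify.
From mathcomp Require Import all_classical all_reals all_analysis.
From mathcomp Require Import measurable_realfun.

Set Implicit Arguments.
Unset Strict Implicit.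
Unset Printing Implicit Defensive.

Import Order.TTheory GRing.Theory Num.Theory.
Import numFieldNormedType.Exports.

Local Open Scope classical_set_scope.
Local Open Scope ring_scope.

(** Fix the residue r of n modulo p.  Along n = k p + r the vectors
    (a_{n+1} p_{n+1}, p_n) are transported by one-period transfer matrices M_k(E)
    of determinant one, polynomial in E, which converge to the periodic ones and,
    by hypothesis, have summable increments in k.  Inside the bands these matrices
    are elliptic: in suitable coordinates M_k(E) is the rotation by an angle
    phi_k(E) with 2 cos phi_k = tr M_k, chosen increasing in E
    ([elliptic_rotation], [phase]).  Passing from the coordinates of one block to
    those of the next costs a summable relative error.  Hence the state, with the
    accumulated rotation Phi_k = phi_0 + ... + phi_{k-1} undone, converges
    uniformly in E, and on a short interval of energies the state of a late block
    is, up to a small relative error, the rotation by Phi_k(E') - Phi_k(E) of the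
    state at E ([state_rotation]).

    A zero of p_n is an energy where the second coordinate of the state vanishes.
    Between two consecutive zeros the state makes half a turn: after a full turn
    there would have been another zero in between, and a very small turn is
    excluded because p_{n+1} vanishes between two zeros of p_n, which moves the
    state away from the first axis ([half_turn_spacing]).  As the angles phi_k
    converge with their derivatives to the angle phi of the periodic problem,
    Phi_k(E') - Phi_k(E) = k phi'(E) (E' - E) (1 + o(1)) uniformly
    ([phase_increment]), so that n (E' - E) tends to pi p / phi'(E)
    ([phase_clock]).  Differentiating 2 cos gamma = Delta, for gamma decreasing,
    identifies phi' with - gamma' ([floquet_speed]).

    The existence of the density of states is independent of this and holds on the
    whole line.  Interlacing turns the number of zeros of p_n below x into a number
    of sign patterns of p_0(x), ..., p_n(x) ([nbelow_zerosS]), and by a discrete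
    Sturm comparison this number depends on the initial condition only up to one
    ([sturm_comparison]).  It is therefore almost additive over windows of sites,
    and on late windows almost that of the periodic coefficients: the normalized
    counting functions converge, to a continuous function ([cvg_ids],
    [continuous_ids]).  Convergence of the counting functions gives weak
    convergence to the Stieltjes measure of the limit ([weak_limit_zero_measure]).
    In the bands the phase counts zeros, which makes the increments of the limit
    equal to those of phi / (pi p) ([ids_increment]); by the fundamental theorem
    of calculus the measure has there the density - gamma' / (pi p)
    ([has_density_of_primitive]). *)

(** * Counting in sorted sequences *)

Definition nbelow (R : realType) (s : seq R) (x : R) : nat :=
  count (fun z => z < x) s.

Lemma nbelow_unique (R : realType) (s : seq R) (x : R) (k : nat) :
  (k <= size s)%N -> (forall i, (i < k)%N -> s`_i < x) ->
  (forall i, (k <= i < size s)%N -> x <= s`_i) -> nbelow s x = k.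
Proof.
move=> ks lo hi; rewrite /nbelow -{1}(cat_take_drop k s) count_cat.
have /eqP -> : count (fun z => z < x) (take k s) == k.
  have {2}<- : size (take k s) = k by rewrite size_take_min; apply/minn_idPl.
  rewrite -all_count; apply/(all_nthP 0) => i.
  rewrite size_take_min (minn_idPl ks) => ik.
  by rewrite nth_take //; exact: lo.
rewrite (@eq_in_count _ _ pred0) ?count_pred0 ?addn0 // => z /(nthP 0)[i].
rewrite size_drop nth_drop => ik <- /=; apply/negbTE; rewrite -leNgt; apply: hi.
by rewrite leq_addr -ltn_subRL.
Qed.

Lemma nth_lt_nbelow (R : realType) (s : seq R) (x : R) (i : nat) :
  sorted <%R s -> (i < size s)%N -> (s`_i < x) = (i < nbelow s x)%N.
Proof.
move=> ss; rewrite /nbelow; elim: s i ss => [|z s IH] i //= ss.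
have ss' := path_sorted ss.
have zs : all (fun y => z < y) s by apply: order_path_min => //; exact: lt_trans.
case: i => [_|i].
  case: ltP => //= xz; symmetry; apply/negbTE; rewrite -leqNgt leqn0.
  rewrite (@eq_in_count _ _ pred0) ?count_pred0 // => y ys /=.
  by apply/negbTE; rewrite -leNgt (le_trans xz) // ltW // (allP zs).
rewrite /= ltnS => iss; rewrite IH //; case: ltP => //= xz.
rewrite (@eq_in_count _ _ pred0) ?count_pred0 // => y ys /=.
by apply/negbTE; rewrite -leNgt (le_trans xz) // ltW // (allP zs).
Qed.

Lemma nbelow_homo (R : realType) (s : seq R) (x y : R) :
  x <= y -> (nbelow s x <= nbelow s y)%N.
Proof. by move=> xy; apply: sub_count => z /= zx; exact: lt_le_trans xy. Qed.

Lemma nbelow_le_size (R : realType) (s : seq R) (x : R) :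
  (nbelow s x <= size s)%N.
Proof. exact: count_size. Qed.

Lemma sgz_prod_XsubC (R : realType) (s : seq R) (x : R) : x \notin s ->
  0 < (-1) ^+ (size s + nbelow s x) * (\prod_(z <- s) ('X - z%:P)).[x].
Proof.
elim: s => [|z s IH]; first by rewrite big_nil hornerC mulr1 expr0 ltr01.
rewrite inE negb_or => /andP[xz /IH{}IH].
rewrite big_cons hornerM hornerXsubC /= /nbelow /=.
case: (ltgtP z x) xz => //= zx _.
- rewrite addnS addSn -[(size s + _)%N]/(size s + nbelow s x)%N !exprS.
  by rewrite !mulN1r opprK mulrCA mulr_gt0 // subr_gt0.
- rewrite add0n addSn -[(size s + _)%N]/(size s + nbelow s x)%N !exprS.
  by rewrite mulN1r mulNr mulrCA -mulNr opprB mulr_gt0 // subr_gt0.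
Qed.

(** * The zeros of orthogonal polynomials *)

Lemma orthopoly0 (R : realType) (a b : nat -> R) : orthopoly a b 0 = 1.
Proof. by []. Qed.

Lemma orthopoly_pairE (R : realType) (a b : nat -> R) n :
  orthopoly_pair a b n.+1 = (orthopoly a b n.+1, orthopoly a b n).
Proof. by rewrite /orthopoly /=; case: (orthopoly_pair a b n). Qed.

Lemma orthopoly1 (R : realType) (a b : nat -> R) : 0 < a 1%N ->
  a 1%N *: orthopoly a b 1 = 'X - (b 1%N)%:P.
Proof.
move=> a1; rewrite /orthopoly /= mulr1 scaler0 subr0 scalerA divff ?scale1r //.
by rewrite gt_eqF.
Qed.

Lemma orthopolyS (R : realType) (a b : nat -> R) n : 0 < a n.+2 ->
  a n.+2 *: orthopoly a b n.+2 =
  ('X - (b n.+2)%:P) * orthopoly a b n.+1 - a n.+1 *: orthopoly a b n.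
Proof.
move=> an; rewrite {1}/orthopoly.
rewrite -[orthopoly_pair a b n.+2]/(let: (q, q') := orthopoly_pair a b n.+1 in
    ((a n.+2)^-1 *: (('X - (b n.+2)%:P) * q - a n.+1 *: q'), q)).
by rewrite orthopoly_pairE /= scalerA divff ?scale1r // gt_eqF.
Qed.

Lemma orthopoly_size_lead (R : realType) (a b : nat -> R) :
  (forall n, 0 < a n.+1) -> forall n,
  size (orthopoly a b n) = n.+1 /\ 0 < lead_coef (orthopoly a b n).
Proof.
move=> a0.
have step c d n (q q' : {poly R}) : 0 < c -> size q = n.+1 ->
    0 < lead_coef q -> (size q' <= n.+1)%N ->
    let r := c^-1 *: (('X - d%:P) * q - q') in
    size r = n.+2 /\ 0 < lead_coef r.
  move=> c0 sq lq sq' /=.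
  have sm : size (('X - d%:P) * q) = n.+2.
    by rewrite size_monicM ?monicXsubC ?size_XsubC ?sq // -size_poly_eq0 sq.
  have c1 : c^-1 != 0 by rewrite invr_eq0 gt_eqF.
  rewrite size_scale // lead_coefZ size_polyDl ?size_polyN ?sm ?ltnS //.
  rewrite lead_coefDl ?size_polyN ?sm ?ltnS // lead_coef_monicM ?monicXsubC //.
    by split=> //; rewrite mulr_gt0 // invr_gt0.
suff H n : (size (orthopoly a b n) = n.+1 /\ 0 < lead_coef (orthopoly a b n)) /\
    (size (orthopoly a b n.+1) = n.+2 /\ 0 < lead_coef (orthopoly a b n.+1)).
  by move=> n; case: (H n).
elim: n => [|n [[s0 l0] [s1 l1]]].
  have s1 : size (1 : {poly R}) = 1%N by rewrite size_poly1.
  have l1 : 0 < lead_coef (1 : {poly R}) by rewrite lead_coef1.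
  split; first by split.
  have := @step (a 1%N) (b 1%N) 0%N 1 0 (a0 0%N) s1 l1.
  by rewrite size_poly0 => /(_ isT) /=; rewrite /orthopoly /= scaler0.
split=> //.
have := @step (a n.+2) (b n.+2) n.+1 _ (a n.+1 *: orthopoly a b n)
  (a0 n.+1) s1 l1.
rewrite size_scale ?s0 ?gt_eqF // => /(_ (leqnSn _)) /=.
rewrite -(orthopolyS b (a0 n.+1)) scalerA mulVf ?scale1r ?gt_eqF //.
Qed.

Lemma orthopoly_neq0 (R : realType) (a b : nat -> R) n :
  (forall n, 0 < a n.+1) -> orthopoly a b n != 0.
Proof.
by move=> a0; rewrite -size_poly_eq0; case: (orthopoly_size_lead b a0 n) => ->.
Qed.

Lemma zeros_sorted (R : realType) (a b : nat -> R) n :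
  sorted <%R (zeros a b n).
Proof. exact: sorted_roots. Qed.

Lemma mem_zeros (R : realType) (a b : nat -> R) n x :
  (forall n, 0 < a n.+1) -> (x \in zeros a b n) = root (orthopoly a b n) x.
Proof.
by move=> a0; rewrite -(roots_on_rootsR (orthopoly_neq0 b n a0)) in_itv.
Qed.

(** A polynomial with as many distinct real zeros as its degree is a positive
    multiple of the product of its linear factors, so that its sign at a point is
    the parity of the number of zeros above that point. *)
Lemma sgr_split_poly (R : realType) (q : {poly R}) (x : R) : q != 0 ->
  0 < lead_coef q -> size q = (size (rootsR q)).+1 -> ~~ root q x ->
  0 < (-1) ^+ (size (rootsR q) + nbelow (rootsR q) x) * q.[x].
Proof.
move=> q0 lq sq qx; have memq y : (y \in rootsR q) = root q y.
  by rewrite -(roots_on_rootsR q0) in_itv.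
have qE : q = lead_coef q *: \prod_(z <- rootsR q) ('X - z%:P).
  apply: all_roots_prod_XsubC => //; first by apply/allP => y; rewrite memq.
  rewrite uniq_rootsE; apply: sorted_uniq (sorted_roots _ _ _).
    exact: lt_trans.
  exact: ltxx.
rewrite {3}qE hornerZ mulrCA mulr_gt0 //; apply: sgz_prod_XsubC.
by rewrite memq.
Qed.

(** Recognizes the list of zeros once enough of them have been located by the
    intermediate value theorem. *)
Lemma rootsR_unique (R : realType) (q : {poly R}) (s : seq R) : q != 0 ->
  size q = (size s).+1 -> all (root q) s -> sorted <%R s -> rootsR q = s.
Proof.
move=> q0 sq qs ss.
have us : uniq s by apply: sorted_uniq ss; [exact: lt_trans | exact: ltxx].
have qE : q = lead_coef q *: \prod_(z <- s) ('X - z%:P).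
  by apply: all_roots_prod_XsubC; rewrite ?uniq_rootsE.
apply: lt_sorted_eq => //; first exact: sorted_roots.
move=> x; rewrite -(roots_on_rootsR q0) in_itv /=.
by rewrite qE rootZ ?lead_coef_eq0 // root_prod_XsubC.
Qed.

Section Interlacing.
Variables (R : realType) (a b : nat -> R).
Hypothesis a0 : forall n, 0 < a n.+1.

Local Notation P := (orthopoly a b).
Local Notation Z := (zeros a b).

Lemma horner_orthopolyS n x :
  a n.+2 * (P n.+2).[x] = (x - b n.+2) * (P n.+1).[x] - a n.+1 * (P n).[x].
Proof.
have /(congr1 (fun q => q.[x])) := orthopolyS b (a0 n.+1).
by rewrite hornerD hornerN !hornerZ hornerM hornerXsubC.
Qed.

Lemma horner_orthopoly1 x : a 1%N * (P 1).[x] = x - b 1%N.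
Proof. have /(congr1 (fun q => q.[x])) := orthopoly1 b (a0 0%N).
by rewrite hornerZ hornerXsubC. Qed.

Lemma zeros_leq n i j : (i < size (Z n))%N -> (j < size (Z n))%N ->
  ((Z n)`_i <= (Z n)`_j) = (i <= j)%N.
Proof. by move=> i_n j_n; rewrite lt_sorted_leq_nth ?zeros_sorted. Qed.

Lemma zeros_ltn n i j : (i < size (Z n))%N -> (j < size (Z n))%N ->
  ((Z n)`_i < (Z n)`_j) = (i < j)%N.
Proof. by move=> i_n j_n; rewrite lt_sorted_ltn_nth ?zeros_sorted. Qed.

Definition interlaced n := [/\ size (Z n) = n, size (Z n.+1) = n.+1 &
  forall i, (i < n)%N -> (Z n.+1)`_i < (Z n)`_i < (Z n.+1)`_i.+1].

Lemma root_zeros n i : (i < size (Z n))%N -> (P n).[(Z n)`_i] = 0.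
Proof. by move=> i_n; apply/eqP; rewrite -[_ == 0]/(root _ _) -mem_zeros // mem_nth. Qed.

Lemma sgr_orthopoly n x : size (Z n) = n -> ~~ root (P n) x ->
  0 < (-1) ^+ (n + nbelow (Z n) x) * (P n).[x].
Proof.
move=> sz Px; have [sP lP] := orthopoly_size_lead b a0 n.
rewrite -{1}sz; apply: sgr_split_poly => //; first exact: orthopoly_neq0.
by rewrite sP -/(Z n) sz.
Qed.

(** The values of p_{n+2} at the zeros of p_{n+1} have the sign opposite to those
   of p_n, which alternate because of the interlacing. *)
Lemma sgr_next_at_zeros n i : interlaced n -> (i < n.+1)%N ->
  0 < (-1) ^+ (n.+1 + i) * (P n.+2).[(Z n.+1)`_i].
Proof.
move=> [sn sn1 itl] i_n; set w := (Z n.+1)`_i.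
have nb : nbelow (Z n) w = i.
  apply: nbelow_unique; first by rewrite sn.
    move=> j ji; have jn : (j < n)%N by lia.
    have /andP[_ h] := itl j jn; apply: lt_le_trans h _.
    by rewrite zeros_leq ?sn1.
  move=> j; rewrite sn => /andP[ij jn]; have /andP[h _] := itl j jn.
  by apply: ltW; apply: le_lt_trans h; rewrite zeros_leq ?sn1 // ltnW.
have nr : ~~ root (P n) w.
  rewrite -mem_zeros //; apply/negP => /(nthP 0)[j]; rewrite sn => jn zj.
  have /andP[] := itl j jn; rewrite zj !zeros_ltn ?sn1 //; last by rewrite ltnW.
  lia.
have := sgr_orthopoly sn nr; rewrite nb => h.
have := horner_orthopolyS n w; rewrite root_zeros ?sn1 // mulr0 sub0r => e.
have e' : (P n.+2).[w] = - (a n.+1 / a n.+2 * (P n).[w]).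
  apply: (mulfI (x := a n.+2)); first by rewrite gt_eqF.
  by rewrite e; field; rewrite gt_eqF.
rewrite e' addSn exprS mulN1r mulrNN mulrCA; apply: mulr_gt0 => //.
by rewrite divr_gt0.
Qed.

Lemma sgr_at_pinfty n : exists T, forall x, T <= x -> 0 < (P n).[x].
Proof.
have P0 := orthopoly_neq0 b n a0; have [sP lP] := orthopoly_size_lead b a0 n.
exists (cauchy_bound (P n)) => x xT; rewrite -sgr_gt0.
rewrite (sgp_pinftyP (ge_cauchy_bound P0)) ?in_itv /= ?xT //.
by rewrite /sgp_pinfty sgr_gt0.
Qed.

Lemma sgr_at_minfty n : exists T, forall x, x <= T -> 0 < (-1) ^+ n * (P n).[x].
Proof.
have P0 := orthopoly_neq0 b n a0; have [sP lP] := orthopoly_size_lead b a0 n.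
exists (- cauchy_bound (P n)) => x xT; rewrite -sgr_gt0 sgrM.
rewrite (sgp_minftyP (le_cauchy_bound P0)) ?in_itv /= ?xT //.
by rewrite /sgp_minfty sP /= -sgrM sgr_gt0 mulrA -exprD addnn -signr_odd odd_double expr0 mul1r.
Qed.

(** At the zeros of p_{n+1} the signs of p_{n+2} alternate, and beyond the extreme
    ones they are those of the leading term; the intermediate value theorem puts
    one zero of p_{n+2} in each of the n+2 intervals so obtained. *)
Lemma zeros_interlaced n : interlaced n.
Proof.
elim: n => [|n IH].
  have z0 : Z 0 = [::].
    by apply: rootsR_unique => //; [exact: orthopoly_neq0 | rewrite size_poly1].
  have z1 : Z 1 = [:: b 1%N].
    apply: rootsR_unique => //; first exact: orthopoly_neq0.
      by case: (orthopoly_size_lead b a0 1).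
    by move/eqP: (horner_orthopoly1 (b 1%N)); rewrite subrr mulf_eq0 gt_eqF //= andbT.
  by split; rewrite ?z0 ?z1.
have [sn sn1 itl] := IH.
have [T1 hT1] := sgr_at_minfty n.+2; have [T2 hT2] := sgr_at_pinfty n.+2.
set w := Z n.+1.
(* t_0 < ... < t_{n+2}: the zeros of p_{n+1} between two far away points. *)
pose t i := if i is j.+1 then (if (j < n.+1)%N then w`_j else Num.max T2 (w`_n + 1))
            else Num.min T1 (w`_0 - 1).
have tlt i : (i < n.+2)%N -> t i < t i.+1.
  case: i => [_|i] /=; first by rewrite gt_min ltrBlDr ltrDl ltr01 orbT.
  rewrite !ltnS => i_n; rewrite i_n; case: ifP => h.
    by rewrite zeros_ltn ?sn1.
  have -> : i = n by lia.
  by rewrite lt_max ltrDl ltr01 orbT.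
have sgt i : (i < n.+3)%N -> 0 < (-1) ^+ (n.+2 + i) * (P n.+2).[t i].
  case: i => [_|i]; first by rewrite addn0 hT1 // ge_min lexx.
  rewrite ltnS /t => i_n; case: ifP => h.
    have := sgr_next_at_zeros IH h.
    by rewrite -[(n.+2 + _)%N]/(n.+1 + i.+1).+1 addnS !exprS mulrA mulrNN mul1r mul1r.
  have -> : i = n.+1 by lia.
  by rewrite addnn -signr_odd odd_double expr0 mul1r hT2 // le_max lexx.
have sgtt i : (i < n.+2)%N -> (P n.+2).[t i] * (P n.+2).[t i.+1] < 0.
  move=> i_n; have h1 := sgt i (ltnW i_n); have h2 := sgt i.+1 i_n.
  have := mulr_gt0 h1 h2; rewrite addnS exprS mulN1r mulNr mulrN oppr_gt0 mulrACA.
  by rewrite -exprD addnn -signr_odd odd_double expr0 mul1r.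
have /choice[y hy] i : exists y, (i < n.+2)%N -> t i < y < t i.+1 /\ root (P n.+2) y.
  case: (boolP (i < n.+2)%N) => i_n; last by exists 0.
  have [y] := poly_ivtoo (ltW (tlt i i_n)) (sgtt i i_n).
  by rewrite in_itv /= => ty ry; exists y.
have ZE : Z n.+2 = mkseq y n.+2.
  apply: rootsR_unique; first exact: orthopoly_neq0.
  - by rewrite size_mkseq; case: (orthopoly_size_lead b a0 n.+2).
  - apply/(all_nthP 0) => i; rewrite size_mkseq => i_n.
    by rewrite nth_mkseq //; case: (hy i i_n).
  - apply/(sortedP 0) => i; rewrite size_mkseq => i_n.
    rewrite !nth_mkseq //; last exact: ltnW.
    have [/andP[_ h1] _] := hy i (ltnW i_n); have [/andP[h2 _] _] := hy i.+1 i_n.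
    exact: lt_trans h1 h2.
split=> //; first by rewrite ZE size_mkseq.
move=> i i_n; rewrite ZE !nth_mkseq //; last by rewrite ltnW.
have [/andP[_ h1] _] := hy i (ltnW i_n); have [/andP[h2 _] _] := hy i.+1 i_n.
by move: h1 h2; rewrite /t i_n => -> ->.
Qed.

Lemma size_zeros n : size (Z n) = n.
Proof. by case: (zeros_interlaced n). Qed.

Lemma zeros_interlace n i : (i < n)%N ->
  (Z n.+1)`_i < (Z n)`_i < (Z n.+1)`_i.+1.
Proof. by have [_ _] := zeros_interlaced n; apply. Qed.

Lemma root_between n x y : x < y -> root (P n) x -> root (P n) y ->
  exists2 t, x < t < y & root (P n.+1) t.
Proof.
move=> + rx ry; move: rx ry; rewrite -!mem_zeros //.
move=> /(nthP 0)[i]; rewrite size_zeros => i_n <-.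
move=> /(nthP 0)[j]; rewrite size_zeros => j_n <-.
rewrite zeros_ltn ?size_zeros // => ij.
exists (Z n.+1)`_i.+1; last by rewrite -mem_zeros // mem_nth // size_zeros.
have /andP[_ ->] := zeros_interlace i_n; have /andP[+ _] := zeros_interlace j_n.
by apply: le_lt_trans; rewrite zeros_leq ?size_zeros // ltnW.
Qed.

(** Every zero of p_n below x forces, by interlacing, a zero of p_{n+1} below x,
    and at most one more can occur; the parity of both counts is visible in the
    signs of p_n and p_{n+1} at x. *)
Lemma nbelow_zerosS n x : nbelow (Z n.+1) x =
  (nbelow (Z n) x + (((P n).[x] == 0) || (0 < (P n).[x] * (P n.+1).[x]))%R)%N.
Proof.
set k := nbelow (Z n) x; have kn : (k <= n)%N by rewrite -(size_zeros n) nbelow_le_size.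
have lo i : (i < k)%N -> (Z n.+1)`_i < x.
  move=> ik; have i_n := leq_trans ik kn; have /andP[h _] := zeros_interlace i_n.
  by apply: lt_trans h _; rewrite nth_lt_nbelow ?zeros_sorted ?size_zeros.
have hi i : (k < i < n.+1)%N -> x < (Z n.+1)`_i.
  case: i => // i; rewrite !ltnS => /andP[ki i_n].
  have /andP[_ h] := zeros_interlace i_n; apply: le_lt_trans h.
  by rewrite leNgt nth_lt_nbelow ?zeros_sorted ?size_zeros // -leqNgt.
have nb : nbelow (Z n.+1) x = (k + ((Z n.+1)`_k < x)%R)%N.
  apply: nbelow_unique; rewrite ?size_zeros; first by case: (_ < x) => /=; lia.
    move=> i; case: (boolP ((Z n.+1)`_k < x)) => /= h; last by rewrite addn0; exact: lo.
    by rewrite addn1 ltnS leq_eqVlt => /orP[/eqP->//|]; exact: lo.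
  move=> i; case: (boolP ((Z n.+1)`_k < x)) => /= h.
    by rewrite addn1 => /hi/ltW.
  rewrite addn0 leq_eqVlt => /andP[/orP[/eqP<- _|ki i_n]]; first by rewrite leNgt.
  by apply/ltW/hi/andP.
rewrite nb; congr (_ + nat_of_bool _)%N.
have [/eqP rx|nrx] /= := boolP ((P n).[x] == 0).
  have : x \in Z n by rewrite mem_zeros // /root rx.
  move=> /(nthP 0)[i]; rewrite size_zeros => i_n zx.
  have : ~~ (i < k)%N by rewrite -nth_lt_nbelow ?zeros_sorted ?size_zeros // zx ltxx.
  rewrite -leqNgt => ki; have /andP[h _] := zeros_interlace i_n.
  by rewrite -zx; apply: le_lt_trans h; rewrite zeros_leq ?size_zeros //; exact: leqW.
have [/eqP rx|nrx1] /= := boolP ((P n.+1).[x] == 0).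
  rewrite rx mulr0 ltxx; apply/negbTE/negP => h.
  have : x \in Z n.+1 by rewrite mem_zeros // /root rx.
  move=> /(nthP 0)[i]; rewrite size_zeros => i_n zx.
  case: (ltngtP i k) => [/lo|ki|ik]; last by rewrite -ik zx ltxx in h.
    by rewrite zx ltxx.
  by have := hi i; rewrite ki i_n zx ltxx => /(_ isT).
have h1 := sgr_orthopoly (size_zeros n) nrx.
have h2 := sgr_orthopoly (size_zeros n.+1) nrx1.
have := mulr_gt0 h1 h2; rewrite mulrACA nb -exprD.
rewrite -/k addSn addnS !addnA addnAC -signr_odd /= !oddD.
case: ((Z n.+1)`_k < x); case: (odd n); case: (odd k) => /=;
  rewrite ?expr0 ?expr1 ?mul1r ?mulN1r ?oppr_gt0 // => h;
  by [rewrite h | rewrite lt_gtF].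
Qed.

End Interlacing.

(** * Discrete Sturm comparison *)

(** A step without change of sign, where a zero counts as having the sign of its
    successor.  By interlacing these steps count the zeros of p_n below x. *)
Definition rises (R : realType) (x y : R) : bool := (x == 0) || (0 < x * y).

Definition rise_count (R : realType) (u : nat -> R) (n : nat) : nat :=
  (\sum_(i < n) rises (u i) (u i.+1))%N.

Definition jacobi_solution (R : realType) (a b : nat -> R) (x : R)
    (u : nat -> R) : Prop :=
  (forall i, a i.+2 * u i.+2 = (x - b i.+2) * u i.+1 - a i.+1 * u i) /\
  ~ (u 0%N = 0 /\ u 1%N = 0).

Lemma rise_countS (R : realType) (u : nat -> R) n :
  rise_count u n.+1 = (rise_count u n + rises (u n) (u n.+1))%N.
Proof. by rewrite /rise_count big_ord_recr. Qed.

(** Ahead of v and by less than a full turn: the two alternatives locate the line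
    through (u_n, u_{n+1}) on the universal cover of the projective line,
    relatively to the line through (v_n, v_{n+1}), by signs only. *)
Lemma sturm_step (R : realType) (u0 u1 v0 v1 : R) : u0 * v1 < u1 * v0 ->
  v0 != 0 -> 0 <= u0 * v0 ->
  [/\ rises u0 u1 = rises v0 v1, v1 != 0 & 0 <= u1 * v1] \/
  [/\ rises u0 u1 = true, rises v0 v1 = false, u1 != 0 & u1 * v1 <= 0].
Proof.
rewrite /rises => w v00 uv.
case: (ltgtP v0 0) v00 => // hv0 _;
 case: (ltgtP u0 0) => hu0 /=; try (by nra);
 case: (ltgtP u1 0) => hu1; case: (ltgtP v1 0) => hv1;
 rewrite ?hu1 ?hv1 ?hu0 ?mulr0 ?mul0r ?(nmulr_rgt0 _ hv0) ?(pmulr_rgt0 _ hv0) ?(nmulr_rgt0 _ hu0) ?(pmulr_rgt0 _ hu0) ?(nmulr_rge0 _ hu1) ?(pmulr_rge0 _ hu1)  ?(nmulr_rle0 _ hu1) ?(pmulr_rle0 _ hu1) //;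
 try (by nra);
 try (by left; split => //; rewrite ?(lt_gtF hu0) ?(lt_gtF hu1) ?(lt_gtF hv1) ?hu1 ?hv1 //; try lra);
 try (by right; split => //; rewrite ?(lt_gtF hu0) ?(lt_gtF hu1) ?(lt_gtF hv1) ?hu1 ?hv1 //; try lra).
Qed.

Lemma sturm_core (R : realType) (u v : nat -> R) :
  (forall i, u i * v i.+1 < u i.+1 * v i) -> v 0%N != 0 -> 0 <= u 0%N * v 0%N ->
  forall n, [/\ rise_count u n = rise_count v n, v n != 0 & 0 <= u n * v n] \/
    [/\ rise_count u n = (rise_count v n).+1, u n != 0 & u n * v n <= 0].
Proof.
move=> w v0 uv0; elim=> [|n [[e vn uv]|[e un uv]]].
- by left; rewrite /rise_count !big_ord0.
- rewrite !rise_countS e.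
  case: (sturm_step (w n) vn uv) => [[-> ? ?]|[-> -> ? ?]]; [left | right] => //.
  by split=> //; rewrite addn1 addn0.
- have w' : v n * (- u n.+1) < v n.+1 * (- u n).
    by rewrite !mulrN ltrN2 mulrC (mulrC (v n)).
  have un' : - u n != 0 by rewrite oppr_eq0.
  have uv' : 0 <= v n * - u n by rewrite mulrN oppr_ge0 mulrC.
  have rN x y : rises (- x) (- y) = rises x y :> bool.
    by rewrite /rises oppr_eq0 mulrNN.
  rewrite !rise_countS e; case: (sturm_step w' un' uv') => [[]|[]].
    rewrite rN => -> h1 h2; right; split; first by rewrite addSn.
      by rewrite -oppr_eq0.
    by rewrite -oppr_ge0 -mulNr mulrC.
  rewrite rN => -> -> h1 h2; left; split=> //; first by rewrite addn0 addn1.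
  by rewrite -oppr_le0 -mulNr mulrC.
Qed.

Lemma wronskian_const (R : realType) (a b : nat -> R) (x : R) (u v : nat -> R) :
  (forall i, a i.+2 * u i.+2 = (x - b i.+2) * u i.+1 - a i.+1 * u i) ->
  (forall i, a i.+2 * v i.+2 = (x - b i.+2) * v i.+1 - a i.+1 * v i) ->
  forall i, a i.+1 * (u i.+1 * v i - u i * v i.+1) =
            a 1%N * (u 1%N * v 0%N - u 0%N * v 1%N).
Proof.
move=> ru rv; elim=> // i <-; rewrite mulrBr !mulrA ru (mulrAC _ (u i.+1)) rv.
ring.
Qed.

(** Two solutions of the same three-term recurrence rise equally often, up to
    one.  The constant Wronskian keeps one solution ahead of the other on the
    universal cover of the projective line, by less than one full turn. *)
Lemma sturm_comparison (R : realType) (a b : nat -> R) (x : R) (u v : nat -> R) :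
  (forall n, 0 < a n.+1) ->
  jacobi_solution a b x u -> jacobi_solution a b x v -> forall n,
  (rise_count u n <= (rise_count v n).+1)%N.
Proof.
move=> a0 [ru nu] [rv nv].
have wr := wronskian_const ru rv.
set W := u 1%N * v 0%N - u 0%N * v 1%N in wr.
have pos (s t : nat -> R) : (forall i, a i.+1 * (s i.+1 * t i - s i * t i.+1) =
    a 1%N * (s 1%N * t 0%N - s 0%N * t 1%N)) ->
    0 < s 1%N * t 0%N - s 0%N * t 1%N -> forall n,
    ((rise_count s n <= (rise_count t n).+1) && (rise_count t n <= (rise_count s n).+1))%N.
  move=> wst w n.
  have lt i : s i * t i.+1 < s i.+1 * t i.
    rewrite -subr_gt0; have := mulr_gt0 (a0 0%N) w; rewrite -(wst i).
    by rewrite pmulr_rgt0.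
  have [t0|t0] := boolP ((t 0%N != 0) && (0 <= s 0%N * t 0%N)).
    have /andP[t0' st] := t0.
    case: (@sturm_core _ s t lt t0' st n) => -[-> _ _]; first by rewrite !leqnSn.
    by rewrite leqnn ltnW // ltnS leqnSn.
  have lt' i : t i * (- s i.+1) < t i.+1 * (- s i).
    by rewrite !mulrN ltrN2 mulrC (mulrC (t i)).
  have s0 : - s 0%N != 0.
    rewrite oppr_eq0; apply/eqP => s0; move: t0 (lt 0%N); rewrite s0 !mul0r lexx andbT.
    by rewrite negbK => /eqP ->; rewrite mulr0 ltxx.
  have ts0 : 0 <= t 0%N * - s 0%N.
    move: t0; rewrite negb_and negbK => /orP[/eqP ->|]; first by rewrite mul0r.
    by rewrite -ltNge mulrN oppr_ge0 mulrC => /ltW.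
  have e : rise_count (fun i => - s i) n = rise_count s n.
    by apply: eq_bigr => i _; rewrite /rises oppr_eq0 mulrNN.
  rewrite -e; case: (@sturm_core _ t (fun i => - s i) lt' s0 ts0 n) => -[-> _ _];
  rewrite ?leqnn ?leqnSn //; lia.
move=> n; case: (ltgtP W 0) => W0.
- have /pos : forall i, a i.+1 * (v i.+1 * u i - v i * u i.+1) =
    a 1%N * (v 1%N * u 0%N - v 0%N * u 1%N).
    move=> i; have := wr i; rewrite /W => h; nra.
  have : 0 < v 1%N * u 0%N - v 0%N * u 1%N by rewrite /W in W0; nra.
  by move=> w /(_ w n) /andP[].
- by have /andP[] := pos u v wr W0 n.
- have ntriv (s : nat -> R) :
      (forall i, a i.+2 * s i.+2 = (x - b i.+2) * s i.+1 - a i.+1 * s i) ->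
      ~ (s 0%N = 0 /\ s 1%N = 0) -> forall i, ~ (s i = 0 /\ s i.+1 = 0).
    move=> rs ns; elim=> // i IH [s1 s2]; apply: IH; split=> //.
    have := rs i; rewrite s1 s2 !mulr0 sub0r => /eqP.
    by rewrite eq_sym oppr_eq0 mulf_eq0 gt_eqF //= => /eqP.
  suff -> : rise_count u n = rise_count v n by exact: leqnSn.
  apply: eq_bigr => -[i _] _ /=; congr nat_of_bool.
  have nui := ntriv u ru nu i; have nvi := ntriv v rv nv i.
  have e : u i.+1 * v i = u i * v i.+1.
    have := wr i; rewrite W0 mulr0 => /eqP; rewrite mulf_eq0 gt_eqF //=.
    by rewrite subr_eq0 => /eqP.
  rewrite /rises; case: (eqVneq (u i) 0) => [u0|u0] /=.
    move: e; rewrite u0 mul0r => /eqP; rewrite mulf_eq0 => /orP[/eqP u1|->] //.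
    by case: nui.
  case: (eqVneq (v i) 0) => [v0|v0] /=.
    move: e; rewrite v0 mulr0 => /esym/eqP; rewrite mulf_eq0 (negbTE u0) => /eqP v1.
    by case: nvi.
  have vE : v i.+1 = u i.+1 / u i * v i by rewrite mulrAC e mulrC mulKf.
  have -> : u i * u i.+1 = u i ^+ 2 * (u i.+1 / u i).
    by rewrite expr2 -mulrA (mulrCA (u i) (u i.+1)) divff // mulr1.
  have -> : v i * v i.+1 = v i ^+ 2 * (u i.+1 / u i) by rewrite vE expr2; ring.
  have sq (z : R) : z != 0 -> 0 < z ^+ 2 by move=> z0; rewrite exprn_even_gt0.
  by rewrite (pmulr_rgt0 _ (sq _ u0)) (pmulr_rgt0 _ (sq _ v0)).
Qed.

Definition shift_seq (T : Type) (m : nat) (u : nat -> T) : nat -> T :=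
  fun i => u (m + i)%N.

Section Additivity.
Variables (R : realType) (a b : nat -> R).
Hypothesis a0 : forall n, 0 < a n.+1.

Lemma nbelow_zeros_cat m n x : nbelow (zeros a b (m + n)) x =
  (nbelow (zeros a b m) x +
   rise_count (fun i => (orthopoly a b (m + i)).[x]) n)%N.
Proof.
elim: n => [|n IH]; first by rewrite addn0 /rise_count big_ord0 addn0.
by rewrite rise_countS addnA -IH !addnS nbelow_zerosS.
Qed.

Lemma nbelow_zeros_rises n x : nbelow (zeros a b n) x =
  rise_count (fun i => (orthopoly a b i).[x]) n.
Proof.
rewrite -[n in LHS]add0n nbelow_zeros_cat.
by have := nbelow_le_size (zeros a b 0) x; rewrite size_zeros // leqn0 => /eqP ->.
Qed.

Lemma orthopoly_consecutive n x :
  ~ ((orthopoly a b n).[x] = 0 /\ (orthopoly a b n.+1).[x] = 0).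
Proof.
elim: n => [|n IH] [e1 e2]; first by move: e1; rewrite orthopoly0 hornerE => /eqP; rewrite oner_eq0.
apply: IH; split=> //; have := horner_orthopolyS b a0 n x.
rewrite e1 e2 !mulr0 sub0r => /eqP.
by rewrite eq_sym oppr_eq0 mulf_eq0 gt_eqF //= => /eqP.
Qed.

Lemma jacobi_solution_orthopoly m x :
  jacobi_solution (shift_seq m a) (shift_seq m b) x
    (fun i => (orthopoly a b (m + i)).[x]).
Proof.
split=> [i|]; last by rewrite !(addn0, addnS); exact: orthopoly_consecutive.
by rewrite /shift_seq !addnS horner_orthopolyS.
Qed.

End Additivity.

(** Restarting the recurrence at m replaces the tail of the orthogonal polynomials
    by another solution of the same recurrence, which costs at most one zero. *)
Lemma nbelow_zeros_additive (R : realType) (a b : nat -> R) m n x :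
  (forall n, 0 < a n.+1) ->
  let N := nbelow (zeros a b m) x in
  let N' := nbelow (zeros (shift_seq m a) (shift_seq m b) n) x in
  (nbelow (zeros a b (m + n)) x <= (N + N').+1)%N /\
  (N + N' <= (nbelow (zeros a b (m + n)) x).+1)%N.
Proof.
move=> a0 N N'; have a0' n' : 0 < shift_seq m a n'.+1 by rewrite /shift_seq addnS.
have s1 := jacobi_solution_orthopoly b a0 m x.
have s2 := jacobi_solution_orthopoly (shift_seq m b) a0' 0 x.
rewrite nbelow_zeros_cat // /N' (nbelow_zeros_rises _ a0').
have h1 := sturm_comparison a0' s1 s2 n; have h2 := sturm_comparison a0' s2 s1 n.
by split; rewrite -addnS leq_add2l.
Qed.

(** * The integrated density of states *)

Fixpoint solution_pair (R : realType) (a b : nat -> R) (x s : R) (n : nat) : R * R :=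
  if n is m.+1 then
    let: (u, u') := solution_pair a b x s m in
    (u', ((x - b n.+1) * u' - a n * u) / a n.+1)
  else (1, s).

Definition solution_from (R : realType) (a b : nat -> R) (x s : R) (n : nat) : R :=
  (solution_pair a b x s n).1.

Lemma solution_fromE (R : realType) (a b : nat -> R) (x s : R) :
  (forall n, 0 < a n.+1) ->
  forall i, solution_from a b x s i.+2 =
  ((x - b i.+2) * solution_from a b x s i.+1 - a i.+1 * solution_from a b x s i)
     / a i.+2.
Proof.
by move=> a0 i; rewrite /solution_from /=; case: (solution_pair a b x s i).
Qed.

Lemma jacobi_solution_from (R : realType) (a b : nat -> R) (x s : R) :
  (forall n, 0 < a n.+1) -> jacobi_solution a b x (solution_from a b x s).
Proof.
move=> a0; split=> [i|[]]; last by move/eqP; rewrite oner_eq0.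
by rewrite solution_fromE // mulrC divfK // gt_eqF.
Qed.

(** Two solutions with different initial slopes never vanish at the same site, so
    that among n + 2 slopes one avoids the sites 0, ..., n.  Such a solution has a
    number of rises that is stable under small changes of the coefficients. *)
Lemma exists_nonvanishing_solution (R : realType) (a b : nat -> R) (x : R) n :
  (forall n, 0 < a n.+1) ->
  exists s, forall i, (i <= n)%N -> solution_from a b x s i != 0.
Proof.
move=> a0; apply: contrapT => H.
have /choice[f hf] (j : 'I_n.+2) :
    exists i : 'I_n.+1, solution_from a b x (nat_of_ord j)%:R i = 0.
  apply: contrapT => Hj; apply: H; exists (nat_of_ord j)%:R => i i_n.
  apply/eqP => e; apply: Hj.
  by exists (Ordinal (i_n : (i < n.+1)%N)).
have finj : injective f.
  move=> j j' fj; apply/val_inj/eqP; rewrite /= -(eqr_nat R).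
  have [r1 _] := jacobi_solution_from b x (nat_of_ord j)%:R a0.
  have [r2 _] := jacobi_solution_from b x (nat_of_ord j')%:R a0.
  have hj' : solution_from a b x (nat_of_ord j')%:R (f j) = 0 by rewrite fj hf.
  have := wronskian_const r1 r2 (f j); rewrite hf hj' mul0r mulr0 subrr mulr0.
  move=> /esym/eqP; rewrite mulf_eq0 gt_eqF //= /solution_from /= mulr1 mul1r.
  by rewrite subr_eq0.
by have := leq_card f finj; rewrite !card_ord ltnn.
Qed.

Section Counting.
Variables (R : realType) (p : nat) (a0 b0 a b : nat -> R).
Hypothesis p_gt0 : (0 < p)%N.
Hypothesis a0_gt0 : forall n, 0 < a0 n.
Hypothesis a0_per : forall n, a0 (n + p)%N = a0 n.
Hypothesis b0_per : forall n, b0 (n + p)%N = b0 n.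
Hypothesis a_gt0 : forall n, 0 < a n.+1.
Hypothesis ab_lim : (fun n => `|a n - a0 n| + `|b n - b0 n|) @ \oo --> (0 : R).

Lemma periodic_mul (f : nat -> R) : (forall n, f (n + p)%N = f n) ->
  forall k i, f (k * p + i)%N = f i.
Proof.
by move=> fp; elim=> // k IH i; rewrite mulSn -addnA addnC fp IH.
Qed.

Lemma cvg_block_index i : (fun k => k * p + i)%N @ \oo --> \oo.
Proof.
have := @cvg_comp _ _ _ (fun k => k * p)%N (fun x => x + i)%N _ _ _
  (cvg_mulnr p p_gt0) (cvg_addnr i).
exact.
Qed.

Lemma cvg_block_a i : (fun k => a (k * p + i)%N) @ \oo --> a0 i.
Proof.
have h : (fun n => a n - a0 n) @ \oo --> (0 : R).
  apply/norm_cvg0P; apply: (squeeze_cvgr _ (cvg_cst 0) ab_lim).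
  by near=> n; rewrite normr_ge0 lerDl normr_ge0.
have := cvg_comp _ _ (cvg_block_index i) h; rewrite /comp /= => h'.
rewrite -[X in _ --> X]add0r.
have -> : (fun k => a (k * p + i)%N) =
    (fun k => (a (k * p + i)%N - a0 (k * p + i)%N) + a0 i).
  by apply/funext => k; rewrite (periodic_mul a0_per) subrK.
by apply: cvgD => //; exact: cvg_cst.
Unshelve. all: by end_near.
Qed.

Lemma cvg_block_b i : (fun k => b (k * p + i)%N) @ \oo --> b0 i.
Proof.
have h : (fun n => b n - b0 n) @ \oo --> (0 : R).
  apply/norm_cvg0P; apply: (squeeze_cvgr _ (cvg_cst 0) ab_lim).
  by near=> n; rewrite normr_ge0 lerDr normr_ge0.
have := cvg_comp _ _ (cvg_block_index i) h; rewrite /comp /= => h'.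
rewrite -[X in _ --> X]add0r.
have -> : (fun k => b (k * p + i)%N) =
    (fun k => (b (k * p + i)%N - b0 (k * p + i)%N) + b0 i).
  by apply/funext => k; rewrite (periodic_mul b0_per) subrK.
by apply: cvgD => //; exact: cvg_cst.
Unshelve. all: by end_near.
Qed.

Local Notation shiftp k := (shift_seq (k * p)).

Lemma cvg_shift_solution x s i :
  (fun k => solution_from (shiftp k a) (shiftp k b) x s i) @ \oo -->
  solution_from a0 b0 x s i.
Proof.
have ca := cvg_block_a.
have cb := cvg_block_b.
suff H : ((fun k => solution_from (shiftp k a) (shiftp k b) x s i) @ \oo -->
    solution_from a0 b0 x s i) /\
   ((fun k => solution_from (shiftp k a) (shiftp k b) x s i.+1) @ \oo -->
    solution_from a0 b0 x s i.+1) by case: H.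
elim: i => [|i [IH0 IH1]]; first by split; exact: cvg_cst.
split=> //; rewrite solution_fromE //.
have -> : (fun k => solution_from (shiftp k a) (shiftp k b) x s i.+2) =
  (fun k => ((x - b (k * p + i.+2)%N) * solution_from (shiftp k a) (shiftp k b) x s i.+1
    - a (k * p + i.+1)%N * solution_from (shiftp k a) (shiftp k b) x s i)
     / a (k * p + i.+2)%N).
  apply/funext => k; rewrite solution_fromE // => n.
  by rewrite /shift_seq addnS.
apply: cvgM; last by apply: cvgV => //; rewrite gt_eqF.
apply: cvgB; last by apply: cvgM.
by apply: cvgM => //; apply: cvgB => //; exact: cvg_cst.
Qed.

Lemma rises_near (u u' : nat -> R) (l l' : R) : u @ \oo --> l -> u' @ \oo --> l' ->
  l != 0 -> l' != 0 -> \forall k \near \oo, rises (u k) (u' k) = rises l l'.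
Proof.
move=> ul ul' l0 l'0; have uul : (fun k => u k * u' k) @ \oo --> l * l' by exact: cvgM.
have ll0 : l * l' != 0 by rewrite mulf_neq0.
rewrite /rises (negbTE l0) /=.
have un0 : \forall k \near \oo, u k != 0 by exact: (cvgr_neq0 _ ul l0).
case: (ltgtP (l * l') 0) ll0 => // h _; near=> k.
  have -> : (u k == 0) = false by apply/negbTE; near: k.
  apply/negbTE; rewrite /= -leNgt ltW //; near: k; exact: (cvgr_lt _ uul _ h).
have -> : (u k == 0) = false by apply/negbTE; near: k.
by rewrite /=; near: k; exact: (cvgr_gt _ uul _ h).
Unshelve. all: by end_near.
Qed.

(** Each count is compared, at the cost of one, with the solution of a given slope
    for its own coefficients; the slope is chosen so that no value of the periodic
    solution vanishes, and then the two solutions have the same rises. *)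
Lemma nbelow_window_near x n : \forall k \near \oo,
  (nbelow (zeros (shiftp k a) (shiftp k b) n) x <=
     (nbelow (zeros a0 b0 n) x).+2)%N /\
  (nbelow (zeros a0 b0 n) x <=
     (nbelow (zeros (shiftp k a) (shiftp k b) n) x).+2)%N.
Proof.
have a0S m : 0 < a0 m.+1 by [].
have [s hs] := exists_nonvanishing_solution b0 x n a0S.
have same m : (m <= n)%N -> \forall k \near \oo,
    rise_count (solution_from (shiftp k a) (shiftp k b) x s) m =
    rise_count (solution_from a0 b0 x s) m.
  elim: m => [|m IH] mn; first by near=> k; rewrite /rise_count !big_ord0.
  have h1 := rises_near (@cvg_shift_solution x s m) (@cvg_shift_solution x s m.+1)
    (hs m (ltnW mn)) (hs m.+1 mn).
  by near=> k; rewrite !rise_countS; congr (_ + nat_of_bool _)%N;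
     near: k => //; exact: IH (ltnW mn).
have := same n (leqnn n); apply: filterS => k e.
have ak m : 0 < shiftp k a m.+1 by rewrite /shift_seq addnS.
have s1 := jacobi_solution_from (shiftp k b) x s ak.
have s2 := jacobi_solution_orthopoly (shiftp k b) ak 0 x.
have s3 := jacobi_solution_from b0 x s a0S.
have s4 := jacobi_solution_orthopoly b0 a0S 0 x.
rewrite (nbelow_zeros_rises _ ak) (nbelow_zeros_rises _ a0S).
have h1 := sturm_comparison ak s1 s2 n; have h2 := sturm_comparison ak s2 s1 n.
have h3 := sturm_comparison a0S s3 s4 n; have h4 := sturm_comparison a0S s4 s3 n.
rewrite e in h1 h2; split.
  by apply: leq_trans h2 _; rewrite ltnS.
by apply: leq_trans h4 _; rewrite ltnS.
Unshelve. all: by end_near.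
Qed.

Lemma nbelow_zeros_le n m x : (nbelow (zeros a b n) x <= nbelow (zeros a b (n + m)) x)%N
  /\ (nbelow (zeros a b (n + m)) x <= nbelow (zeros a b n) x + m)%N.
Proof.
elim: m => [|m [h1 h2]]; first by rewrite addn0 addn0.
rewrite addnS nbelow_zerosS //; split; first by apply: leq_trans h1 _; exact: leq_addr.
by case: (_ || _) => /=; lia.
Qed.

(** Cutting n sites into windows of l periods gives the density of zeros up to an
    error of order 1 / (l p), uniformly in n. *)
Lemma nbelow_window_bound x l : (0 < l)%N ->
  let q := nbelow (zeros a0 b0 (l * p)) x in
  exists C : R, forall n,
   `| (nbelow (zeros a b n) x)%:R - n%:R * (q%:R / (l * p)%:R) | <=
   C + n%:R * (3 / (l * p)%:R).
Proof.
move=> l0 q; set L := (l * p)%N.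
have L0 : (0 < L)%N by rewrite muln_gt0 l0.
have qL : (q <= L)%N.
  by apply: leq_trans (nbelow_le_size _ _) _; rewrite size_zeros.
have [k0 _ Hk] := nbelow_window_near x L.
pose N n := nbelow (zeros a b n) x; pose m0 := (k0 * p)%N.
have step t : (N (m0 + t * L) <= N m0 + t * q + 3 * t)%N /\
              (N m0 + t * q <= N (m0 + t * L) + 3 * t)%N.
  elim: t => [|t [h1 h2]]; first by rewrite !mul0n !muln0 !addn0.
  have -> : (m0 + t.+1 * L)%N = ((k0 + t * l) * p + L)%N by rewrite /m0 /L; ring.
  have [h3 h4] := nbelow_zeros_additive b ((k0 + t * l) * p) L x a_gt0.
  have [h5 h6] := Hk (k0 + t * l)%N (leq_addr _ _).
  move: h1 h2; have -> : (m0 + t * L)%N = ((k0 + t * l) * p)%N by rewrite /m0 /L; ring.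
  rewrite -/L -/q -/(N _) -/(N _) in h3 h4 h5 h6 *.
  move=> h1 h2; split; lia.
exists (2 * (m0 + L)%:R) => n; rewrite -/(N n).
have Lr : 0 < L%:R :> R by rewrite ltr0n.
have key : exists t, (N n <= t * q + 3 * t + m0 + L)%N /\ (t * q <= N n + 3 * t)%N
   /\ (t * L <= n)%N /\ (n <= t * L + m0 + L)%N.
  case: (leqP m0 n) => mn; last first.
    exists 0%N; rewrite !mul0n; split; last by split=> //; split => //; lia.
    by have := nbelow_le_size (zeros a b n) x; rewrite size_zeros // -/(N n); lia.
  exists ((n - m0) %/ L)%N; set t := ((n - m0) %/ L)%N.
  have nE : n = (m0 + t * L + (n - m0) %% L)%N by rewrite -addnA -divn_eq subnKC.
  have rL : ((n - m0) %% L < L)%N by rewrite ltn_mod.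
  have [h1 h2] := step t.
  have [h3 h4] := nbelow_zeros_le (m0 + t * L) ((n - m0) %% L) x.
  rewrite -nE -/(N _) -/(N n) in h3 h4.
  have N0 : (N m0 <= m0)%N by have := nbelow_le_size (zeros a b m0) x; rewrite size_zeros.
  by move: h1 h2 h3 h4 rL N0 nE; lia.
have [t [h1 [h2 [h3 h4]]]] := key.
clear Hk step key; clearbody L m0.
move: h1 h2 h3 h4 qL; rewrite -!(ler_nat R) !(natrM, natrD) => h1 h2 h3 h4 qL.
set Nr := (N n)%:R in h1 h2 *; set nr := n%:R in h3 h4 *; set tr := t%:R in h1 h2 h3 h4.
set qr : R := q%:R in h1 h2 qL *; set Lr' : R := L%:R in h1 h3 h4 Lr qL *.
set mr : R := m0%:R in h1 h4 *.
have q0 : 0 <= qr by exact: ler0n.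
have rho1 : qr / Lr' <= 1 by rewrite ler_pdivrMr // mul1r.
have rho0 : 0 <= qr / Lr' by rewrite divr_ge0 // ltW.
have e1 : tr * qr = tr * Lr' * (qr / Lr') by field; rewrite gt_eqF.
have e2 : tr = tr * Lr' / Lr' by field; rewrite gt_eqF.
have i0 : 0 <= Lr'^-1 by rewrite invr_ge0 ltW.
have h5 : tr <= nr / Lr' by rewrite e2 ler_wpM2r.
have h6 : tr * qr <= nr * (qr / Lr') by rewrite e1 ler_wpM2r.
have h7 : nr * (qr / Lr') <= (tr * Lr' + mr + Lr') * (qr / Lr') by rewrite ler_wpM2r.
have m0r : 0 <= mr by exact: ler0n.
have h8 : (mr + Lr') * (qr / Lr') <= mr + Lr' by rewrite ler_piMr // addr_ge0 // ltW.
have h9 : nr * (qr / Lr') <= tr * qr + (mr + Lr').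
  by apply: le_trans h7 _; rewrite -addrA mulrDl -e1 lerD2l.
have -> : nr * (3 / Lr') = 3 * (nr / Lr') by ring.
rewrite ler_norml; apply/andP; split; lra.
Qed.

End Counting.

Lemma nbelow_near (R : realType) (s : seq R) (x0 : R) : uniq s ->
  \forall x \near x0, (nbelow s x <= (nbelow s x0).+1)%N /\
                      (nbelow s x0 <= (nbelow s x).+1)%N.
Proof.
move=> us.
have H : \forall x \near x0,
    (nbelow s x <= nbelow s x0 + count_mem x0 s)%N /\
    (nbelow s x0 <= nbelow s x + count_mem x0 s)%N.
  elim: s {us} => [|z s IH]; first by near=> x.
  have hz : \forall x \near x0, (z != x0) ==> ((z < x) == (z < x0)).
    have [->|zx] := eqVneq z x0; first by near=> x.
    case: (ltgtP z x0) zx => // h _.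
      by near=> x; apply/eqP; near: x; exact: lt_nbhsr.
    near=> x; apply/eqP/negbTE; rewrite -leNgt ltW //; near: x; exact: lt_nbhsl.
  near=> x; have [h1 h2] : (nbelow s x <= nbelow s x0 + count_mem x0 s)%N /\
    (nbelow s x0 <= nbelow s x + count_mem x0 s)%N by near: x.
  have : (z != x0) ==> ((z < x) == (z < x0)) by near: x.
  rewrite /nbelow /= -/(nbelow s x) -/(nbelow s x0).
  move: h1 h2; move: (nbelow s x) (nbelow s x0) (count_mem x0 s) => A B C h1 h2.
  have [->|zx] /= := eqVneq z x0.
    by move=> _; rewrite ltxx; case: (x0 < x) => /=; split; lia.
  by move=> /eqP ->; split; lia.
apply: filterS H => x; rewrite count_uniq_mem //.
by case: (x0 \in s) => /= -[]; split; lia.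
Unshelve. all: by end_near.
Qed.

(** Inductively a_{n+1} v_{n+1} >= M v_n, since the diagonal coefficient y - c is at
    least 2M while the off-diagonal ones are at most M. *)
Lemma growing_solution (R : realType) (a c : nat -> R) (y M : R) (v : nat -> R) :
  (forall n, 0 < a n.+1) -> 0 < M -> (forall n, a n.+1 <= M) ->
  (forall n, c n.+1 <= M) -> 3 * M <= y ->
  0 < v 0%N -> a 1%N * v 1%N = (y - c 1%N) * v 0%N ->
  (forall i, a i.+2 * v i.+2 = (y - c i.+2) * v i.+1 - a i.+1 * v i) ->
  forall n, 0 < v n.
Proof.
move=> a0 M0 aM cM yM v0 v1 vS.
suff H n : 0 < v n /\ M * v n <= a n.+1 * v n.+1 by move=> n; case: (H n).
elim: n => [|n [vn le]].
  by split=> //; rewrite v1 ler_wpM2r ?ltW //; have := cM 0%N; lra.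
have vn1 : 0 < v n.+1.
  by rewrite -(pmulr_rgt0 _ (a0 n)); apply: lt_le_trans le; rewrite mulr_gt0.
split=> //; rewrite vS.
have : a n.+1 * v n <= M * v n.+1.
  rewrite -(ler_pM2l M0); have h1 := ler_wpM2l (ltW (a0 n)) le.
  have h2 : a n.+1 * (a n.+1 * v n.+1) <= M * (M * v n.+1).
    by rewrite !mulrA ler_wpM2r ?(ltW vn1) // ler_pM // ltW.
  by apply: le_trans h2; rewrite mulrCA.
have : 2 * M * v n.+1 <= (y - c n.+2) * v n.+1.
  by rewrite ler_wpM2r ?(ltW vn1) //; have := cM n.+1; lra.
lra.
Qed.

Section Support.
Variables (R : realType) (a b : nat -> R) (M : R).
Hypothesis a0 : forall n, 0 < a n.+1.
Hypothesis aM : forall n, `|a n.+1| <= M.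
Hypothesis bM : forall n, `|b n.+1| <= M.

Lemma orthopoly_gt0_right n x : 3 * M <= x -> 0 < (orthopoly a b n).[x].
Proof.
move=> xM; have M0 : 0 < M by apply: lt_le_trans (aM 0); rewrite normr_gt0 gt_eqF.
apply: (@growing_solution _ a b x M (fun n => (orthopoly a b n).[x])) => //.
- by move=> i; apply: le_trans (aM i); exact: ler_norm.
- by move=> i; apply: le_trans (bM i); exact: ler_norm.
- by cbv beta; rewrite orthopoly0 hornerE ltr01.
- by cbv beta; rewrite horner_orthopoly1 // orthopoly0 hornerE mulr1.
- by move=> i; rewrite horner_orthopolyS.
Qed.

Lemma orthopoly_alternate_left n x : x <= - (3 * M) ->
  0 < (-1) ^+ n * (orthopoly a b n).[x].
Proof.
move=> xM; have M0 : 0 < M by apply: lt_le_trans (aM 0); rewrite normr_gt0 gt_eqF.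
apply: (@growing_solution _ a (fun n => - b n) (- x) M
  (fun n => (-1) ^+ n * (orthopoly a b n).[x])) => //.
- by move=> i; apply: le_trans (aM i); exact: ler_norm.
- by move=> i; apply: le_trans (bM i); rewrite -normrN; exact: ler_norm.
- by rewrite lerNr.
- by cbv beta; rewrite orthopoly0 hornerC expr0 mulr1 ltr01.
- by cbv beta; rewrite mulrCA horner_orthopoly1 // orthopoly0 hornerC expr0 expr1; ring.
- by move=> i; rewrite mulrCA horner_orthopolyS // !exprS; ring.
Qed.

Lemma nbelow_zeros_right n x : 3 * M <= x -> nbelow (zeros a b n) x = n.
Proof.
move=> xM; rewrite nbelow_zeros_rises // /rise_count.
rewrite (eq_bigr (fun=> 1%N)) ?sum1_card ?card_ord // => i _.
by rewrite /rises (mulr_gt0 (orthopoly_gt0_right i xM) (orthopoly_gt0_right i.+1 xM)) orbT.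
Qed.

Lemma nbelow_zeros_left n x : x <= - (3 * M) -> nbelow (zeros a b n) x = 0%N.
Proof.
move=> xM; rewrite nbelow_zeros_rises // /rise_count big1 // => i _.
have h1 := orthopoly_alternate_left i xM; have h2 := orthopoly_alternate_left i.+1 xM.
rewrite /rises; have /negbTE -> : (orthopoly a b i).[x] != 0.
  by apply/eqP => e; move: h1; rewrite e mulr0 ltxx.
have sgn : (-1) ^+ i * (-1) ^+ i.+1 = -1 :> R.
  by rewrite exprS mulrCA -exprD addnn -signr_odd odd_double expr0 mulr1.
have := mulr_gt0 h1 h2; rewrite mulrACA sgn.
by rewrite mulN1r oppr_gt0 => /lt_gtF ->.
Qed.

Lemma zeros_bounded n x : x \in zeros a b n -> - (3 * M) <= x < 3 * M.
Proof.
rewrite mem_zeros // => /rootP rx; apply/andP; split.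
  rewrite leNgt; apply/negP => /ltW /(orthopoly_alternate_left n).
  by rewrite rx mulr0 ltxx.
by rewrite ltNge; apply/negP => /(orthopoly_gt0_right n); rewrite rx ltxx.
Qed.

End Support.

(** The integrated density of states. *)
Definition ids (R : realType) (a b : nat -> R) (x : R) : R :=
  limn (fun n => (nbelow (zeros a b n) x)%:R / n%:R : R).

Section Ids.
Variables (R : realType) (p : nat) (a0 b0 a b : nat -> R).
Hypothesis p_gt0 : (0 < p)%N.
Hypothesis a0_gt0 : forall n, 0 < a0 n.
Hypothesis a0_per : forall n, a0 (n + p)%N = a0 n.
Hypothesis b0_per : forall n, b0 (n + p)%N = b0 n.
Hypothesis a_gt0 : forall n, 0 < a n.+1.
Hypothesis ab_lim : (fun n => `|a n - a0 n| + `|b n - b0 n|) @ \oo --> (0 : R).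

Lemma invn_near (C e : R) : 0 < e -> \forall n \near \oo, C / n%:R <= e.
Proof.
move=> e0; near=> n.
have n0 : 0 < n%:R :> R.
  by rewrite ltr0n; near: n; exact: nbhs_infty_gt.
rewrite ler_pdivrMr // mulrC -ler_pdivrMr //; near: n; exact: nbhs_infty_ger.
Unshelve. all: by end_near.
Qed.

Lemma ids_window_near x l e : (0 < l)%N -> 0 < e -> \forall n \near \oo,
  `| (nbelow (zeros a b n) x)%:R / n%:R -
     (nbelow (zeros a0 b0 (l * p)) x)%:R / (l * p)%:R : R | <= 3 / (l * p)%:R + e.
Proof.
move=> l0 e0.
have [C hC] := nbelow_window_bound p_gt0 a0_gt0 a0_per b0_per a_gt0 ab_lim x l0.
near=> n.
have n0 : 0 < n%:R :> R.
  by rewrite ltr0n; near: n; exact: nbhs_infty_gt.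
have Ce : C / n%:R <= e by near: n; exact: invn_near.
have := hC n; set q : R := (nbelow _ _)%:R / (l * p)%:R => h.
have -> : (nbelow (zeros a b n) x)%:R / n%:R - q =
    ((nbelow (zeros a b n) x)%:R - n%:R * q) / n%:R by field; rewrite gt_eqF.
rewrite normrM normfV (gtr0_norm n0) ler_pdivrMr //.
apply: le_trans h _; rewrite [leRHS]mulrDl.
rewrite [leLHS]addrC (mulrC n%:R).
rewrite lerD2l.
by rewrite -ler_pdivrMr.
Unshelve. all: by end_near.
Qed.

Lemma exists_long_window (e : R) : 0 < e ->
  exists2 l, (0 < l)%N & 3 / (l * p)%:R <= e :> R.
Proof.
move=> e0; have [N _ /(_ N.+1 (leqnSn _)) /= h] := invn_near 3 e0.
exists N.+1 => //; apply: le_trans h; rewrite ler_pM2l // lef_pV2 ?posrE ?ltr0n //.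
  by rewrite ler_nat leq_pmulr.
by rewrite muln_gt0.
Qed.

(** The windows of l periods squeeze the upper and lower limits up to 3 / (l p). *)
Lemma cvg_ids x : (fun n => (nbelow (zeros a b n) x)%:R / n%:R : R) @ \oo --> ids a b x.
Proof.
apply: cauchy_cvg; apply: cauchy_exP => e e0.
have e2 : 0 < e / 3 by rewrite divr_gt0.
have [l l0 hl] := exists_long_window e2.
exists ((nbelow (zeros a0 b0 (l * p)) x)%:R / (l * p)%:R : R).
have := ids_window_near x l0 e2; rewrite /fmap /=; apply: filterS => n h /=.
rewrite /ball /= distrC; apply: le_lt_trans h _; lra.
Qed.

Lemma ids_window x l : (0 < l)%N ->
  `| ids a b x - (nbelow (zeros a0 b0 (l * p)) x)%:R / (l * p)%:R | <=
    3 / (l * p)%:R.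
Proof.
move=> l0; apply/ler_addgt0Pr => e e0.
set q : R := _ / (l * p)%:R.
have h : (fun n => `| (nbelow (zeros a b n) x)%:R / n%:R - q |) @ \oo -->
   `|ids a b x - q|.
  by apply: cvg_norm; apply: cvgB; [exact: cvg_ids | exact: cvg_cst].
rewrite -(cvg_lim _ h) //; apply: limr_le; first by apply: cvgP h.
exact: ids_window_near.
Qed.

Lemma ids_homo x y : x <= y -> ids a b x <= ids a b y.
Proof.
move=> xy; rewrite /ids; apply: ler_lim.
- by apply: cvgP; exact: cvg_ids.
- by apply: cvgP; exact: cvg_ids.
near=> n; rewrite ler_wpM2r ?invr_ge0 // ler_nat; exact: nbelow_homo.
Unshelve. all: by end_near.
Qed.

(** A jump of the integrated density of states would contribute a positive
    fraction of the zeros of every periodic window to one point; but these zeros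
    are simple, and the windows determine the limit up to the inverse of their
    length. *)
Lemma continuous_ids : continuous (ids a b).
Proof.
move=> x0; apply/cvgrPdist_le => e e0.
have e4 : 0 < e / 3 by rewrite divr_gt0.
have [l l0 hl] := exists_long_window e4.
set L := (l * p)%N in hl.
have us : uniq (zeros a0 b0 L).
  by apply: sorted_uniq (zeros_sorted _ _ _); [exact: lt_trans | exact: ltxx].
have := nbelow_near x0 us; apply: filterS => x [h1 h2].
have := ids_window x l0; have := ids_window x0 l0; rewrite -/L.
have L0 : 0 < (L%:R)^-1 :> R by rewrite invr_gt0 ltr0n muln_gt0 l0.
move: h1 h2; rewrite -!(ler_nat R) -!natr1.
set q : R := (nbelow _ x)%:R; set q0 : R := (nbelow _ x0)%:R => h1 h2.
have {h1}h1 : q / L%:R <= q0 / L%:R + 1 / L%:R by rewrite -mulrDl ler_pM2r.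
have {h2}h2 : q0 / L%:R <= q / L%:R + 1 / L%:R by rewrite -mulrDl ler_pM2r.
have : 1 / L%:R <= e / 9 by lra.
rewrite !ler_norml => h3 /andP[h4 h5] /andP[h6 h7]; apply/andP; split; lra.
Qed.

End Ids.

(** * Uniform continuity on segments *)

Lemma uniform_continuity_segment (R : realType) (f : R -> R) (a b e : R) :
  (forall x, a <= x <= b -> {for x, continuous f}) -> 0 < e ->
  exists2 d, 0 < d & forall x y, a <= x <= b -> a <= y <= b ->
    `|x - y| <= d -> `|f x - f y| <= e.
Proof.
move=> cf e0.
have e2 : 0 < e / 2 by rewrite divr_gt0.
have /compact_near_coveringP := @segment_compact R a b.
pose P (d : R) (x : R) := a <= x <= b -> forall y, a <= y <= b ->
    `|x - y| <= d -> `|f x - f y| <= e.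
move=> /(_ _ (0 : R)^'+ P _) H.
have : \forall d \near (0 : R)^'+, `[a, b]%classic `<=` P d.
  apply: H => x; rewrite /= in_itv /= => abx.
  have /cvgrPdist_le /(_ _ e2) := cf x abx.
  rewrite -nbhs_nearE => /nbhs_ballP[r /= r0 hr].
  have r2 : 0 < r / 2 by rewrite divr_gt0.
  exists (ball x (r / 2), [set d | 0 < d < r / 2]).
    split => /=; first exact: nbhsx_ballx.
    near=> d; apply/andP; split; near: d; first exact: nbhs_right_gt.
    exact: nbhs_right_lt.
  move=> [y d] /= [xy /andP[d0 dr]] aby z abz yzd.
  have {}xy : `|x - y| < r / 2 by [].
  have h1 : `|f x - f y| <= e / 2.
    by apply: hr; change (`|x - y| < r); lra.
  have h2 : `|f x - f z| <= e / 2.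
    apply: hr; apply: le_lt_trans (ler_distD y x z) _.
    by rewrite [ltRHS]splitr ltrD // (le_lt_trans yzd).
  have := ler_distD (f x) (f y) (f z); rewrite (distrC (f y) (f x)); lra.
move=> [d /= d0 hd]; exists (d / 2); first by rewrite divr_gt0.
move=> x y abx aby xy; apply: (hd (d / 2) _ _ x) => //=.
- by rewrite sub0r normrN gtr0_norm ?divr_gt0 // ltr_pdivrMr // ltr_pMr // ltr1n.
- by rewrite divr_gt0.
Unshelve. all: by end_near.
Qed.

(** * Weak convergence from convergence of the counting functions *)

Section Rintegral_near.
Context d (T : measurableType d) (R : realType).
Variable mu : {finite_measure set T -> \bar R}.

Lemma Rintegral_near_cst (A : set T) (f : T -> R) (c e : R) : measurable A ->
  mu.-integrable A (EFin \o f) ->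
  (forall x, A x -> `|f x - c| <= e) ->
  `|\int[mu]_(x in A) f x - c * fine (mu A)| <= e * fine (mu A).
Proof.
move=> mA intf cef.
have icst r : mu.-integrable A (EFin \o cst r).
  exact: finite_measure_integrable_cst.
have h1 : \int[mu]_(x in A) (cst (c - e)) x <= \int[mu]_(x in A) f x.
  apply: le_Rintegral => // x Ax; have := cef x Ax; rewrite ler_norml /=; lra.
have h2 : \int[mu]_(x in A) f x <= \int[mu]_(x in A) (cst (c + e)) x.
  apply: le_Rintegral => // x Ax; have := cef x Ax; rewrite ler_norml /=; lra.
rewrite !Rintegral_cst // in h1 h2.
rewrite ler_norml; apply/andP; split; lra.
Qed.

End Rintegral_near.

Lemma cvg_sum_ord (R : realType) (T : Type) (G : set_system T) (FG : Filter G)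
    (N : nat) (f : nat -> T -> R) (l : nat -> R) :
  (forall i, (i < N)%N -> f i @ G --> l i) ->
  (fun t => \sum_(i < N) f i t) @ G --> \sum_(i < N) l i.
Proof.
elim: N => [|N IH] h.
  rewrite big_ord0 (_ : (fun t => _) = cst 0); first exact: cvg_cst.
  by apply/funext => t; rewrite big_ord0.
rewrite big_ord_recr (_ : (fun t => _) = (fun t => \sum_(i < N) f i t + f N t)).
  by apply: cvgD; [apply: IH => i iN; apply: h; exact: ltnW | exact: h].
by apply/funext => t; rewrite big_ord_recr.
Qed.

Section Stieltjes.
Variables (R : realType) (F : cumulativeBounded (0 : R) (1 : R)).

Lemma lebesgue_stieltjes_itv (x y : R) : x <= y ->
  lebesgue_stieltjes_measure F `]x, y]%classic = (F y - F x)%:E.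
Proof.
move=> xy; rewrite /lebesgue_stieltjes_measure /measure_extension.
by rewrite measurable_mu_extE /= ?wlength_itv_bnd //; exact: is_ocitv.
Qed.

Local Notation nu := (lebesgue_stieltjes_measure F).

(** A function that varies by at most e on each cell is replaced by its values at
    the left ends; the measure of a cell is the increment of F. *)
Lemma Rintegral_stieltjes_sum (f : R -> R) (x : nat -> R) (e : R) N :
  nu.-integrable setT (EFin \o f) ->
  (forall i, x i <= x i.+1) ->
  (forall i z, (i < N)%N -> x i < z <= x i.+1 -> `|f z - f (x i)| <= e) ->
  `|\int[nu]_(z in `]x 0%N, x N]%classic) f z
     - \sum_(i < N) f (x i) * (F (x i.+1) - F (x i))| <= e * (F (x N) - F (x 0%N)).
Proof.
move=> intf xx fe; have mi (y z : R) : measurable (`]y, z]%classic : set (measurableTypeR R)).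
  exact: measurable_itv.
have intA (A : set (measurableTypeR R)) : measurable A -> nu.-integrable A (EFin \o f).
  by move=> mA; apply: integrableS intf.
have x0m m : x 0%N <= x m by elim: m => // m IH; exact: le_trans IH (xx m).
elim: N fe => [|N IH] fe.
  by rewrite big_ord0 subrr mulr0 set_itvoc0 Rintegral_set0 subr0 normr0.
have {}IH := IH (fun i z iN => fe i z (ltnW iN)).
have -> : `]x 0%N, x N.+1]%classic = `]x 0%N, x N] `|` `]x N, x N.+1]%classic.
  by rewrite -itv_bndbnd_setU // bnd_simp.
rewrite Rintegral_setU //; [|exact: intA (measurableU _ _ _ _)|]; last first.
  apply/disj_setPS => z [] /=; rewrite !in_itv /= => /andP[_ h1] /andP[h2 _].
  by move: (lt_le_trans h2 h1); rewrite ltxx.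
have := @Rintegral_near_cst _ _ _ nu `]x N, x N.+1]%classic f (f (x N)) e
  (mi _ _) (intA _ (mi _ _)).
move=> h.
have E : F (x N.+1) - F (x N) = fine (nu `]x N, x N.+1]%classic).
  by rewrite lebesgue_stieltjes_itv.
have {}h : `|\int[nu]_(z in `]x N, x N.+1]%classic) f z
    - f (x N) * (F (x N.+1) - F (x N))| <= e * (F (x N.+1) - F (x N)).
  by rewrite E; apply: h => z; rewrite /= in_itv /=; exact: fe.
rewrite big_ord_recr /=; set I1 := Rintegral _ _ _ in IH *; set I2 := Rintegral _ _ _ in h *.
set S := \sum_(i < N) _ in IH *.
have -> : I1 + I2 - (S + f (x N) * (F (x N.+1) - F (x N))) =
  (I1 - S) + (I2 - f (x N) * (F (x N.+1) - F (x N))) by ring.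
by apply: le_trans (ler_normD _ _) _; lra.
Qed.

End Stieltjes.

Lemma integral_zero_measure (R : realType) (a b : nat -> R) n
    (g : measurableTypeR R -> \bar R) :
  @measurable_fun _ _ (measurableTypeR R) (\bar R) setT g ->
  (forall x, 0 <= g x)%E ->
  (\int[zero_measure a b n]_x g x =
   (n%:R^-1)%:E * \sum_(z <- zeros a b n) g z)%E.
Proof.
move=> mg g0; rewrite /zero_measure ge0_integral_mscale //=.
rewrite ge0_integral_measure_sum // (big_nth 0) big_mkord.
congr (_ * _)%E; apply: eq_bigr => i _.
by rewrite integral_dirac // diracT mul1e.
Qed.

Lemma Rintegral_zero_measure (R : realType) (a b : nat -> R) n
    (f : measurableTypeR R -> R) :
  @measurable_fun _ _ (measurableTypeR R) R setT f ->
  \int[zero_measure a b n]_x f x = n%:R^-1 * \sum_(z <- zeros a b n) f z.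
Proof.
move=> mf; have mEf : @measurable_fun _ _ (measurableTypeR R) (\bar R) setT (EFin \o f).
  exact/measurable_EFinP.
rewrite /Rintegral integralE.
rewrite !integral_zero_measure //; first last.
- exact: measurable_funepos.
- exact: measurable_funeneg.
have pE : (\sum_(z <- zeros a b n) (EFin \o f)^\+%E z =
    (\sum_(z <- zeros a b n) Num.max (f z) 0)%:E)%E.
  by rewrite -sumEFin; apply: eq_bigr => z _; rewrite funeposE /= -EFin_max.
have nE : (\sum_(z <- zeros a b n) (EFin \o f)^\-%E z =
    (\sum_(z <- zeros a b n) Num.max (- f z) 0)%:E)%E.
  by rewrite -sumEFin; apply: eq_bigr => z _; rewrite funenegE /= -EFin_max.
rewrite pE nE -!EFinM -EFinB /= -mulrBr -sumrB; congr (_ * _).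
apply: eq_bigr => z _; case: (lerP (f z) 0) => h.
  by rewrite max_l ?oppr_ge0 // sub0r opprK.
by rewrite max_r ?subr0 // oppr_le0 ltW.
Qed.

(** The discrete counterpart of the previous estimate: the counting function of a
    finite set plays the role of F. *)
Lemma counting_stieltjes_sum (R : realType) (s : seq R) (f : R -> R) (x : nat -> R)
    (e : R) N :
  (forall i, x i <= x i.+1) ->
  (forall i z, (i < N)%N -> x i <= z < x i.+1 -> `|f z - f (x i)| <= e) ->
  (forall z, z \in s -> x 0%N <= z < x N) ->
  `|\sum_(z <- s) f z
     - \sum_(i < N) f (x i) * ((nbelow s (x i.+1))%:R - (nbelow s (x i))%:R)|
  <= e * (size s)%:R.
Proof.
move=> xx fe sx.
pose c (z : R) i : R := (z < x i)%R%:R.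
have nE y : (nbelow s y)%:R = \sum_(z <- s) (z < y)%R%:R :> R.
  by rewrite /nbelow -sum1_count big_mkcond natr_sum; apply: eq_bigr => z _; case: ifP.
have -> : \sum_(i < N) f (x i) * ((nbelow s (x i.+1))%:R - (nbelow s (x i))%:R) =
    \sum_(z <- s) \sum_(i < N) f (x i) * (c z i.+1 - c z i).
  rewrite exchange_big /=; apply: eq_bigr => i _.
  by rewrite -mulr_sumr sumrB !nE.
rewrite -sumrB -sum1_size natr_sum mulr_sumr.
apply: le_trans (ler_norm_sum _ _ _) _; rewrite big_seq [leRHS]big_seq.
apply: ler_sum => z zs; rewrite mulr1; have /andP[xz zx] := sx z zs.
have c0 : c z 0%N = 0 by rewrite /c ltNge xz.
have cN : c z N = 1 by rewrite /c zx.
have ci i : 0 <= c z i.+1 - c z i.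
  rewrite subr_ge0 /c ler_nat; case: (ltP z (x i)) => // h.
  by rewrite (lt_le_trans h (xx i)).
have tel : \sum_(i < N) (c z i.+1 - c z i) = 1.
  by rewrite -(big_mkord xpredT (fun i => c z i.+1 - c z i)) telescope_sumr // c0 cN subr0.
rewrite -[f z]mulr1 -{1}tel mulr_sumr -sumrB.
apply: le_trans (ler_norm_sum _ _ _) _.
rewrite -[leRHS]mulr1 -tel mulr_sumr; apply: ler_sum => i _.
rewrite -mulrBl normrM (ger0_norm (ci i)).
case: (boolP (x i <= z < x i.+1)) => h; first by rewrite ler_wpM2r //; exact: fe.
suff -> : c z i.+1 - c z i = 0 by rewrite !mulr0.
move: h; rewrite negb_and -!ltNge /c => /orP[h|].
  by rewrite h (lt_le_trans h (xx i)) subrr.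
rewrite -leNgt => h; rewrite ltNge h ltNge (le_trans (xx i) h) subrr //.
Qed.

Section WeakLimit.
Variables (R : realType) (a b : nat -> R) (F : cumulativeBounded (0 : R) (1 : R)).
Variable K : R.
Hypothesis a0 : forall n, 0 < a n.+1.
Hypothesis K0 : 0 < K.
Hypothesis zK : forall n z, z \in zeros a b n -> - K <= z < K.
Hypothesis FNK : F (- K) = 0.
Hypothesis FK : F K = 1.
Hypothesis cvgF : forall x,
  (fun n => (nbelow (zeros a b n) x)%:R / n%:R : R) @ \oo --> F x.

Local Notation nu := (lebesgue_stieltjes_measure F).

Lemma bounded_continuous_integrable (f : R -> R) : continuous f ->
  bounded_fun f -> nu.-integrable setT (EFin \o f).
Proof.
move=> cf bf; apply: (measurable_bounded_integrable (A := setT)) => //.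
- have : (nu setT < +oo)%E; last exact.
  by rewrite (_ : nu setT = 1%E) ?ltry //; exact: (@probability_setT _ _ _ nu).
- exact: continuous_measurable_fun.
Qed.

Lemma Rintegral_stieltjes_segment (f : R -> R) : continuous f -> bounded_fun f ->
  \int[nu]_x f x = \int[nu]_(x in `]- K, K]%classic) f x.
Proof.
move=> cf bf; have intf := bounded_continuous_integrable cf bf.
have mA : measurable (`]- K, K]%classic : set (measurableTypeR R)).
  exact: measurable_itv.
set A : set (measurableTypeR R) := `]- K, K]%classic.
have mAC : measurable (~` A) by exact: measurableC.
have NKK : - K <= K by rewrite ge0_cp // ltW.
have nuAC : nu (~` A) = 0%E.
  have := @probability_setC _ _ _ nu A mA; rewrite /A /= => ->.
  rewrite lebesgue_stieltjes_itv // FK FNK subr0 subee //.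
rewrite -[in LHS](setUv A) Rintegral_setU //; last 2 first.
- by rewrite setUv.
- by apply/disj_setPCl.
have [B [_ hB]] := bf.
have := @Rintegral_near_cst _ _ _ nu (~` A) f 0 (B + 1) mAC
  (integrableS measurableT mAC (@subsetT _ _) intf).
have -> : fine (nu (~` A)) = 0 by rewrite nuAC.
rewrite !mulr0 subr0 normr_le0 => h.
have {}h : \int[nu]_(x in ~` A) f x = 0.
  by apply/eqP/h => x _; rewrite subr0; apply: hB => //; rewrite ltrDl ltr01.
by rewrite h addr0.
Qed.

(** The integrals of a continuous function are uniformly close to
    Riemann-Stieltjes sums, which converge termwise. *)
Lemma weak_limit_zero_measure (f : R -> R) : continuous f -> bounded_fun f ->
  (fun n => \int[zero_measure a b n]_x f x) @ \oo --> \int[nu]_x f x.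
Proof.
move=> cf bf; apply/cvgrPdist_le => e e0.
have e3 : 0 < e / 3 by rewrite divr_gt0.
have [d d0 hd] := @uniform_continuity_segment _ f (- K) K (e / 3) (fun x _ => cf x) e3.
have [N hN] : exists N : nat, 2 * K / N.+1%:R <= d.
  exists (Num.truncn (2 * K / d)); rewrite ler_pdivrMr ?ltr0n // [leRHS]mulrC -ler_pdivrMr //.
  by rewrite ltW // truncnS_gt.
set h := 2 * K / N.+1%:R in hN.
have h0 : 0 < h by rewrite divr_gt0 ?mulr_gt0 ?ltr0n.
pose x i := - K + i%:R * h.
have x0 : x 0%N = - K by rewrite /x mul0r addr0.
have xN : x N.+1 = K by rewrite /x /h mulrC divfK ?pnatr_eq0 //; lra.
have xS i : x i.+1 = x i + h by rewrite /x -natr1 mulrDl mul1r addrA.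
have xx i : x i <= x i.+1 by rewrite xS lerDl ltW.
have xmono i j : (i <= j)%N -> x i <= x j.
  by move=> ij; rewrite lerD2l ler_wpM2r ?ler_nat // ltW.
have xK i : (i <= N.+1)%N -> - K <= x i <= K.
  by move=> iN; rewrite -{1}x0 -xN !xmono.
have cell i z : (i < N.+1)%N -> x i <= z <= x i.+1 -> `|f z - f (x i)| <= e / 3.
  move=> iN /andP[h1 h2]; apply: hd; last by rewrite ger0_norm; [move: h2; rewrite xS; lra|lra].
    have /andP[h3 _] := xK i (ltnW iN); have /andP[_ h4] := xK i.+1 iN.
    by apply/andP; split; lra.
  exact: xK (ltnW iN).
have intf := bounded_continuous_integrable cf bf.
have := @Rintegral_stieltjes_sum _ F f x (e / 3) N.+1 intf xx.
rewrite x0 xN FK FNK subr0 mulr1 -Rintegral_stieltjes_segment // => S1.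
set S := \sum_(i < N.+1) f (x i) * (F (x i.+1) - F (x i)) in S1.
have {}S1 : `|\int[nu]_x f x - S| <= e / 3.
  by apply: S1 => i z iN /andP[h1 h2]; apply: cell => //; rewrite h2 ltW.
pose Sn n := \sum_(i < N.+1) f (x i) *
  ((nbelow (zeros a b n) (x i.+1))%:R / n%:R - (nbelow (zeros a b n) (x i))%:R / n%:R).
have cS : Sn @ \oo --> S.
  rewrite /Sn /S; apply: (@cvg_sum_ord _ _ _ _ _ (fun i n => f (x i) *
    ((nbelow (zeros a b n) (x i.+1))%:R / n%:R - (nbelow (zeros a b n) (x i))%:R / n%:R))
    (fun i => f (x i) * (F (x i.+1) - F (x i)))) => i _.
  by apply: cvgM; [exact: cvg_cst | apply: cvgB; exact: cvgF].
have S2 : \forall n \near \oo, `|S - Sn n| <= e / 3.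
  by have /cvgrPdist_le := cS; apply.
near=> n.
have n0 : 0 < n%:R :> R by rewrite ltr0n; near: n; exact: nbhs_infty_gt.
have S2n : `|S - Sn n| <= e / 3 by near: n.
rewrite Rintegral_zero_measure; last exact: continuous_measurable_fun.
have S3 : `|n%:R^-1 * \sum_(z <- zeros a b n) f z - Sn n| <= e / 3.
  have := @counting_stieltjes_sum _ (zeros a b n) f x (e / 3) N.+1 xx.
  rewrite x0 xN size_zeros // => h3.
  have -> : Sn n = n%:R^-1 * \sum_(i < N.+1) f (x i) *
     ((nbelow (zeros a b n) (x i.+1))%:R - (nbelow (zeros a b n) (x i))%:R).
    by rewrite mulr_sumr; apply: eq_bigr => i _; rewrite -mulrBl mulrA mulrC.
  rewrite -mulrBr normrM normfV (gtr0_norm n0) mulrC ler_pdivrMr //.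
  apply: h3; last exact: zK.
  by move=> i z iN /andP[h1 h2]; apply: cell; rewrite // h1 ltW.
have -> : \int[nu]_x f x - n%:R^-1 * \sum_(z <- zeros a b n) f z =
  (\int[nu]_x f x - S) + (S - Sn n) - (n%:R^-1 * \sum_(z <- zeros a b n) f z - Sn n) by ring.
apply: le_trans (ler_normB _ _) _; have := ler_normD (\int[nu]_x f x - S) (S - Sn n); lra.
Unshelve. all: by end_near.
Qed.

End WeakLimit.

(** * Sequences and polynomials of bounded variation *)

Definition summable_seq (R : realType) (e : nat -> R) : Prop :=
  (forall k, 0 <= e k) /\ exists C, forall n, \sum_(k < n) e k <= C.

(** Convergence with summable increments, the regularity inherited by everything
    computed rationally from the coefficients along one residue class. *)
Definition tame (R : realType) (u : nat -> R) (l : R) : Prop :=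
  u @ \oo --> l /\ summable_seq (fun k => `|u k.+1 - u k|).

Definition poly_tame (R : realType) (u : nat -> {poly R}) (q : {poly R}) : Prop :=
  (exists d, forall k, (size (u k) <= d)%N) /\
  forall i, tame (fun k => (u k)`_i) q`_i.

Section Tame.
Variable R : realType.
Implicit Types (u v : nat -> R) (l : R).

Lemma summable_seqD (e f : nat -> R) : summable_seq e -> summable_seq f ->
  summable_seq (fun k => e k + f k).
Proof.
move=> [e0 [C hC]] [f0 [D hD]]; split=> [k|]; first exact: addr_ge0.
by exists (C + D) => n; rewrite big_split; exact: lerD.
Qed.

Lemma summable_seqZ (c : R) (e : nat -> R) : 0 <= c -> summable_seq e ->
  summable_seq (fun k => c * e k).
Proof.
move=> c0 [e0 [C hC]]; split=> [k|]; first exact: mulr_ge0.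
by exists (c * C) => n; rewrite -mulr_sumr; exact: ler_wpM2l.
Qed.

Lemma summable_seq_le (e f : nat -> R) : summable_seq f ->
  (forall k, 0 <= e k <= f k) -> summable_seq e.
Proof.
move=> [f0 [C hC]] ef; split=> [k|]; first by case/andP: (ef k).
by exists C => n; apply: le_trans (hC n); apply: ler_sum => k _; case/andP: (ef k).
Qed.

Lemma summable_seq_tail (e : nat -> R) (d : R) : summable_seq e -> 0 < d ->
  exists k0, forall m n, (k0 <= m)%N -> \sum_(m <= k < n) e k <= d.
Proof.
move=> [e0 [C hC]] d0; pose S n := \sum_(0 <= k < n) e k.
have ndS : nondecreasing_seq S.
  by apply/nondecreasing_seqP => n; rewrite /S big_nat_recr //= lerDl.
have cS : cvgn S.
  apply: nondecreasing_is_cvgn => //; exists C => _ [n _ <-].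
  by rewrite /S big_mkord.
have /cvgrPdist_lt /(_ _ d0)[k0 _ hk] := cS.
exists k0 => m n km; case: (leqP n m) => nm.
  by rewrite big_geq // ltW.
have Sn : S n = S m + \sum_(m <= k < n) e k by rewrite /S -big_cat_nat //= ltnW.
have h1 := hk m km.
have h2 : S n <= limn S by apply: nondecreasing_cvgn_le.
have h3 : S m <= limn S by apply: nondecreasing_cvgn_le.
move: h1; rewrite /= ger0_norm ?subr_ge0 // => h1; lra.
Qed.

Lemma tame_bounded u l : tame u l -> exists2 B, 0 <= B & forall k, `|u k| <= B.
Proof.
move=> [_ [_ [C hC]]]; have C0 : 0 <= C by have := hC 0%N; rewrite big_ord0.
exists (`|u 0%N| + C) => [|k]; first exact: addr_ge0.
have -> : u k = u 0%N + \sum_(i < k) (u i.+1 - u i).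
  rewrite -(big_mkord xpredT (fun i => u i.+1 - u i)) telescope_sumr //.
  by rewrite addrC subrK.
apply: le_trans (ler_normD _ _) _; rewrite lerD2l.
exact: le_trans (ler_norm_sum _ _ _) (hC k).
Qed.

Lemma tame_cst l : tame (fun=> l) l.
Proof.
split; first exact: cvg_cst; split=> // ; exists 0 => n.
by rewrite big1 // => k _; rewrite subrr normr0.
Qed.

Lemma tameD u v l m : tame u l -> tame v m -> tame (fun k => u k + v k) (l + m).
Proof.
move=> [cu su] [cv sv]; split; first exact: cvgD.
apply: summable_seq_le (summable_seqD su sv) _ => k; rewrite normr_ge0 /=.
have -> : u k.+1 + v k.+1 - (u k + v k) = (u k.+1 - u k) + (v k.+1 - v k) by ring.
exact: ler_normD.
Qed.

Lemma tameM u v l m : tame u l -> tame v m -> tame (fun k => u k * v k) (l * m).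
Proof.
move=> tu tv; have [B B0 hB] := tame_bounded tu; have [D D0 hD] := tame_bounded tv.
case: tu tv => cu su [cv sv]; split; first exact: cvgM.
apply: summable_seq_le (summable_seqD (summable_seqZ B0 sv) (summable_seqZ D0 su)) _.
move=> k; rewrite normr_ge0 /=.
have -> : u k.+1 * v k.+1 - u k * v k =
  u k.+1 * (v k.+1 - v k) + v k * (u k.+1 - u k) by ring.
by apply: le_trans (ler_normD _ _) _; rewrite !normrM lerD // ler_wpM2r.
Qed.

Lemma tameN u l : tame u l -> tame (fun k => - u k) (- l).
Proof.
move=> [cu su]; split; first exact: cvgN.
by apply: summable_seq_le su _ => k; rewrite normr_ge0 -opprD normrN /=.
Qed.

Lemma tameV u l : tame u l -> l != 0 -> (forall k, u k != 0) ->
  tame (fun k => (u k)^-1) l^-1.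
Proof.
move=> [cu su] l0 u0; have cV : (fun k => (u k)^-1) @ \oo --> l^-1 by exact: cvgV.
split=> //.
have [B [_ hB]] := cvg_seq_bounded (cvgP _ cV).
have B0 k : `|(u k)^-1| <= `|B| + 1.
  by apply: (hB (`|B| + 1)) => //; apply: le_lt_trans (ler_norm B) _; rewrite ltrDl ltr01.
have BB : 0 <= (`|B| + 1) * (`|B| + 1) by rewrite mulr_ge0 // addr_ge0.
apply: summable_seq_le (summable_seqZ BB su) _ => k; rewrite normr_ge0 /=.
have -> : (u k.+1)^-1 - (u k)^-1 = - ((u k.+1)^-1 * (u k)^-1 * (u k.+1 - u k)).
  by field; rewrite !u0.
by rewrite normrN !normrM ler_wpM2r // ler_pM.
Qed.

Lemma tame_sum (I : Type) (r : seq I) (F : I -> nat -> R) (L : I -> R) :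
  (forall i, tame (F i) (L i)) ->
  tame (fun k => \sum_(i <- r) F i k) (\sum_(i <- r) L i).
Proof.
move=> h; elim: r => [|i r IH].
  rewrite big_nil (_ : (fun k => _) = fun=> 0); first exact: tame_cst.
  by apply/funext => k; rewrite big_nil.
rewrite big_cons (_ : (fun k => _) = fun k => F i k + \sum_(j <- r) F j k).
  exact: tameD.
by apply/funext => k; rewrite big_cons.
Qed.

Lemma poly_tameC u l : tame u l -> poly_tame (fun k => (u k)%:P) l%:P.
Proof.
move=> tu; split; first by exists 1%N => k; exact: size_polyC_leq1.
case=> [|i].
  rewrite coefC (_ : (fun k => _) = u) //.
  by apply/funext => k; rewrite coefC.
rewrite coefC (_ : (fun k => _) = fun=> 0); first exact: tame_cst.
by apply/funext => k; rewrite coefC.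
Qed.

Lemma poly_tame_cst (q : {poly R}) : poly_tame (fun=> q) q.
Proof. by split; [exists (size q) | move=> i; exact: tame_cst]. Qed.

Lemma poly_tameD (u v : nat -> {poly R}) (p q : {poly R}) :
  poly_tame u p -> poly_tame v q -> poly_tame (fun k => u k + v k) (p + q).
Proof.
move=> [[d hd] tu] [[e he] tv]; split.
  exists (maxn d e) => k; apply: leq_trans (size_polyD _ _) _.
  by rewrite geq_max !leq_max hd he orbT.
move=> i; rewrite coefD (_ : (fun k => _) = fun k => (u k)`_i + (v k)`_i).
  exact: tameD.
by apply/funext => k; rewrite coefD.
Qed.

Lemma poly_tameM (u v : nat -> {poly R}) (p q : {poly R}) :
  poly_tame u p -> poly_tame v q -> poly_tame (fun k => u k * v k) (p * q).
Proof.
move=> [[d hd] tu] [[e he] tv]; split.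
  exists (d + e)%N => k; apply: leq_trans (size_polyMleq _ _) _.
  by apply: leq_trans (leq_pred _) _; exact: leq_add.
move=> i; rewrite coefM.
rewrite (_ : (fun k => _) = fun k => \sum_(j < i.+1) (u k)`_j * (v k)`_(i - j)).
  by apply: tame_sum => j; exact: tameM.
by apply/funext => k; rewrite coefM.
Qed.

Lemma poly_tame_deriv (u : nat -> {poly R}) (p : {poly R}) :
  poly_tame u p -> poly_tame (fun k => (u k)^`()) p^`().
Proof.
move=> [[d hd] tu]; split.
  exists d => k; apply: leq_trans (size_poly _ _) _.
  by apply: leq_trans (leq_pred _) _.
move=> i; rewrite coef_deriv -mulr_natr.
rewrite (_ : (fun k => _) = fun k => (u k)`_i.+1 * i.+1%:R).
  by apply: tameM; [exact: tu | exact: tame_cst].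
by apply/funext => k; rewrite coef_deriv mulr_natr.
Qed.

Lemma poly_tame_size (u : nat -> {poly R}) (p : {poly R}) : poly_tame u p ->
  exists d, (forall k, (size (u k) <= d)%N) /\ (size p <= d)%N.
Proof.
move=> [[d hd] tu]; exists (maxn d (size p)); split; last exact: leq_maxr.
by move=> k; apply: leq_trans (hd k) (leq_maxl _ _).
Qed.

Lemma horner_diff_le (p q : {poly R}) d (T t : R) : (size p <= d)%N ->
  (size q <= d)%N -> `|t| <= T ->
  `|p.[t] - q.[t]| <= \sum_(i < d) `|p`_i - q`_i| * T ^+ i.
Proof.
move=> pd qd tT; rewrite (horner_coef_wide _ pd) (horner_coef_wide _ qd) -sumrB.
apply: le_trans (ler_norm_sum _ _ _) _; apply: ler_sum => i _.
by rewrite -mulrBl normrM normrX ler_wpM2l // lerXn2r // nnegrE // (le_trans _ tT).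
Qed.

Lemma poly_tame_cvg (u : nat -> {poly R}) (p : {poly R}) (T e : R) :
  poly_tame u p -> 0 < e ->
  \forall k \near \oo, forall t, `|t| <= T -> `|(u k).[t] - p.[t]| <= e.
Proof.
move=> tu e0; have [d [ud pd]] := poly_tame_size tu; case: tu => _ tu.
have c : (fun k => \sum_(i < d) `|(u k)`_i - p`_i| * T ^+ i) @ \oo --> (0 : R).
  suff : (fun k => \sum_(i < d) `|(u k)`_i - p`_i| * T ^+ i) @ \oo -->
      \sum_(i < d) (0 : R) * T ^+ i.
    by rewrite [in X in _ --> X -> _]big1 // => i _; rewrite mul0r.
  apply: (@cvg_sum_ord _ _ _ _ _ (fun i k => `|(u k)`_i - p`_i| * T ^+ i)
    (fun i => 0 * T ^+ i)) => i _.
  apply: cvgM; last exact: cvg_cst.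
  have h : (fun k => (u k)`_i - p`_i) @ \oo --> p`_i - p`_i.
    by apply: cvgB; [exact: (tu i).1 | exact: cvg_cst].
  by apply/norm_cvg0P; rewrite subrr in h.
have /cvgrPdist_le /(_ _ e0) := c; apply: filterS => k hk t tT.
apply: le_trans (horner_diff_le (ud k) pd tT) _.
by apply: le_trans hk; rewrite sub0r normrN; exact: ler_norm.
Qed.

Lemma poly_tame_variation (u : nat -> {poly R}) (p : {poly R}) (T : R) :
  poly_tame u p -> 0 <= T -> exists2 e, summable_seq e &
  forall k t, `|t| <= T -> `|(u k.+1).[t] - (u k).[t]| <= e k.
Proof.
move=> tu T0; have [d [ud _]] := poly_tame_size tu; case: tu => _ tu.
exists (fun k => \sum_(i < d) `|(u k.+1)`_i - (u k)`_i| * T ^+ i); last first.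
  by move=> k t tT; exact: horner_diff_le.
elim: d {ud} => [|d IH].
  split=> [k|]; first by rewrite big_ord0.
  by exists 0 => n; rewrite big1 // => k _; rewrite big_ord0.
have Td : 0 <= T ^+ d by exact: exprn_ge0.
apply: summable_seq_le (summable_seqD IH (summable_seqZ Td (tu d).2)) _ => k.
by rewrite big_ord_recr /= mulrC lexx andbT addr_ge0 ?sumr_ge0 ?mulr_ge0 // => i _;
  rewrite mulr_ge0 // exprn_ge0.
Qed.

End Tame.

(** * Transfer matrices over one period *)

Lemma mulmx2E (S : pzRingType) n (A : 'M[S]_2) (B : 'M[S]_(2, n)) i l :
  (A *m B) i l = A i 0 * B 0 l + A i 1 * B 1 l.
Proof.
rewrite mxE !big_ord_recl big_ord0 addr0; congr (A i _ * B _ l + A i _ * B _ l);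
exact/val_inj.
Qed.

Lemma mxtrace2E (S : pzRingType) (A : 'M[S]_2) : \tr A = A 0 0 + A 1 1.
Proof.
rewrite /mxtrace !big_ord_recl big_ord0 addr0; congr (A _ _ + A _ _);
exact/val_inj.
Qed.

Lemma ord2_split (P : 'I_2 -> Prop) : P 0 -> P 1 -> forall i, P i.
Proof.
move=> P0 P1 [[|[|i]] hi] //.
- by rewrite (_ : Ordinal hi = 0) //; exact/val_inj.
- by rewrite (_ : Ordinal hi = 1) //; exact/val_inj.
Qed.

Definition det2 (S : pzRingType) (A : 'M[S]_2) : S := A 0 0 * A 1 1 - A 0 1 * A 1 0.

Lemma det2M (S : comPzRingType) (A B : 'M[S]_2) : det2 (A *m B) = det2 A * det2 B.
Proof. by rewrite /det2 !mulmx2E; ring. Qed.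

Section Blocks.
Variable R : realType.
Implicit Types (a b : nat -> R).

(** The recurrence in the coordinates (a_{j+1} p_{j+1}, p_j), where it has
    determinant one. *)
Definition step_mx a b (j : nat) : 'M[{poly R}]_2 :=
  \matrix_(i < 2, l < 2)
    if i == 0 then if l == 0 then ((a j.+1)^-1)%:P * ('X - (b j.+2)%:P)
                   else - (a j.+1)%:P
    else if l == 0 then ((a j.+1)^-1)%:P else 0.

Fixpoint step_prod a b (j m : nat) : 'M[{poly R}]_2 :=
  if m is m'.+1 then step_mx a b (j + m') *m step_prod a b j m' else 1%:M.

Definition ortho_vec a b (j : nat) : 'cV[{poly R}]_2 :=
  \matrix_(i < 2, l < 1)
    if i == 0 then (a j.+1) *: orthopoly a b j.+1 else orthopoly a b j.

Lemma det2_step_prod a b j m : (forall n, 0 < a n.+1) -> det2 (step_prod a b j m) = 1.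
Proof.
move=> a0; elim: m => [|m IH] /=.
  by rewrite /det2 !mxE /= mulr1 mul0r subr0.
rewrite det2M IH mulr1 /det2 !mxE /= mulr0 sub0r mulNr opprK -polyCM.
by rewrite divff // gt_eqF.
Qed.

Lemma ortho_vec_step a b j : (forall n, 0 < a n.+1) ->
  ortho_vec a b j.+1 = step_mx a b j *m ortho_vec a b j.
Proof.
move=> a0; apply/matrixP => i l; rewrite mulmx2E.
have aC : ((a j.+1)^-1)%:P * (a j.+1)%:P = 1 :> {poly R}.
  by rewrite -polyCM mulVf // gt_eqF.
elim/ord2_split : i; rewrite !mxE /=.
  rewrite orthopolyS // -!mul_polyC mulNr; congr (_ - _).
  move: aC; set A := (a j.+1)%:P; set A' := (a j.+1)^-1%:P; set Q := 'X - _ => aC.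
  set q := orthopoly a b j.+1.
  have -> : A' * Q * (A * q) = A' * A * (Q * q) by ring.
  by rewrite aC mul1r.
by rewrite mul0r addr0 -mul_polyC mulrA aC mul1r.
Qed.

Lemma ortho_vec_prod a b j m : (forall n, 0 < a n.+1) ->
  ortho_vec a b (j + m) = step_prod a b j m *m ortho_vec a b j.
Proof.
move=> a0; elim: m => [|m IH] /=; first by rewrite addn0 mul1mx.
by rewrite addnS ortho_vec_step // IH mulmxA.
Qed.

(** Conjugation by diag(a_n, 1) turns the steps above into the transfer
    matrices acting on (u_{n+1}, u_n). *)
Fixpoint transfer_from a b (x : R) (n m : nat) : 'M[R]_2 :=
  if m is m'.+1 then transfer_step a b x (n + m').+1 *m transfer_from a b x n m'
  else 1%:M.

Lemma transfer_stepE a b (x : R) n i l : transfer_step a b x n i l =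
  if i == 0 then if l == 0 then (x - b n) / a n else - (a n.-1 / a n)
  else if l == 0 then 1 else 0.
Proof.
rewrite /transfer_step.
have e0 : (0 : 'I_2) = lshift 1 (0 : 'I_1) by exact/val_inj.
have e1 : (1 : 'I_2) = rshift 1 (0 : 'I_1) by exact/val_inj.
elim/ord2_split : i; elim/ord2_split : l => /=.
- by rewrite [in LHS]e0; apply: etrans (block_mxEul _ _ _ _ _ _) _; rewrite mxE /= mulr1n.
- by rewrite [in LHS]e0 [in LHS]e1; apply: etrans (block_mxEur _ _ _ _ _ _) _; rewrite mxE /= mulr1n.
- by rewrite [in LHS]e0 [in LHS]e1; apply: etrans (block_mxEdl _ _ _ _ _ _) _; rewrite mxE /= mulr1n.
- by rewrite [in LHS]e1; apply: etrans (block_mxEdr _ _ _ _ _ _) _; rewrite mxE.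
Qed.

Definition scale_mx (c : R) : 'M[R]_2 :=
  \matrix_(i < 2, l < 2) if i == l then if i == 0 then c else 1 else 0.

Definition eval_mx (x : R) (A : 'M[{poly R}]_2) : 'M[R]_2 :=
  map_mx (fun q => q.[x]) A.

Lemma eval_mxM (x : R) A B : eval_mx x (A *m B) = eval_mx x A *m eval_mx x B.
Proof.
by apply/matrixP => i l; rewrite [LHS]mxE !mulmx2E hornerD !hornerM /eval_mx !mxE.
Qed.

Lemma transfer_from_conj a b x j m : (forall n, 0 < a n.+1) ->
  scale_mx (a (j.+1 + m)%N) *m transfer_from a b x j.+1 m =
  eval_mx x (step_prod a b j m) *m scale_mx (a j.+1).
Proof.
move=> a0; elim: m => [|m IH] /=.
  rewrite addn0 mulmx1; apply/matrixP => i l; rewrite mulmx2E /eval_mx !mxE.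
  elim/ord2_split : i; elim/ord2_split : l; rewrite /= ?hornerE; lra.
rewrite eval_mxM -mulmxA -IH !mulmxA; congr (_ *m _).
apply/matrixP => i l; rewrite !mulmx2E !transfer_stepE /eval_mx !mxE.
have h1 : a (j + m).+1 != 0 by rewrite gt_eqF.
have h2 : a (j + m).+2 != 0 by rewrite gt_eqF.
rewrite addSn addnS /=.
elim/ord2_split : i; elim/ord2_split : l; rewrite /= ?hornerE /=; field; by rewrite ?h1 ?h2.
Qed.

Lemma transfer_from_recl a b x n m :
  transfer_from a b x n m.+1 = transfer_from a b x n.+1 m *m transfer_step a b x n.+1.
Proof.
elim: m => [|m IH] /=; first by rewrite mulmx1 mul1mx addn0.
rewrite -mulmxA -IH /=.
by rewrite addSnnS.
Qed.

Section Periodic.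
Variables (p : nat) (a0 b0 : nat -> R).
Hypothesis p_gt0 : (0 < p)%N.
Hypothesis a0_gt0 : forall n, 0 < a0 n.
Hypothesis a0_per : forall n, a0 (n + p)%N = a0 n.
Hypothesis b0_per : forall n, b0 (n + p)%N = b0 n.

(** By cyclicity of the trace, the starting point of the period is irrelevant. *)
Lemma mxtrace_step_prod j x :
  (\tr (step_prod a0 b0 j p)).[x] = discriminant a0 b0 p x.
Proof.
have step n : transfer_step a0 b0 x (n + p).+1 = transfer_step a0 b0 x n.+1.
  by rewrite /transfer_step -addSn a0_per b0_per /= a0_per.
have cyc n : \tr (transfer_from a0 b0 x n p) = \tr (transfer_from a0 b0 x 0 p).
  elim: n => // n <-.
  move: step; rewrite -(prednK p_gt0); set q := p.-1 => step.
  rewrite [in RHS]transfer_from_recl [in RHS]mxtrace_mulC -step /=.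
  by rewrite addSnnS.
have -> : discriminant a0 b0 p x = \tr (transfer_from a0 b0 x j.+1 p).
  rewrite cyc /discriminant; congr (\tr _).
  by elim: p => //= m ->.
have := @transfer_from_conj a0 b0 x j p (fun n => a0_gt0 n.+1); rewrite a0_per.
move=> /(congr1 (fun A => scale_mx (a0 j.+1)^-1 *m A)); rewrite mulmxA.
have -> : scale_mx (a0 j.+1)^-1 *m scale_mx (a0 j.+1) = 1%:M.
  apply/matrixP => i l; rewrite mulmx2E !mxE.
  elim/ord2_split : i; elim/ord2_split : l; rewrite /= ?mulVf ?gt_eqF //; lra.
rewrite mul1mx => ->; rewrite mulmxA mxtrace_mulC mulmxA.
have -> : scale_mx (a0 j.+1) *m scale_mx (a0 j.+1)^-1 = 1%:M.
  apply/matrixP => i l; rewrite mulmx2E !mxE.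
  elim/ord2_split : i; elim/ord2_split : l; rewrite /= ?divff ?gt_eqF //; lra.
by rewrite mul1mx !mxtrace2E hornerD !mxE.
Qed.

Variables (a b : nat -> R).
Hypothesis a_gt0 : forall n, 0 < a n.+1.
Hypothesis ab_lim : (fun n => `|a n - a0 n| + `|b n - b0 n|) @ \oo --> (0 : R).
Hypothesis ab_bv : (\sum_(1 <= n <oo)
        (`|a (n + p)%N - a n| + `|b (n + p)%N - b n|)%:E < +oo)%E.

Lemma summable_blocks i : summable_seq (fun k =>
  `|a (k.+1 * p + i.+1)%N - a (k * p + i.+1)%N| + `|b (k.+1 * p + i.+1)%N - b (k * p + i.+1)%N|).
Proof.
pose f n := `|a (n + p)%N - a n| + `|b (n + p)%N - b n|.
have f0 n : 0 <= f n by exact: addr_ge0.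
split=> [k|]; first exact: addr_ge0.
have fE k : `|a (k.+1 * p + i.+1)%N - a (k * p + i.+1)%N| +
   `|b (k.+1 * p + i.+1)%N - b (k * p + i.+1)%N| = f (k * p + i.+1)%N.
  by rewrite /f mulSn -addnA (addnC p).
have [C hC] : exists C, forall N, \sum_(1 <= n < N) f n <= C.
  exists (fine (\sum_(1 <= n <oo) (f n)%:E)%E) => N.
  rewrite -lee_fin fineK; last first.
    rewrite ge0_fin_numE //; apply: nneseries_ge0 => n _ _; rewrite lee_fin; exact: f0.
  rewrite -sumEFin; apply: nneseries_lim_ge => n _ _; rewrite lee_fin; exact: f0.
exists C => n; apply: le_trans (hC (n * p + i.+1)%N).
elim: n => [|n IH]; first by rewrite big_ord0; apply: sumr_ge0.
rewrite big_ord_recr /= fE.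
rewrite (big_cat_nat (n := (n * p + i.+1)%N)) /=; [|by rewrite addnS|by rewrite leq_add2r leq_mul2r leqnSn orbT].
apply: lerD IH _; rewrite big_ltn; last by rewrite ltn_add2r ltn_pmul2r.
by rewrite lerDl sumr_ge0.
Qed.

Lemma tame_block_a i : tame (fun k => a (k * p + i.+1)%N) (a0 i.+1).
Proof.
split; first exact: (cvg_block_a p_gt0 a0_per ab_lim).
by apply: summable_seq_le (summable_blocks i) _ => k; rewrite normr_ge0 lerDl /=.
Qed.

Lemma tame_block_b i : tame (fun k => b (k * p + i.+1)%N) (b0 i.+1).
Proof.
split; first exact: (cvg_block_b p_gt0 b0_per ab_lim).
by apply: summable_seq_le (summable_blocks i) _ => k; rewrite normr_ge0 lerDr /=.
Qed.

Lemma poly_tame_step r i l :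
  poly_tame (fun k => step_mx a b (k * p + r) i l) (step_mx a0 b0 r i l).
Proof.
have ta : tame (fun k => a (k * p + r).+1) (a0 r.+1).
  rewrite (_ : (fun k => _) = fun k => a (k * p + r.+1)%N); first exact: tame_block_a.
  by apply/funext => k; rewrite addnS.
have tb : tame (fun k => b (k * p + r).+2) (b0 r.+2).
  rewrite (_ : (fun k => _) = fun k => b (k * p + r.+2)%N); first exact: tame_block_b.
  by apply/funext => k; rewrite !addnS.
have tV : tame (fun k => (a (k * p + r).+1)^-1) (a0 r.+1)^-1.
  by apply: tameV => // [|k]; rewrite gt_eqF.
have tN : tame (fun k => - b (k * p + r).+2) (- b0 r.+2) by exact: tameN.
rewrite (_ : (fun k => _) = (fun k =>
  if i == 0 then if l == 0 then ((a (k * p + r).+1)^-1)%:P * ('X + (- b (k * p + r).+2)%:P)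
                   else (- a (k * p + r).+1)%:P
    else if l == 0 then ((a (k * p + r).+1)^-1)%:P else 0)); last first.
  by apply/funext => k; rewrite mxE !polyCN.
rewrite mxE; case: (i == 0); case: (l == 0).
- apply: poly_tameM; first exact: poly_tameC.
  by rewrite -polyCN; apply: poly_tameD; [exact: poly_tame_cst | exact: poly_tameC].
- by rewrite -polyCN; apply: poly_tameC; exact: tameN.
- exact: poly_tameC.
- exact: poly_tame_cst.
Qed.

Lemma poly_tame_step_prod r m i l :
  poly_tame (fun k => step_prod a b (k * p + r) m i l) (step_prod a0 b0 r m i l).
Proof.
elim: m i l => [|m IH] i l; first exact: poly_tame_cst.
rewrite [X in poly_tame _ X]mulmx2E (_ : (fun k => _) = fun k =>
   step_mx a b (k * p + (r + m)) i 0 * step_prod a b (k * p + r) m 0 l +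
   step_mx a b (k * p + (r + m)) i 1 * step_prod a b (k * p + r) m 1 l).
  by apply: poly_tameD; apply: poly_tameM => //; exact: poly_tame_step.
by apply/funext => k; rewrite /= mulmx2E addnA.
Qed.

End Periodic.
End Blocks.

(** * Rotations of the plane *)

Definition rotx (R : realType) (h u z : R) : R := cos h * u - sin h * z.
Definition roty (R : realType) (h u z : R) : R := sin h * u + cos h * z.
(** Equivalent to the Euclidean norm, and free of square roots; rotations preserve
    it up to a factor 2. *)
Definition norm1 (R : realType) (u z : R) : R := `|u| + `|z|.

Section Rotation.
Variable R : realType.
Implicit Types h u z : R.

Lemma norm1_ge0 u z : 0 <= norm1 u z. Proof. exact: addr_ge0. Qed.

Lemma norm1D u z u' z' : norm1 (u + u') (z + z') <= norm1 u z + norm1 u' z'.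
Proof.
rewrite /norm1; have := ler_normD u u'; have := ler_normD z z'; lra.
Qed.

Lemma norm1B u z u' z' : norm1 (u - u') (z - z') = norm1 (u' - u) (z' - z).
Proof. by rewrite /norm1 distrC (distrC z). Qed.

Lemma norm1_rot h u z : norm1 (rotx h u z) (roty h u z) <= 2 * norm1 u z.
Proof.
rewrite /norm1 /rotx /roty.
have hu : `|cos h * u| <= `|u| by rewrite normrM ler_piMl // cos_max.
have hz : `|sin h * z| <= `|z| by rewrite normrM ler_piMl // sin_max.
have hu' : `|sin h * u| <= `|u| by rewrite normrM ler_piMl // sin_max.
have hz' : `|cos h * z| <= `|z| by rewrite normrM ler_piMl // cos_max.
have := ler_normB (cos h * u) (sin h * z).
have := ler_normD (sin h * u) (cos h * z); lra.
Qed.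

Lemma rotx_add h h' u z :
  rotx (h + h') u z = rotx h (rotx h' u z) (roty h' u z).
Proof. by rewrite /rotx /roty cosD sinD; ring. Qed.

Lemma roty_add h h' u z :
  roty (h + h') u z = roty h (rotx h' u z) (roty h' u z).
Proof. by rewrite /rotx /roty cosD sinD; ring. Qed.

Lemma rotxB h u z u' z' :
  rotx h (u - u') (z - z') = rotx h u z - rotx h u' z'.
Proof. by rewrite /rotx; ring. Qed.

Lemma rotyB h u z u' z' :
  roty h (u - u') (z - z') = roty h u z - roty h u' z'.
Proof. by rewrite /roty; ring. Qed.

Lemma rotx0 u z : rotx 0 u z = u.
Proof. by rewrite /rotx cos0 sin0; ring. Qed.

Lemma roty0 u z : roty 0 u z = z.
Proof. by rewrite /roty cos0 sin0; ring. Qed.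

Lemma norm1_rot_inv h u z : norm1 u z <= 2 * norm1 (rotx h u z) (roty h u z).
Proof.
have := norm1_rot (- h) (rotx h u z) (roty h u z).
by rewrite -rotx_add -roty_add addNr rotx0 roty0.
Qed.

End Rotation.

(** As long as the distance to the start is at most the norm of the start, norms are
    at most doubled, and the relative increments add up like absolute ones. *)
Lemma relative_stability (R : realType) (P Q e : nat -> R) (k1 : nat) (d : R) :
  (forall k, 0 <= e k) -> d <= 1 / 2 ->
  (forall n, \sum_(k1 <= k < n) e k <= d) ->
  (forall k, (k1 <= k)%N ->
     norm1 (P k.+1 - P k) (Q k.+1 - Q k) <= e k * norm1 (P k) (Q k)) ->
  forall k, (k1 <= k)%N ->
  norm1 (P k - P k1) (Q k - Q k1) <= 2 * d * norm1 (P k1) (Q k1).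
Proof.
move=> e0 d2 se st k k1k.
suff h : norm1 (P k - P k1) (Q k - Q k1) <=
    2 * (\sum_(k1 <= j < k) e j) * norm1 (P k1) (Q k1).
  by apply: le_trans h _; rewrite ler_wpM2r ?norm1_ge0 // ler_wpM2l.
rewrite -(subnKC k1k); elim: (k - k1)%N => [|m IH].
  by rewrite addn0 !subrr /norm1 normr0 addr0 big_geq // mulr0 mul0r.
rewrite addnS; set j := (k1 + m)%N in IH *; have k1j : (k1 <= j)%N by exact: leq_addr.
rewrite big_nat_recr //=.
have S2 : \sum_(k1 <= i < j) e i <= 1 / 2 by exact: le_trans (se j) d2.
set S := \sum_(k1 <= i < j) e i in IH S2 *; set N1 := norm1 (P k1) (Q k1) in IH *.
have N10 : 0 <= N1 by exact: norm1_ge0.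
have hj : norm1 (P j) (Q j) <= 2 * N1.
  have := norm1D (P j - P k1) (Q j - Q k1) (P k1) (Q k1); rewrite !subrK -/N1 => h.
  apply: le_trans h _; have h2 : 2 * S * N1 <= 1 * N1 by rewrite ler_wpM2r //; lra.
  lra.
have h1 := norm1D (P j.+1 - P j) (Q j.+1 - Q j) (P j - P k1) (Q j - Q k1).
have eqs (X : nat -> R) : X j.+1 - X j + (X j - X k1) = X j.+1 - X k1 by ring.
rewrite !eqs in h1; apply: le_trans h1 _.
have h2 := st j k1j; have h3 : e j * norm1 (P j) (Q j) <= e j * (2 * N1).
  by rewrite ler_wpM2l.
have -> : 2 * (S + e j) * N1 = 2 * S * N1 + e j * (2 * N1) by ring.
lra.
Qed.

(** * Diagonalization of one elliptic block *)

(** (m21, tau - m11 + i sn) is a left eigenvector of the block for the eigenvalue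
    tau + i sn; its real and imaginary parts applied to (x, y) give coordinates in
    which the block is a rotation. *)
Lemma elliptic_rotation (R : realType) (m11 m12 m21 m22 tau sn x y : R) :
  m11 * m22 - m12 * m21 = 1 -> 2 * tau = m11 + m22 -> sn ^+ 2 = 1 - tau ^+ 2 ->
  let x' := m11 * x + m12 * y in let y' := m21 * x + m22 * y in
  let u := m21 * x + (tau - m11) * y in let z := sn * y in
  m21 * x' + (tau - m11) * y' = tau * u - sn * z /\ sn * y' = sn * u + tau * z.
Proof.
move=> det tr sn2 x' y' u z; have m22E : m22 = 2 * tau - m11 by lra.
have h : m12 * m21 = m11 * (2 * tau - m11) - 1 by rewrite -m22E -det; ring.
split; last by rewrite /y' /u /z m22E; ring.
have -> : m21 * x' + (tau - m11) * y' =
   m21 * m11 * x + (m12 * m21) * y + (tau - m11) * (m21 * x + m22 * y).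
  by rewrite /x' /y'; ring.
have -> : tau * u - sn * z = tau * u - sn ^+ 2 * y by rewrite /z; ring.
by rewrite m22E h sn2 /u; ring.
Qed.

(** The change of coordinates has an inverse that is controlled away from the band
    edges: m12 being bounded, m21 cannot be small in view of
    - m12 m21 = 1 - tau^2 + (tau - m11)^2. *)
Lemma elliptic_bound (R : realType) (m11 m12 m21 m22 tau sn kap B x y : R) :
  0 < kap -> kap <= 1 -> 1 <= B -> `|m11| <= B -> `|m12| <= B ->
  m11 * m22 - m12 * m21 = 1 -> 2 * tau = m11 + m22 ->
  kap <= 1 - tau ^+ 2 -> kap <= `|sn| ->
  let u := m21 * x + (tau - m11) * y in let z := sn * y in
  `|x| <= B / kap * (1 + 2 * B / kap) * norm1 u z /\ `|y| <= kap^-1 * norm1 u z.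
Proof.
move=> kap0 kap1 B1 b11 b12 det tr ell ksn u z.
have hy : `|y| <= kap^-1 * norm1 u z.
  rewrite mulrC ler_pdivlMr // mulrC.
  apply: le_trans (_ : `|z| <= _); last by rewrite /norm1 lerDr.
  by rewrite /z normrM ler_wpM2r.
split=> //.
have m0 : kap <= `|m12| * `|m21|.
  have : kap <= - (m12 * m21).
    have := sqr_ge0 (m11 - m22); nra.
  by rewrite -normrM => h; apply: le_trans h _; rewrite -normrN; exact: ler_norm.
have m21B : kap / B <= `|m21|.
  rewrite ler_pdivrMr; last lra.
  by apply: le_trans m0 _; rewrite mulrC ler_wpM2l.
have tau1 : `|tau| <= 1.
  by rewrite -(@expr_le1 _ 2) // real_normK ?num_real //; lra.
have h1 : `|tau - m11| <= 2 * B by have := ler_normB tau m11; lra.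
have h2 : `|m21 * x| <= norm1 u z * (1 + 2 * B / kap).
  have -> : m21 * x = u - (tau - m11) * y by rewrite /u; ring.
  apply: le_trans (ler_normB _ _) _; rewrite mulrDr mulr1; apply: lerD.
    by rewrite /norm1 lerDl.
  rewrite normrM; apply: le_trans (_ : 2 * B * (kap^-1 * norm1 u z) <= _).
    by rewrite ler_pM.
  by rewrite le_eqVlt; apply/orP; left; apply/eqP; ring.
have Bk : 0 < kap / B by rewrite divr_gt0 //; lra.
have h3 : kap / B * `|x| <= norm1 u z * (1 + 2 * B / kap).
  by apply: le_trans h2; rewrite normrM ler_wpM2r.
rewrite -(ler_pM2l Bk); apply: le_trans h3 _.
rewrite le_eqVlt; apply/orP; left; apply/eqP; field; apply/andP; split; lra.
Qed.

(** * The rotation angle of a block *)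

(** An angle with cosine q(t); for s the sign of the derivative of q it increases
    with t. *)
Definition phase (R : realType) (s : R) (q : {poly R}) (t : R) : R :=
  - s * acos q.[t].

Definition dphase (R : realType) (s : R) (q : {poly R}) (t : R) : R :=
  s * q^`().[t] / Num.sqrt (1 - q.[t] ^+ 2).

Section Phase.
Variables (R : realType) (s kap : R).
Hypothesis s1 : s = 1 \/ s = -1.
Hypothesis kap0 : 0 < kap.
Implicit Types (q : {poly R}) (t : R).

Lemma elliptic_itv q t : kap <= 1 - q.[t] ^+ 2 -> -1 < q.[t] < 1.
Proof.
rewrite expr2 => h; have k0 := kap0.
by apply/andP; split; rewrite ltNge; apply/negP => h1; nra.
Qed.

Lemma elliptic_sqrt q t : kap <= 1 - q.[t] ^+ 2 ->
  kap <= Num.sqrt (1 - q.[t] ^+ 2) <= 1.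
Proof.
move=> h; have h0 : 0 <= 1 - q.[t] ^+ 2 by exact: le_trans (ltW kap0) h.
have := sqr_sqrtr h0; have := sqrtr_ge0 (1 - q.[t] ^+ 2); have := sqr_ge0 q.[t].
set A := Num.sqrt _ => q0 A0 AE; rewrite -AE expr2 in h.
have A1 : A * A <= 1 by rewrite -expr2 AE; lra.
by apply/andP; split; rewrite leNgt; apply/negP => h1; nra.
Qed.

Lemma cos_phase q t : kap <= 1 - q.[t] ^+ 2 -> cos (phase s q t) = q.[t].
Proof.
move=> /elliptic_itv/andP[h1 h2]; rewrite /phase.
have e : cos (- s * acos q.[t]) = cos (acos q.[t]).
  by case: s1 => ->; rewrite ?mulN1r ?opprK ?mul1r ?cosN.
by rewrite e acosK // in_itv /= !ltW.
Qed.

Lemma sin_phase q t : kap <= 1 - q.[t] ^+ 2 ->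
  sin (phase s q t) = - s * Num.sqrt (1 - q.[t] ^+ 2).
Proof.
move=> /elliptic_itv/andP[h1 h2]; rewrite /phase -sin_acos ?ltW //.
by case: s1 => ->; rewrite ?mulN1r ?opprK ?mul1r ?sinN.
Qed.

Lemma sin_phase_sqr q t : kap <= 1 - q.[t] ^+ 2 ->
  sin (phase s q t) ^+ 2 = 1 - q.[t] ^+ 2.
Proof.
by move=> h; have := cos2Dsin2 (phase s q t); rewrite (cos_phase h) => <-; ring.
Qed.

Lemma sin_phase_ge q t : kap <= 1 - q.[t] ^+ 2 -> kap <= `|sin (phase s q t)|.
Proof.
move=> h; have /andP[h1 _] := elliptic_sqrt h.
rewrite sin_phase // normrM (ger0_norm (sqrtr_ge0 _)).
by case: s1 => ->; rewrite ?normrN ?opprK normr1 mul1r.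
Qed.

Lemma sin_phase_diff q q' t : kap <= 1 - q.[t] ^+ 2 -> kap <= 1 - q'.[t] ^+ 2 ->
  `|sin (phase s q' t) - sin (phase s q t)| <= kap^-1 * `|q'.[t] - q.[t]|.
Proof.
move=> h h'; rewrite !sin_phase //.
have /andP[a1 a2] := elliptic_sqrt h; have /andP[b1 b2] := elliptic_sqrt h'.
have e1 := sqr_sqrtr (le_trans (ltW kap0) h).
have e2 := sqr_sqrtr (le_trans (ltW kap0) h').
have /andP[c1 c2] := elliptic_itv h; have /andP[d1 d2] := elliptic_itv h'.
set A := Num.sqrt _ in a1 a2 e1 *; set B := Num.sqrt _ in b1 b2 e2 *.
have -> : `|- s * B - - s * A| = `|B - A|.
  by rewrite -mulrBr normrM; case: s1 => ->; rewrite ?normrN ?opprK normr1 mul1r.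
rewrite mulrC ler_pdivlMr //.
have AB : (B - A) * (B + A) = (q.[t] - q'.[t]) * (q.[t] + q'.[t]).
  have -> : (B - A) * (B + A) = B ^+ 2 - A ^+ 2 by ring.
  by rewrite e1 e2; ring.
have n1 : `|B - A| * (B + A) = `|q.[t] - q'.[t]| * `|q.[t] + q'.[t]|.
  have k0 := kap0; have BA0 : 0 <= B + A by lra.
  by rewrite -normrM -AB normrM (ger0_norm BA0).
have n2 : `|q.[t] + q'.[t]| <= 2 by rewrite ler_norml; apply/andP; split; lra.
have n3 : `|q.[t] - q'.[t]| * `|q.[t] + q'.[t]| <= `|q.[t] - q'.[t]| * 2.
  by rewrite ler_wpM2l.
have n4 : `|B - A| * (2 * kap) <= `|B - A| * (B + A) by rewrite ler_wpM2l //; lra.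
rewrite [leRHS]distrC; lra.
Qed.

Lemma is_derive_phase q t : kap <= 1 - q.[t] ^+ 2 ->
  is_derive t (1 : R) (phase s q) (dphase s q t).
Proof.
move=> h; have hi := elliptic_itv h.
have d1 := is_derive1_acos hi.
have d2 := is_derive1_comp d1 (is_derive_poly q t).
have d3 := is_deriveZ (- s) d2.
rewrite (_ : phase s q = (- s) \*: (acos \o horner q)); last exact/funext.
apply: is_derive_eq d3 _; rewrite /dphase /GRing.scale /=; ring.
Qed.

Lemma continuous_phase q t : kap <= 1 - q.[t] ^+ 2 ->
  {for t, continuous (phase s q)}.
Proof.
move=> h; apply: differentiable_continuous; apply/derivable1_diffP.
by have [] := is_derive_phase h.
Qed.

Lemma dphase_ge q t : kap <= 1 - q.[t] ^+ 2 -> kap <= s * q^`().[t] ->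
  kap <= dphase s q t.
Proof.
move=> h h2; have /andP[h3 h4] := elliptic_sqrt h; rewrite /dphase.
rewrite ler_pdivlMr; last exact: lt_le_trans h3.
by apply: le_trans h2; rewrite ler_piMr // ltW.
Qed.

Lemma dphase_diff q q' t : kap <= 1 - q.[t] ^+ 2 -> kap <= 1 - q'.[t] ^+ 2 ->
  `|dphase s q' t - dphase s q t| <=
  kap^-1 * `|q'^`().[t] - q^`().[t]| + `|q^`().[t]| * kap^-1 ^+ 3 * `|q'.[t] - q.[t]|.
Proof.
move=> h h'; have sd := sin_phase_diff h h'; move: sd; rewrite !sin_phase //.
have /andP[a1 a2] := elliptic_sqrt h; have /andP[b1 b2] := elliptic_sqrt h'.
rewrite /dphase.
set A := Num.sqrt _ in a1 a2 *; set B := Num.sqrt _ in b1 b2 *.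
have ns : `|s| = 1 by case: s1 => ->; rewrite ?normrN normr1.
have -> : `|- s * B - - s * A| = `|B - A|.
  by rewrite -mulrBr normrM normrN ns mul1r.
move=> sd; have A0 : A != 0 by rewrite gt_eqF // (lt_le_trans kap0).
have B0 : B != 0 by rewrite gt_eqF // (lt_le_trans kap0).
have -> : s * q'^`().[t] / B - s * q^`().[t] / A =
  s * (B^-1 * (q'^`().[t] - q^`().[t])) - s * (q^`().[t] * (A^-1 * B^-1 * (B - A))).
  by field; rewrite A0 B0.
have hi X : kap <= X -> `|X^-1| <= kap^-1.
  move=> kX; have X0 := lt_le_trans kap0 kX.
  have X0i : 0 <= X^-1 by rewrite invr_ge0 ltW.
  by rewrite (ger0_norm X0i) lef_pV2 ?posrE.
apply: le_trans (ler_normB _ _) _; apply: lerD.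
  by rewrite !normrM ns mul1r ler_wpM2r // hi.
rewrite !normrM ns mul1r -[leRHS]mulrA ler_wpM2l //.
have k0 : 0 <= kap^-1 by rewrite invr_ge0 ltW.
rewrite exprS expr2 -!mulrA; apply: ler_pM => //; [exact: hi |].
by apply: ler_pM => //; exact: hi.
Qed.

End Phase.

Lemma poly_tame_bounded (R : realType) (u : nat -> {poly R}) (q : {poly R}) (T : R) :
  poly_tame u q -> 0 <= T ->
  exists2 B, 0 <= B & forall k t, `|t| <= T -> `|(u k).[t]| <= B.
Proof.
move=> tu T0; have [e [e0 [C hC]] he] := poly_tame_variation tu T0.
have C0 : 0 <= C by have := hC 0%N; rewrite big_ord0.
pose D := \sum_(i < size (u 0%N)) `|(u 0%N)`_i| * T ^+ i.
have D0 : 0 <= D by apply: sumr_ge0 => i _; rewrite mulr_ge0 // exprn_ge0.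
exists (D + C) => [|k t tT]; first exact: addr_ge0.
have h0 : `|(u 0%N).[t]| <= D.
  have := @horner_diff_le _ (u 0%N) 0 (size (u 0%N)) T t (leqnn _).
  rewrite size_poly0 => /(_ isT tT); rewrite horner0 subr0 => h; apply: le_trans h _.
  by apply: ler_sum => i _; rewrite coef0 subr0.
have -> : (u k).[t] = (u 0%N).[t] + \sum_(i < k) ((u i.+1).[t] - (u i).[t]).
  rewrite -(big_mkord xpredT (fun i => (u i.+1).[t] - (u i).[t])) telescope_sumr //.
  by rewrite addrC subrK.
apply: le_trans (ler_normD _ _) _; apply: lerD h0 _.
apply: le_trans (ler_norm_sum _ _ _) _; apply: le_trans (hC k).
by apply: ler_sum => i _; exact: he.
Qed.

(** * Asymptotic rotation of the state *)

Definition half_trace (R : realType) (A : 'M[{poly R}]_2) : {poly R} :=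
  (2^-1)%:P * (A 0 0 + A 1 1).

Section Stability.
Variables (R : realType) (M : nat -> 'M[{poly R}]_2) (L : 'M[{poly R}]_2).
Variables (V : nat -> 'cV[{poly R}]_2) (al be s kap : R).
Hypothesis tM : forall i l, poly_tame (fun k => M k i l) (L i l).
Hypothesis detM : forall k, det2 (M k) = 1.
Hypothesis VS : forall k, V k.+1 = M k *m V k.
Hypothesis s1 : s = 1 \/ s = -1.
Hypothesis kap0 : 0 < kap.
Hypothesis kap1 : kap <= 1.
Hypothesis ell : forall k t, al <= t <= be -> kap <= 1 - (half_trace (M k)).[t] ^+ 2.

Local Notation T k := (half_trace (M k)).
Local Notation ph k := (phase s (half_trace (M k))).

Lemma poly_tame_half_trace : poly_tame (fun k => T k) (half_trace L).
Proof.
by apply: poly_tameM; [exact: poly_tame_cst | apply: poly_tameD].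
Qed.

Let bnd := Num.max `|al| `|be|.

Lemma in_bnd t : al <= t <= be -> `|t| <= bnd.
Proof.
move=> /andP[h1 h2]; rewrite /bnd le_max; case: (lerP 0 t) => t0.
  by rewrite [`|t|]ger0_norm // [`|be|]ger0_norm ?h2 ?orbT //; lra.
by rewrite [`|t|]ltr0_norm // [`|al|]ltr0_norm ?lerN2 ?h1 //; lra.
Qed.

Lemma bnd_ge0 : 0 <= bnd. Proof. by rewrite /bnd le_max normr_ge0. Qed.

(** The coordinates of the state V k in which the block M k is a rotation; the
    second one has the zeros of the second component of V k. *)
Definition wx k t : R :=
  (M k 1 0).[t] * (V k 0 0).[t] + ((T k).[t] - (M k 0 0).[t]) * (V k 1 0).[t].
Definition wy k t : R := sin (ph k t) * (V k 1 0).[t].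

(** In the coordinates of its own block the state is rotated exactly; passing to
    the coordinates of the next block costs the variation of the coefficients. *)
Lemma block_step : exists2 e, summable_seq e &
  forall k t, al <= t <= be ->
  norm1 (wx k.+1 t - rotx (ph k t) (wx k t) (wy k t))
        (wy k.+1 t - roty (ph k t) (wx k t) (wy k t))
  <= e k * norm1 (wx k t) (wy k t).
Proof.
have [B1 _ hB1] := poly_tame_bounded (tM 0 0) bnd_ge0.
have [B2 _ hB2] := poly_tame_bounded (tM 0 1) bnd_ge0.
pose B := Num.max 1 (Num.max B1 B2).
have B1' : 1 <= B by rewrite /B le_max lexx.
have hB00 k t : al <= t <= be -> `|(M k 0 0).[t]| <= B.
  by move=> /in_bnd/(hB1 k) h; rewrite /B !le_max h orbT.
have hB01 k t : al <= t <= be -> `|(M k 0 1).[t]| <= B.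
  by move=> /in_bnd/(hB2 k) h; rewrite /B !le_max h !orbT.
have [e1 se1 he1] := poly_tame_variation (tM 1 0) bnd_ge0.
have [e2 se2 he2] := poly_tame_variation (tM 0 0) bnd_ge0.
have [e3 se3 he3] := poly_tame_variation poly_tame_half_trace bnd_ge0.
have ki0 : 0 <= kap^-1 by rewrite invr_ge0 ltW.
pose C := B / kap * (1 + 2 * B / kap).
have C0 : 0 <= C.
  rewrite /C mulr_ge0 ?addr_ge0 ?mulr_ge0 //; lra.
exists (fun k => 2 * (C * e1 k + kap^-1 * (e3 k + e2 k + kap^-1 * e3 k))).
  apply: summable_seqZ => //; apply: summable_seqD; apply: summable_seqZ => //.
  by apply: summable_seqD; [exact: summable_seqD | exact: summable_seqZ].
move=> k t It.
have ek := ell k It; have ek1 := ell k.+1 It.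
have V0 : (V k.+1 0 0).[t] = (M k 0 0).[t] * (V k 0 0).[t] + (M k 0 1).[t] * (V k 1 0).[t].
  by rewrite VS mulmx2E hornerD !hornerM.
have V1 : (V k.+1 1 0).[t] = (M k 1 0).[t] * (V k 0 0).[t] + (M k 1 1).[t] * (V k 1 0).[t].
  by rewrite VS mulmx2E hornerD !hornerM.
have det : (M k 0 0).[t] * (M k 1 1).[t] - (M k 0 1).[t] * (M k 1 0).[t] = 1.
  have := congr1 (fun q => q.[t]) (detM k).
  by rewrite /det2 hornerD hornerN !hornerM hornerC.
have tr : 2 * (T k).[t] = (M k 0 0).[t] + (M k 1 1).[t].
  by rewrite /half_trace hornerM hornerC hornerD mulrA divff ?mul1r ?pnatr_eq0.
have [] := elliptic_rotation (V k 0 0).[t] (V k 1 0).[t] det tr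
  (sin_phase_sqr s1 kap0 ek).
rewrite -V0 -V1 -/(wx k t) -/(wy k t) => ex ey.
have [] := elliptic_bound (V k.+1 0 0).[t] (V k.+1 1 0).[t] kap0 kap1 B1'
  (hB00 k t It) (hB01 k t It) det tr ek (sin_phase_ge s1 kap0 ek).
rewrite ex ey.
have -> : (T k).[t] * wx k t - sin (ph k t) * wy k t = rotx (ph k t) (wx k t) (wy k t).
  by rewrite /rotx (cos_phase s1 kap0 ek).
have -> : sin (ph k t) * wx k t + (T k).[t] * wy k t = roty (ph k t) (wx k t) (wy k t).
  by rewrite /roty (cos_phase s1 kap0 ek).
rewrite -/C => bx by_.
set X1 := (V k.+1 0 0).[t] in ex ey bx *; set Y1 := (V k.+1 1 0).[t] in ex ey by_ *.
set N := norm1 (wx k t) (wy k t).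
have rN := norm1_rot (ph k t) (wx k t) (wy k t); rewrite -/N in rN.
have N0 : 0 <= N by exact: norm1_ge0.
have {}bx : `|X1| <= C * (2 * N) by apply: le_trans bx _; rewrite ler_wpM2l.
have {}by_ : `|Y1| <= kap^-1 * (2 * N) by apply: le_trans by_ _; rewrite ler_wpM2l.
have dx : wx k.+1 t - rotx (ph k t) (wx k t) (wy k t) =
    ((M k.+1 1 0).[t] - (M k 1 0).[t]) * X1 +
    ((T k.+1).[t] - (T k).[t] - ((M k.+1 0 0).[t] - (M k 0 0).[t])) * Y1.
  rewrite /rotx (cos_phase s1 kap0 ek) -ex /wx -/X1 -/Y1; ring.
have dy : wy k.+1 t - roty (ph k t) (wx k t) (wy k t) =
    (sin (ph k.+1 t) - sin (ph k t)) * Y1.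
  by rewrite /roty (cos_phase s1 kap0 ek) -ey /wy -/Y1; ring.
have tb := in_bnd It; have h1 := he1 k t tb; have h2 := he2 k t tb; have h3 := he3 k t tb.
have hs := sin_phase_diff s1 kap0 ek ek1.
have d1 : `|((M k.+1 1 0).[t] - (M k 1 0).[t]) * X1| <= e1 k * (C * (2 * N)).
  by rewrite normrM ler_pM.
have d2 : `|((T k.+1).[t] - (T k).[t] - ((M k.+1 0 0).[t] - (M k 0 0).[t])) * Y1|
    <= (e3 k + e2 k) * (kap^-1 * (2 * N)).
  by rewrite normrM ler_pM // (le_trans (ler_normB _ _)) // lerD.
have d3 : `|(sin (ph k.+1 t) - sin (ph k t)) * Y1| <= (kap^-1 * e3 k) * (kap^-1 * (2 * N)).
  by rewrite normrM ler_pM // (le_trans hs) // ler_wpM2l.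
rewrite dx dy /norm1; apply: le_trans (lerD (ler_normD _ _) (lexx _)) _.
apply: le_trans (lerD (lerD d1 d2) d3) _.
by rewrite le_eqVlt; apply/orP; left; apply/eqP; ring.
Qed.

Definition total_phase k t : R := \sum_(j < k) ph j t.

(** The state with the accumulated rotation undone. *)
Definition cx k t : R := rotx (- total_phase k t) (wx k t) (wy k t).
Definition cy k t : R := roty (- total_phase k t) (wx k t) (wy k t).

Lemma derotated_step : exists2 e, summable_seq e &
  forall k t, al <= t <= be ->
  norm1 (cx k.+1 t - cx k t) (cy k.+1 t - cy k t) <= e k * norm1 (cx k t) (cy k t).
Proof.
have [e se he] := block_step; exists (fun k => 4 * e k); first exact: summable_seqZ.
move=> k t It.
have e1 : - total_phase k t = - total_phase k.+1 t + ph k t.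
  by rewrite /total_phase big_ord_recr /=; ring.
have -> : cx k.+1 t - cx k t = rotx (- total_phase k.+1 t)
    (wx k.+1 t - rotx (ph k t) (wx k t) (wy k t))
    (wy k.+1 t - roty (ph k t) (wx k t) (wy k t)).
  by rewrite rotxB /cx e1 rotx_add.
have -> : cy k.+1 t - cy k t = roty (- total_phase k.+1 t)
    (wx k.+1 t - rotx (ph k t) (wx k t) (wy k t))
    (wy k.+1 t - roty (ph k t) (wx k t) (wy k t)).
  by rewrite rotyB /cy e1 roty_add.
apply: le_trans (norm1_rot _ _ _) _.
have h1 := he k t It; have h2 := norm1_rot_inv (- total_phase k t) (wx k t) (wy k t).
have e0 : 0 <= e k by case: se => e0 _.
rewrite -/(cx k t) -/(cy k t) in h2.
have h3 : e k * norm1 (wx k t) (wy k t) <= e k * (2 * norm1 (cx k t) (cy k t)).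
  by rewrite ler_wpM2l.
have -> : 4 * e k * norm1 (cx k t) (cy k t) = 2 * (e k * (2 * norm1 (cx k t) (cy k t))).
  ring.
lra.
Qed.

Lemma continuous_total_phase k t : al <= t <= be -> {for t, continuous (total_phase k)}.
Proof.
move=> It; elim: k => [|k IH].
  rewrite (_ : total_phase 0 = cst 0); first exact: cst_continuous.
  by apply/funext => x; rewrite /total_phase big_ord0.
rewrite (_ : total_phase k.+1 = (fun x => total_phase k x + ph k x)); last first.
  by apply/funext => x; rewrite /total_phase big_ord_recr.
have cph := continuous_phase (s := s) kap0 (ell k It).
by apply: cvgD; [exact: IH | exact: cph].
Qed.

Lemma continuous_wx k t : {for t, continuous (wx k)}.
Proof.
apply: cvgD; first by apply: cvgM; exact: continuous_horner.
by apply: cvgM; [apply: cvgB; exact: continuous_horner | exact: continuous_horner].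
Qed.

Lemma continuous_wy k t : al <= t <= be -> {for t, continuous (wy k)}.
Proof.
move=> It; apply: cvgM; last exact: continuous_horner.
apply: (@cvg_comp _ _ _ (ph k) sin) (continuous_phase (s := s) kap0 (ell k It)) _.
exact: continuous_sin.
Qed.

Lemma continuous_cxy k t : al <= t <= be ->
  {for t, continuous (cx k)} /\ {for t, continuous (cy k)}.
Proof.
move=> It; have cP := @continuous_total_phase k t It.
have cN : (fun x => - total_phase k x) x @[x --> t] --> - total_phase k t by exact: cvgN.
have cc : cos (- total_phase k x) @[x --> t] --> cos (- total_phase k t).
  by apply: (@cvg_comp _ _ _ (fun x => - total_phase k x) cos) cN _; exact: continuous_cos.
have cs : sin (- total_phase k x) @[x --> t] --> sin (- total_phase k t).
  by apply: (@cvg_comp _ _ _ (fun x => - total_phase k x) sin) cN _; exact: continuous_sin.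
have cwx := @continuous_wx k t; have cwy := @continuous_wy k t It.
by split; [apply: cvgB | apply: cvgD]; apply: cvgM.
Qed.

Hypothesis albe : al <= be.
Hypothesis Vn0 : forall k t, ~ ((V k 0 0).[t] = 0 /\ (V k 1 0).[t] = 0).

Lemma state_neq0 k t : al <= t <= be -> 0 < norm1 (wx k t) (wy k t).
Proof.
move=> It; rewrite lt_def norm1_ge0 andbT; apply/eqP => w0.
have ek := ell k It.
have det : (M k 0 0).[t] * (M k 1 1).[t] - (M k 0 1).[t] * (M k 1 0).[t] = 1.
  have := congr1 (fun q => q.[t]) (detM k).
  by rewrite /det2 hornerD hornerN !hornerM hornerC.
have tr : 2 * (T k).[t] = (M k 0 0).[t] + (M k 1 1).[t].
  by rewrite /half_trace hornerM hornerC hornerD mulrA divff ?mul1r ?pnatr_eq0.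
pose B := Num.max 1 (Num.max `|(M k 0 0).[t]| `|(M k 0 1).[t]|).
have B1 : 1 <= B by rewrite /B le_max lexx.
have b1 : `|(M k 0 0).[t]| <= B by rewrite /B !le_max lexx orbT.
have b2 : `|(M k 0 1).[t]| <= B by rewrite /B !le_max lexx !orbT.
have [] := elliptic_bound (V k 0 0).[t] (V k 1 0).[t] kap0 kap1 B1 b1 b2 det tr ek
  (sin_phase_ge s1 kap0 ek).
rewrite -/(wx k t) -/(wy k t) w0 !mulr0 !normr_le0 => /eqP h1 /eqP h2.
exact: (@Vn0 k t).
Qed.

Lemma derotated_neq0 k t : al <= t <= be -> 0 < norm1 (cx k t) (cy k t).
Proof.
move=> It; have := norm1_rot_inv (- total_phase k t) (wx k t) (wy k t).
have := state_neq0 k It; rewrite -/(cx k t) -/(cy k t); lra.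
Qed.

(** On a short interval of energies the state of every late block is, up to a
    small relative error, a rotation of the state at one energy by the increment
    of the accumulated phase: the derotated states converge uniformly in the
    energy, so that their variation is that of a single continuous function. *)
Lemma state_rotation (eta : R) : 0 < eta -> exists K d, 0 < d /\
  forall k t E, (K <= k)%N -> al <= t <= be -> al <= E <= be -> `|t - E| <= d ->
  norm1 (wx k t - rotx (total_phase k t - total_phase k E) (wx k E) (wy k E))
        (wy k t - roty (total_phase k t - total_phase k E) (wx k E) (wy k E))
  <= eta * norm1 (wx k E) (wy k E).
Proof.
move=> eta0; pose d := Num.min (1 / 4) (eta / 48).
have d0 : 0 < d by rewrite /d lt_min !divr_gt0.
have d4 : d <= 1 / 4 by rewrite /d ge_min lexx.
have deta : d <= eta / 48 by rewrite /d ge_min lexx orbT.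
have [e se he] := derotated_step.
have [K hK] := summable_seq_tail se d0.
pose N k t := norm1 (cx k t) (cy k t).
have tail k t : (K <= k)%N -> al <= t <= be ->
    norm1 (cx k t - cx K t) (cy k t - cy K t) <= 2 * d * N K t.
  move=> Kk It; apply: (@relative_stability _ (cx^~ t) (cy^~ t) e K d) => //.
  - by case: se.
  - lra.
  - by move=> n; exact: hK.
  - by move=> j _; exact: he.
have [mu mu0 hmu] : exists2 mu, 0 < mu & forall t, al <= t <= be -> mu <= N K t.
  have [|c Ic hc] := @EVT_min _ (N K) al be albe.
    apply: continuous_in_subspaceT => t; rewrite inE /= in_itv /= => It.
    have [c1 c2] := continuous_cxy K It.
    by apply: cvgD; apply: cvg_norm.
  rewrite in_itv /= in Ic.
  exists (N K c); first exact: derotated_neq0.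
  by move=> t It; apply: hc; rewrite in_itv.
have e2 : 0 < d * mu / 2 by rewrite divr_gt0 // mulr_gt0.
have [r1 r10 hr1] := uniform_continuity_segment
  (fun t It => (continuous_cxy K It).1) e2.
have [r2 r20 hr2] := uniform_continuity_segment
  (fun t It => (continuous_cxy K It).2) e2.
exists K, (Num.min r1 r2); split; first by rewrite lt_min r10.
move=> k t E Kk It IE; rewrite le_min => /andP[tE1 tE2].
have h1 := tail k t Kk It; have h2 := tail k E Kk IE.
have h3 : norm1 (cx K t - cx K E) (cy K t - cy K E) <= d * N K E.
  have m1 := hr1 t E It IE tE1; have m2 := hr2 t E It IE tE2.
  have : d * mu <= d * N K E by rewrite ler_wpM2l ?(ltW d0) // hmu.
  rewrite /norm1; lra.
have N0 : 0 < N K E by exact: derotated_neq0.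
have h4 : N K t <= (1 + d) * N K E.
  have := norm1D (cx K t - cx K E) (cy K t - cy K E) (cx K E) (cy K E).
  rewrite !subrK -/(N K t) -/(N K E); lra.
have h5 : N K E <= 2 * N k E.
  have := norm1D (cx K E - cx k E) (cy K E - cy k E) (cx k E) (cy k E).
  rewrite !subrK -/(N K E) -/(N k E) norm1B => h.
  have : 2 * d * N K E <= 1 / 2 * N K E by rewrite ler_wpM2r ?(ltW N0) //; lra.
  lra.
have h6 : norm1 (cx k t - cx k E) (cy k t - cy k E) <= 6 * d * N K E.
  have q1 := norm1D (cx k t - cx K t) (cy k t - cy K t) (cx K t - cx k E) (cy K t - cy k E).
  have q2 := norm1D (cx K t - cx K E) (cy K t - cy K E) (cx K E - cx k E) (cy K E - cy k E).
  have eqs (a b c : R) : a - b + (b - c) = a - c by ring.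
  rewrite !eqs in q1 q2.
  have q3 : 2 * d * N K t <= 2 * d * ((1 + d) * N K E).
    by rewrite ler_wpM2l // mulr_ge0 // ltW.
  have q4 : d * (d * N K E) <= 1 / 2 * (d * N K E).
    by rewrite ler_wpM2r ?mulr_ge0 ?(ltW d0) ?(ltW N0) //; lra.
  have q5 : norm1 (cx K E - cx k E) (cy K E - cy k E) <= 2 * d * N K E by rewrite norm1B.
  have q6 : 2 * d * ((1 + d) * N K E) = 2 * d * N K E + 2 * (d * (d * N K E)) by ring.
  lra.
have undo x : rotx (total_phase k x) (cx k x) (cy k x) = wx k x /\
              roty (total_phase k x) (cx k x) (cy k x) = wy k x.
  by rewrite /cx /cy -rotx_add -roty_add subrr rotx0 roty0.
have ux : wx k t - rotx (total_phase k t - total_phase k E) (wx k E) (wy k E) =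
    rotx (total_phase k t) (cx k t - cx k E) (cy k t - cy k E).
  by rewrite rotxB rotx_add (undo t).1.
have uy : wy k t - roty (total_phase k t - total_phase k E) (wx k E) (wy k E) =
    roty (total_phase k t) (cx k t - cx k E) (cy k t - cy k E).
  by rewrite rotyB roty_add (undo t).2.
rewrite ux uy; apply: le_trans (norm1_rot _ _ _) _.
have h7 : N k E <= 2 * norm1 (wx k E) (wy k E) by exact: norm1_rot.
have h8 : 6 * d * N K E <= 6 * d * (4 * norm1 (wx k E) (wy k E)).
  by rewrite ler_wpM2l ?mulr_ge0 ?(ltW d0) //; lra.
have h9 : 48 * d * norm1 (wx k E) (wy k E) <= eta * norm1 (wx k E) (wy k E).
  by rewrite ler_wpM2r ?norm1_ge0 //; lra.
have h10 : 2 * (6 * d * (4 * norm1 (wx k E) (wy k E))) =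
  48 * d * norm1 (wx k E) (wy k E) by ring.
lra.
Qed.

End Stability.

(** * Elementary bounds for sine and cosine *)

Section Trigo.
Variable R : realType.
Implicit Types (x h : R).

Lemma sin_le_id x : 0 <= x -> sin x <= x.
Proof.
move=> x0; have [|c _ e] := @MVT_segment R sin cos 0 x x0 (fun t _ => is_derive_sin t).
  by apply: continuous_subspaceT; exact: continuous_sin.
rewrite sin0 !subr0 in e; rewrite e -[leRHS]mul1r ler_wpM2r //; exact: cos_le1.
Qed.

Lemma cos_ge_half x : 0 <= x <= 1 / 2 -> 1 / 2 <= cos x.
Proof.
move=> /andP[x0 x2]; have pi2 := @pihalf_ge1 R.
have s0 : 0 <= sin x by apply: sin_ge0_pi; apply/andP; split; lra.
have c0 : 0 < cos x by apply: cos_gt0_pihalf; apply/andP; split; lra.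
have := sin_le_id x0; have := cos2Dsin2 x; rewrite !expr2; nra.
Qed.

Lemma sin_ge_mid h x : 0 < h -> h <= 1 -> h <= x <= pi - h -> sin h <= sin x.
Proof.
move=> h0 h1 /andP[hx xh]; have pi2 := @pihalf_ge1 R.
have mono (y : R) : h <= y <= pi / 2 -> sin h <= sin y.
  rewrite le_eqVlt => /andP[/orP[/eqP->//|h2] h3].
  by apply: ltW; rewrite ltr_sin ?in_itv //=; apply/andP; split; lra.
case: (lerP x (pi / 2)) => h2; first by apply: mono; rewrite hx.
have -> : sin x = sin (pi - x) by rewrite sinB sinpi cospi; ring.
by apply: mono; apply/andP; split; lra.
Qed.

End Trigo.

(** * Zeros of the second component of a rotating state *)

Section Spacing.
Variables (R : realType) (X Y Th : nat -> R -> R) (q : nat -> {poly R}).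
Variables (al be kap C : R).
Hypothesis kap0 : 0 < kap.
Hypothesis C0 : 0 <= C.
Hypothesis rotating : forall eta, 0 < eta -> exists K d, 0 < d /\
  forall k t E, (K <= k)%N -> al <= t <= be -> al <= E <= be -> `|t - E| <= d ->
  norm1 (X k t - rotx (Th k t - Th k E) (X k E) (Y k E))
        (Y k t - roty (Th k t - Th k E) (X k E) (Y k E))
  <= eta * norm1 (X k E) (Y k E).
Hypothesis state_pos : forall k t, al <= t <= be -> 0 < norm1 (X k t) (Y k t).
Hypothesis cont_Th : forall k t, al <= t <= be -> {for t, continuous (Th k)}.
Hypothesis grow_Th : forall k a b, al <= a -> a <= b -> b <= be ->
  kap * k%:R * (b - a) <= Th k b - Th k a.
Hypothesis sign_q : forall k t t', al <= t <= be -> al <= t' <= be ->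
  Y k t * Y k t' < 0 -> (q k).[t] * (q k).[t'] < 0.
Hypothesis root_q : forall k t, root (q k) t -> Y k t = 0.
Hypothesis interlacing : forall k E E', al <= E -> E < E' -> E' <= be ->
  root (q k) E -> root (q k) E' -> exists2 t, E < t < E' & `|X k t| <= C * `|Y k t|.

Let opposite_signs (N c u v : R) : 0 < N -> N <= 2 * `|c| ->
  `|u - c| <= 1 / 8 * N -> `|v - - c| <= 1 / 8 * N -> u * v < 0.
Proof.
move=> N0 Nc; rewrite !ler_norml => /andP[u1 u2] /andP[v1 v2].
case: (lerP 0 c) => c0.
  rewrite (ger0_norm c0) in Nc; have up : 0 < u by lra.
  by rewrite pmulr_rlt0 //; lra.
rewrite (ltr0_norm c0) in Nc; have un : u < 0 by lra.
by rewrite nmulr_rlt0 //; lra.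
Qed.

Lemma phase_reach k a b th : al <= a -> a <= b -> b <= be ->
  0 <= th <= Th k b - Th k a -> exists2 t, a <= t <= b & Th k t = Th k a + th.
Proof.
move=> ala ab bbe /andP[th0 th1].
have [||t] := @IVT R (Th k) a b (Th k a + th) ab.
- apply: continuous_in_subspaceT => t; rewrite inE /= in_itv /= => /andP[h1 h2].
  by apply: cont_Th; rewrite (le_trans ala h1) (le_trans h2 bbe).
- by rewrite ge_min le_max lerDl th0 /=; apply/orP; right; lra.
by rewrite in_itv /= => It e; exists t.
Qed.

Lemma phase_lt k t t' : al <= t <= be -> al <= t' <= be -> Th k t < Th k t' -> t < t'.
Proof.
move=> /andP[h1 h2] /andP[h3 h4] h; rewrite ltNge; apply/negP => t't.
have := grow_Th k h3 t't h2; have : 0 <= kap * k%:R * (t - t').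
  by rewrite mulr_ge0 ?mulr_ge0 ?subr_ge0 // ltW.
lra.
Qed.

Lemma sign_change_root k t t' : al <= t <= be -> al <= t' <= be -> t <= t' ->
  Y k t * Y k t' < 0 -> exists2 z, t < z < t' & root (q k) z.
Proof.
move=> It It' tt' h; have [z + rz] := poly_ivtoo tt' (sign_q It It' h).
by rewrite in_itv /= => zt; exists z.
Qed.

(** While the phase increases by a full turn, the second coordinate changes sign:
    the larger of the two coordinates at the start passes, up to an eighth of the
    norm, through the second coordinate with both signs. *)
Lemma root_in_full_turn : exists K, forall k a b, (K <= k)%N ->
  al <= a -> a <= b -> b <= be -> 2 * pi <= Th k b - Th k a ->
  exists2 z, a < z < b & root (q k) z.
Proof.
have e8 : 0 < 1 / 8 :> R by rewrite divr_gt0.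
have [K0 [d [d0 hK]]] := rotating e8.
pose K1 := (Num.truncn (2 * pi / (kap * d))).+1.
exists (maxn K0 K1) => k a b; rewrite geq_max => /andP[k0 k1] ala ab bbe full.
have kd : 0 < kap * d by rewrite mulr_gt0.
have hk : 2 * pi <= kap * k%:R * d.
  have -> : kap * k%:R * d = k%:R * (kap * d) by ring.
  rewrite -ler_pdivrMr //; apply: ltW; apply: lt_le_trans (truncnS_gt _) _.
  by rewrite ler_nat.
have pi0 := pi_gt0 R.
(* A full turn is already made on the interval of length d, where [rotating]
   applies. *)
pose b' := Num.min b (a + d).
have ab' : a <= b' by rewrite /b' le_min ab lerDl ltW.
have b'b : b' <= b by rewrite /b' ge_min lexx.
have b'd : b' <= a + d by rewrite /b' ge_min lexx orbT.
have b'be := le_trans b'b bbe.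
have full' : 2 * pi <= Th k b' - Th k a.
  rewrite /b'; case: (leP b (a + d)) => // h.
  have := @grow_Th k a (a + d) ala _ _; rewrite lerDl ltW // addrAC subrr add0r.
  by move=> /(_ isT (le_trans (ltW h) bbe)) => h2; apply: le_trans h2.
have Ia : al <= a <= be by rewrite ala (le_trans ab bbe).
have reach th : 0 <= th <= 2 * pi -> exists t, [/\ a <= t <= b', Th k t = Th k a + th &
   `|Y k t - roty th (X k a) (Y k a)| <= 1 / 8 * norm1 (X k a) (Y k a)].
  move=> /andP[th0 th1].
  have [|t /andP[t1 t2] e] := @phase_reach k a b' th ala ab' b'be.
    by rewrite th0 (le_trans th1).
  exists t; split=> //; first by rewrite t1.
  have It : al <= t <= be by rewrite (le_trans ala t1) (le_trans t2 b'be).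
  have td : `|t - a| <= d by rewrite ger0_norm; lra.
  have := hK k t a k0 It Ia td; rewrite e addrAC subrr add0r /norm1.
  by move=> h; apply: le_trans h; rewrite lerDr.
have Nx := state_pos k Ia.
set N := norm1 (X k a) (Y k a) in Nx reach *.
have concl th1 th2 : 0 <= th1 -> th1 < th2 -> th2 < 2 * pi ->
    (forall u v : R, `|u - roty th1 (X k a) (Y k a)| <= 1 / 8 * N ->
       `|v - roty th2 (X k a) (Y k a)| <= 1 / 8 * N -> u * v < 0) ->
    exists2 z, a < z < b & root (q k) z.
  move=> th10 th12 th2p neg.
  have [|t1 [/andP[a1 a2] e1 n1]] := reach th1; first by apply/andP; split; lra.
  have [|t2 [/andP[c1 c2] e2 n2]] := reach th2; first by apply/andP; split; lra.
  have I1 : al <= t1 <= be by rewrite (le_trans ala a1) (le_trans a2 b'be).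
  have I2 : al <= t2 <= be by rewrite (le_trans ala c1) (le_trans c2 b'be).
  have t12 : t1 < t2 by apply: (@phase_lt k) => //; rewrite e1 e2 ltrD2l.
  have [z /andP[z1 z2] rz] := sign_change_root I1 I2 (ltW t12) (neg _ _ n1 n2).
  exists z => //; rewrite (le_lt_trans a1 z1) /=.
  by apply: lt_le_trans z2 (le_trans c2 b'b).
have ND : N = `|X k a| + `|Y k a| by [].
case: (lerP `|Y k a| `|X k a|) => XY.
  apply: (concl (pi / 2) (pi / 2 + pi)); try lra.
  move=> u v; rewrite /roty sinDpi cosDpi sin_pihalf cos_pihalf mul0r addr0 oppr0 mul0r addr0.
  rewrite mul1r mulN1r.
  by move=> hu hv; apply: (@opposite_signs N (X k a)) => //; lra.
apply: (concl 0 pi); try lra.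
move=> u v; rewrite /roty sinpi cospi sin0 cos0 !mul0r !add0r mul1r mulN1r.
by move=> hu hv; apply: (@opposite_signs N (Y k a)) => //; lra.
Qed.

(** At the zeros of its second coordinate the state points along the first axis, so
    that it nearly makes a multiple of half a turn between two of them.  More than
    half a turn would produce a zero in between, and no turn at all is excluded
    because the state has to leave the cone around that axis. *)
Lemma half_turn_spacing (h : R) : 0 < h -> exists K, forall k E E', (K <= k)%N ->
  al <= E -> E < E' -> E' <= be -> root (q k) E -> root (q k) E' ->
  (forall x, E < x < E' -> ~~ root (q k) x) ->
  `|Th k E' - Th k E - pi| <= h.
Proof.
move=> h_gt0; pose h0 := 1 / (8 * (C + 1)).
have C1 : 0 < 8 * (C + 1) by rewrite mulr_gt0 //; have := C0; lra.
have h00 : 0 < h0 by rewrite divr_gt0.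
have h08 : h0 <= 1 / 8.
  by rewrite /h0 ler_pM2l // lef_pV2 ?posrE //; have := C0; lra.
have Ch0 : C * h0 <= 1 / 8.
  by rewrite /h0 mul1r ler_pdivrMr //; have := C0; lra.
pose g := Num.min h h0.
have g0 : 0 < g by rewrite lt_min h_gt0.
have gh : g <= h by rewrite ge_min lexx.
have gh0 : g <= h0 by rewrite ge_min lexx orbT.
have g1 : g <= 1 by apply: le_trans gh0 _; lra.
have pi2 := pi_ge2 R.
have sg : 0 < sin g by apply: sin_gt0_pi; apply/andP; split; lra.
pose eta := Num.min (sin g / 2) h0.
have eta0 : 0 < eta by rewrite lt_min divr_gt0.
have etas : eta <= sin g / 2 by rewrite ge_min lexx.
have etah : eta <= h0 by rewrite ge_min lexx orbT.
have [K0 [d [d0 hK]]] := rotating eta0.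
have [K1 hK1] := root_in_full_turn.
pose K2 := (Num.truncn (2 * pi / (kap * d))).+1.
exists (maxn K0 (maxn K1 K2)) => k E E'; rewrite !geq_max => /and3P[k0 k1 k2].
move=> alE EE' E'be rE rE' nor.
have kd : 0 < kap * d by rewrite mulr_gt0.
have hk : 2 * pi <= kap * k%:R * d.
  have -> : kap * k%:R * d = k%:R * (kap * d) by ring.
  rewrite -ler_pdivrMr //; apply: ltW; apply: lt_le_trans (truncnS_gt _) _.
  by rewrite ler_nat.
have IE : al <= E <= be by rewrite alE (le_trans (ltW EE')).
have lt2pi : Th k E' - Th k E < 2 * pi.
  rewrite ltNge; apply/negP => /(hK1 k E E' k1 alE (ltW EE') E'be)[z zI rz].
  by have := nor z zI; rewrite rz.
have E'd : E' - E <= d.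
  rewrite leNgt; apply/negP => hd; have := grow_Th k alE (ltW EE') E'be.
  have : kap * k%:R * d <= kap * k%:R * (E' - E).
    by rewrite ler_wpM2l ?(ltW hd) // mulr_ge0 // ltW.
  lra.
have YE := root_q rE; set c := X k E.
have N0 : 0 < `|c| by have := state_pos k IE; rewrite /norm1 YE normr0 addr0.
have approx t : E <= t <= E' ->
    `|X k t - cos (Th k t - Th k E) * c| <= eta * `|c| /\
    `|Y k t - sin (Th k t - Th k E) * c| <= eta * `|c|.
  move=> /andP[t1 t2]; have It : al <= t <= be by rewrite (le_trans alE) // (le_trans t2).
  have td : `|t - E| <= d by rewrite ger0_norm; lra.
  have := hK k t E k0 It IE td; rewrite YE /rotx /roty !mulr0 subr0 addr0 /norm1 normr0 addr0.
  rewrite -/c => H; split; apply: le_trans H; [by rewrite lerDl | by rewrite lerDr].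
have Thmono t t' : E <= t -> t <= t' -> t' <= E' -> Th k t <= Th k t'.
  move=> t1 t2 t3; have := grow_Th k (le_trans alE t1) t2 (le_trans t3 E'be).
  have : 0 <= kap * k%:R * (t' - t) by rewrite mulr_ge0 ?mulr_ge0 ?subr_ge0 // ltW.
  lra.
set D := Th k E' - Th k E in lt2pi *.
have D0 : 0 <= D by rewrite subr_ge0 Thmono // ltW.
have sinD : `|sin D| <= eta.
  have [|_] := approx E'; first by rewrite lexx (ltW EE').
  by rewrite (root_q rE') sub0r normrN normrM ler_pM2r // => ->.
(* Otherwise the state would stay close to the first axis between the two zeros. *)
have Dg : g <= D.
  rewrite leNgt; apply/negP => Dg.
  have [t /andP[t1 t2] XC] := interlacing alE EE' E'be rE rE'.
  have [|] := approx t; first by rewrite !ltW.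
  have T0 := Thmono E t (lexx _) (ltW t1) (ltW t2).
  have T1 := Thmono t E' (ltW t1) (ltW t2) (lexx _).
  set th := Th k t - Th k E; have th0 : 0 <= th by rewrite subr_ge0.
  have thg : th <= g by apply: le_trans (ltW Dg); rewrite lerD2r.
  have c2 : 1 / 2 <= cos th by apply: cos_ge_half; apply/andP; split; lra.
  have s2 : sin th <= g by apply: le_trans (sin_le_id th0) thg.
  have s0 : 0 <= sin th by apply: sin_ge0_pi; apply/andP; split; lra.
  move=> aX aY.
  have b1 : `|cos th * c| <= `|X k t| + eta * `|c|.
    have := ler_normB (X k t) (X k t - cos th * c).
    have -> : X k t - (X k t - cos th * c) = cos th * c by ring.
    lra.
  have b2 : `|Y k t| <= (g + eta) * `|c|.
    have := ler_normD (Y k t - sin th * c) (sin th * c); rewrite subrK => b.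
    have : `|sin th * c| <= g * `|c| by rewrite normrM (ger0_norm s0) ler_wpM2r.
    lra.
  have b3 : 1 / 2 * `|c| <= `|cos th * c|.
    by rewrite normrM ler_wpM2r // (le_trans c2) // ler_norm.
  have b4 : C * `|Y k t| <= C * ((g + eta) * `|c|) by rewrite ler_wpM2l.
  have b5 : C * (g + eta) <= 1 / 4.
    have : C * g <= C * h0 by rewrite ler_wpM2l.
    have : C * eta <= C * h0 by rewrite ler_wpM2l.
    lra.
  have b6 : C * ((g + eta) * `|c|) <= 1 / 4 * `|c| by rewrite mulrA ler_wpM2r.
  have b7 : eta * `|c| <= 1 / 8 * `|c| by rewrite ler_wpM2r // (le_trans etah).
  lra.
(* Otherwise the second coordinate would change sign between a quarter of a turn
   and half a turn plus g. *)
have Dpi : D <= pi + g.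
  rewrite leNgt; apply/negP => Dpi.
  have p0 : 0 <= (pi / 2 : R) <= D by apply/andP; split; lra.
  have p1 : 0 <= pi + g <= D by apply/andP; split; lra.
  have [t /andP[t1 t2] et] := phase_reach alE (ltW EE') E'be p0.
  have [t' /andP[t1' t2'] et'] := phase_reach alE (ltW EE') E'be p1.
  have It : al <= t <= be by rewrite (le_trans alE) // (le_trans t2).
  have It' : al <= t' <= be by rewrite (le_trans alE) // (le_trans t2').
  have tt' : t < t' by apply: (@phase_lt k) => //; rewrite et et' ltrD2l; lra.
  have [|_] := approx t; first by rewrite t1.
  have [|_] := approx t'; first by rewrite t1'.
  rewrite et et' [X in sin X](_ : _ = g + pi); last by ring.
  rewrite [X in _ -> `|_ - sin X * _| <= _ -> _](_ : _ = pi / 2); last by ring.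
  rewrite sinDpi sin_pihalf mul1r mulNr => n1 n2.
  have e2 : eta * `|c| < `|c| by rewrite gtr_pMl //; lra.
  have e3 : eta * `|c| < sin g * `|c| by rewrite ltr_pM2r //; lra.
  have neg : Y k t * Y k t' < 0.
    move: n1 n2; rewrite !ler_norml => /andP[u1 u2] /andP[v1 v2].
    case: (lerP 0 c) => c0.
      rewrite (ger0_norm c0) in e2 e3 u1 u2 v1 v2.
      have up : 0 < Y k t by lra.
      by rewrite pmulr_rlt0 //; lra.
    rewrite (ltr0_norm c0) in e2 e3 u1 u2 v1 v2.
    have un : Y k t < 0 by lra.
    by rewrite nmulr_rlt0 //; lra.
  have [z /andP[z1 z2] rz] := sign_change_root It It' (ltW tt') neg.
  have := nor z; rewrite rz (le_lt_trans t1 z1) (lt_le_trans z2 t2').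
  by move=> /(_ isT).
(* From g to pi - g the sine exceeds the bound [sinD]. *)
have Dpi' : pi - g <= D.
  rewrite leNgt; apply/negP => Dpi'.
  have : sin g <= sin D by apply: sin_ge_mid => //; rewrite Dg ltW.
  by have := ler_norm (sin D); lra.
rewrite ler_norml; apply/andP; split; lra.
Qed.

(** The half turns between consecutive zeros add up; before the first and after
    the last zero between a and b there is less than a full turn.  This
    makes an error of at most 5 pi. *)
Lemma phase_counts_roots (h : R) : 0 < h -> exists K, forall k a b (zs : seq R),
  (K <= k)%N -> al <= a -> a <= b -> b <= be ->
  sorted <%R zs -> (forall t, root (q k) t = (t \in zs)) ->
  let m := ((nbelow zs b)%:R - (nbelow zs a)%:R : R) in
  `|Th k b - Th k a - m * pi| <= m * h + 5 * pi.
Proof.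
move=> h0; have [K0 hK0] := half_turn_spacing h0; have [K1 hK1] := root_in_full_turn.
exists (maxn K0 K1) => k a b zs; rewrite geq_max => /andP[k0 k1] ala ab bbe ss rzs /=.
have pi0 := pi_gt0 R.
set i0 := nbelow zs a; set i1 := nbelow zs b.
have i01 : (i0 <= i1)%N by exact: nbelow_homo.
have i1s : (i1 <= size zs)%N by exact: nbelow_le_size.
have gap x y : al <= x -> x <= y -> y <= be -> (forall z, x < z < y -> ~~ root (q k) z) ->
    0 <= Th k y - Th k x < 2 * pi.
  move=> alx xy ybe nor; apply/andP; split.
    have := grow_Th k alx xy ybe.
    have : 0 <= kap * k%:R * (y - x) by rewrite mulr_ge0 ?mulr_ge0 ?subr_ge0 // ltW.
    lra.
  rewrite ltNge; apply/negP => /(hK1 k x y k1 alx xy ybe)[z zI rz].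
  by have := nor z zI; rewrite rz.
have between i z : (i < size zs)%N -> (z \in zs) ->
    (forall j, (j < i)%N -> (j < size zs)%N -> zs`_j < z -> j.+1 = i -> z < zs`_i -> False).
  move=> i_s /(nthP 0)[l l_s <-] j ji j_s; rewrite !lt_sorted_ltn_nth //; lia.
have [e01|i01'] := eqVneq i0 i1.
  rewrite e01 subrr !mul0r subr0 add0r.
  have /andP[g1 g2] : 0 <= Th k b - Th k a < 2 * pi.
    apply: gap => // z /andP[az zb]; rewrite rzs; apply/negP => /(nthP 0)[l l_s zl].
    move: az zb; rewrite -zl => az; rewrite nth_lt_nbelow // -/i1 -e01 => li.
    by move: az; rewrite ltNge ltW // nth_lt_nbelow.
  by rewrite ger0_norm //; lra.
have {i01'} i01' : (i0 < i1)%N by rewrite ltn_neqAle i01' i01.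
have zin i : (i0 <= i)%N -> (i < i1)%N -> a <= zs`_i < b.
  move=> h1 h2; have i_s := leq_trans h2 i1s.
  by rewrite leNgt !nth_lt_nbelow // -/i0 -/i1 h2 andbT -leqNgt.
have chain m : (i0 + m < i1)%N ->
    `|Th k zs`_(i0 + m) - Th k zs`_i0 - m%:R * pi| <= m%:R * h.
  elim: m => [|m IH] hm; first by rewrite addn0 subrr !mul0r subr0 normr0.
  have hm' : (i0 + m < i1)%N by rewrite (leq_trans _ hm) // addnS.
  have /andP[z1 z2] := zin _ (leq_addr m i0) hm'.
  have /andP[z3 z4] := zin _ (leq_addr m.+1 i0) hm.
  have s1 := leq_trans hm' i1s; have s2 := leq_trans hm i1s.
  have lt12 : zs`_(i0 + m) < zs`_(i0 + m.+1) by rewrite lt_sorted_ltn_nth // addnS.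
  have := @hK0 k _ _ k0 (le_trans ala z1) lt12 (le_trans (ltW z4) bbe).
  rewrite !rzs !mem_nth // => /(_ isT isT) H.
  have {}H : `|Th k zs`_(i0 + m.+1) - Th k zs`_(i0 + m) - pi| <= h.
    apply: H => x /andP[x1 x2]; rewrite rzs; apply/negP => xz.
    by apply: (between (i0 + m.+1)%N x s2 xz (i0 + m)%N) => //; rewrite ?addnS.
  have -> : Th k zs`_(i0 + m.+1) - Th k zs`_i0 - m.+1%:R * pi =
    (Th k zs`_(i0 + m.+1) - Th k zs`_(i0 + m) - pi) +
    (Th k zs`_(i0 + m) - Th k zs`_i0 - m%:R * pi) by rewrite -natr1; ring.
  apply: le_trans (ler_normD _ _) _; rewrite -natr1 mulrDl mul1r addrC.
  exact: lerD (IH hm') H.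
pose m := (i1 - i0).-1.
have mE : (i0 + m = i1.-1)%N by rewrite /m; lia.
have hm : (i0 + m < i1)%N by rewrite mE; lia.
have := chain m hm; have /andP[z1 z2] := zin _ (leqnn i0) i01'.
have /andP[z3 z4] := zin _ (leq_addr m i0) hm.
have /andP[g1 g2] : 0 <= Th k zs`_i0 - Th k a < 2 * pi.
  apply: gap => //; first exact: le_trans (ltW z2) bbe.
  move=> z /andP[az zb]; rewrite rzs; apply/negP => /(nthP 0)[l l_s zl].
  move: az zb; rewrite -zl => az; rewrite lt_sorted_ltn_nth //; last exact: leq_trans i01' i1s.
  by rewrite -nth_lt_nbelow // ltNge ltW.
have /andP[g3 g4] : 0 <= Th k b - Th k zs`_(i0 + m) < 2 * pi.
  apply: gap => //; [exact: le_trans ala z3 | exact: ltW |].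
  move=> z /andP[az zb]; rewrite rzs; apply/negP => /(nthP 0)[l l_s zl].
  have s3 := leq_trans hm i1s.
  move: az zb; rewrite -zl lt_sorted_ltn_nth // nth_lt_nbelow // -/i1 => h1.
  rewrite (_ : i1 = (i0 + m).+1) ?ltnS => [h2|]; first by move: (leq_trans h1 h2); rewrite ltnn.
  by rewrite mE prednK // (leq_ltn_trans (leq0n i0)).
have mR : i1%:R - i0%:R = m%:R + 1 :> R.
  by rewrite -natrB // natr1 /m prednK // subn_gt0.
rewrite mR => cm.
have -> : Th k b - Th k a - (m%:R + 1) * pi =
  (Th k b - Th k zs`_(i0 + m)) + (Th k zs`_i0 - Th k a) +
  (Th k zs`_(i0 + m) - Th k zs`_i0 - m%:R * pi) - pi by ring.
move: cm; rewrite !ler_norml => /andP[c1 c2]; apply/andP; split; lra.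
Qed.

End Spacing.

(** * Growth of the accumulated phase *)

Section PhaseIncrement.
Variables (R : realType) (M : nat -> 'M[{poly R}]_2) (L : 'M[{poly R}]_2).
Variables (al be s kap : R).
Hypothesis tM : forall i l, poly_tame (fun k => M k i l) (L i l).
Hypothesis s1 : s = 1 \/ s = -1.
Hypothesis kap0 : 0 < kap.
Hypothesis ell : forall k t, al <= t <= be -> kap <= 1 - (half_trace (M k)).[t] ^+ 2.
Hypothesis ellL : forall t, al <= t <= be -> kap <= 1 - (half_trace L).[t] ^+ 2.
Hypothesis mono : forall k t, al <= t <= be -> kap <= s * (half_trace (M k))^`().[t].

Local Notation T k := (half_trace (M k)).
Local Notation TL := (half_trace L).
Local Notation tot := (total_phase M s).

Lemma is_derive_total_phase k t : al <= t <= be ->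
  is_derive t (1 : R) (tot k) (\sum_(j < k) dphase s (T j) t).
Proof.
move=> It; elim: k => [|k IH].
  rewrite big_ord0 (_ : tot 0 = cst 0); first exact: is_derive_cst.
  by apply/funext => x; rewrite /total_phase big_ord0.
rewrite big_ord_recr /= (_ : tot k.+1 = tot k + phase s (T k)); last first.
  by apply/funext => x; rewrite /total_phase big_ord_recr.
apply: is_deriveD => //.
exact: (is_derive_phase s kap0 (ell k It)).
Qed.

Lemma MVT_on (f df : R -> R) a b : al <= a -> a <= b -> b <= be ->
  (forall t, al <= t <= be -> is_derive t (1 : R) f (df t)) ->
  exists2 c, a <= c <= b & f b - f a = df c * (b - a).
Proof.
move=> ala ab bbe dfP.
have [t|t|c] := @MVT_segment R f df a b ab _ _.
- rewrite in_itv /= => /andP[h1 h2]; apply: dfP.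
  by rewrite (le_trans ala (ltW h1)) (le_trans (ltW h2) bbe).
- move: t; apply: derivable_within_continuous => t; rewrite in_itv /= => /andP[h1 h2].
  have It : al <= t <= be by rewrite (le_trans ala h1) (le_trans h2 bbe).
  by have [] := dfP t It.
- by rewrite in_itv /= => Ic e; exists c.
Qed.

Lemma total_phase_growth k a b : al <= a -> a <= b -> b <= be ->
  kap * k%:R * (b - a) <= tot k b - tot k a.
Proof.
move=> ala ab bbe; have [c /andP[c1 c2] ->] := MVT_on ala ab bbe (@is_derive_total_phase k).
have Ic : al <= c <= be by rewrite (le_trans ala c1) (le_trans c2 bbe).
rewrite ler_wpM2r ?subr_ge0 //.
have -> : kap * k%:R = \sum_(j < k) kap.
  by rewrite sumr_const card_ord mulr_natr.
by apply: ler_sum => j _; exact: (dphase_ge (s := s) kap0 (ell j Ic) (mono j Ic)).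
Qed.

Let T0 := Num.max `|al| `|be|.

(** The block angles converge with their derivatives, uniformly in the energy, and
    the contribution of the early blocks is bounded; conclude by the mean value
    theorem. *)
Lemma phase_increment (e : R) : 0 < e -> exists K, forall k a b, (K <= k)%N ->
  al <= a -> a <= b -> b <= be ->
  `|(tot k b - tot k a) - k%:R * (phase s TL b - phase s TL a)| <= e * k%:R * (b - a).
Proof.
move=> e0.
have tT := poly_tame_half_trace tM; have tT' := poly_tame_deriv tT.
have T00 : 0 <= T0 by exact: bnd_ge0.
have [B1 B10 hB1] := poly_tame_bounded tT' T00.
have [B2 B20 hB2] := poly_tame_bounded (poly_tame_cst TL^`()) T00.
have ki0 : 0 < kap^-1 by rewrite invr_gt0.
pose A1 := kap^-1; pose A2 := B2 * kap^-1 ^+ 3.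
have A20 : 0 <= A2 by rewrite mulr_ge0 // exprn_ge0 // ltW.
have diff j t : al <= t <= be -> `|dphase s (T j) t - dphase s TL t| <=
    A1 * `|(T j)^`().[t] - TL^`().[t]| + A2 * `|(T j).[t] - TL.[t]|.
  move=> It; apply: le_trans (dphase_diff s1 kap0 (ellL It) (ell j It)) _.
  rewrite lerD2l ler_wpM2r // ler_wpM2r ?exprn_ge0 ?(ltW ki0) //.
  by apply: (hB2 0%N); exact: in_bnd.
pose C := A1 * (B1 + B2) + A2 * 2.
have C0 : 0 <= C by rewrite addr_ge0 ?mulr_ge0 ?addr_ge0 // ltW.
have bound j t : al <= t <= be -> `|dphase s (T j) t - dphase s TL t| <= C.
  move=> It; apply: le_trans (diff j t It) _; apply: lerD.
    rewrite ler_wpM2l ?(ltW ki0) //; apply: le_trans (ler_normB _ _) _; apply: lerD.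
      by apply: hB1; exact: in_bnd.
    by apply: (hB2 0%N); exact: in_bnd.
  rewrite ler_wpM2l //.
  have /andP[u1 u2] := elliptic_itv kap0 (ell j It).
  have /andP[v1 v2] := elliptic_itv kap0 (ellL It).
  by rewrite ler_norml; apply/andP; split; lra.
pose d1 := e / 2 / (2 * A1); have d10 : 0 < d1 by rewrite !divr_gt0 // mulr_gt0.
pose d2 := e / 2 / (2 * (A2 + 1)).
have A21 : 0 < A2 + 1 by apply: lt_le_trans (_ : 1 <= _); rewrite ?ltr01 // lerDr.
have d20 : 0 < d2 by rewrite !divr_gt0 // mulr_gt0.
have [K1 _ h1] := poly_tame_cvg T0 tT' d10.
have [K2 _ h2] := poly_tame_cvg T0 tT d20.
pose K := maxn K1 K2.
have small j t : (K <= j)%N -> al <= t <= be ->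
    `|dphase s (T j) t - dphase s TL t| <= e / 2.
  rewrite geq_max => /andP[j1 j2] It; apply: le_trans (diff j t It) _.
  have b1 : A1 * `|(T j)^`().[t] - TL^`().[t]| <= A1 * d1.
    by rewrite ler_wpM2l ?(ltW ki0) //; apply: (h1 j j1); exact: in_bnd.
  have b2 : A2 * `|(T j).[t] - TL.[t]| <= A2 * d2.
    by rewrite ler_wpM2l //; apply: (h2 j j2); exact: in_bnd.
  have c1 : A1 * d1 = e / 4 by rewrite /d1; field; rewrite gt_eqF.
  have c2 : A2 * d2 <= (A2 + 1) * d2 by rewrite ler_wpM2r ?(ltW d20) // lerDl.
  have c3 : (A2 + 1) * d2 = e / 4 by rewrite /d2; field; rewrite gt_eqF.
  lra.
have sumle k t : al <= t <= be ->
    \sum_(j < k) `|dphase s (T j) t - dphase s TL t| <= K%:R * C + k%:R * (e / 2).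
  move=> It; elim: k => [|k IH].
    by rewrite big_ord0 mul0r addr0 mulr_ge0.
  have e20 : 0 <= e / 2 by rewrite ltW // divr_gt0.
  case: (leqP K k) => Kk.
    rewrite big_ord_recr /= -natr1 mulrDl mul1r addrA.
    by apply: lerD; [exact: IH | exact: small].
  apply: le_trans (_ : \sum_(j < k.+1) C <= _).
    by apply: ler_sum => j _; exact: bound.
  rewrite sumr_const card_ord -[C *+ _]mulr_natl.
  have h3 : k.+1%:R * C <= K%:R * C by rewrite ler_wpM2r // ler_nat.
  have h4 : 0 <= k.+1%:R * (e / 2) by exact: mulr_ge0.
  by apply: le_trans h3 _; rewrite lerDl.
pose K3 := (Num.truncn (K%:R * C / (e / 2))).+1.
exists K3 => k a b k3 ala ab bbe.
have [t It|c /andP[c1 c2]] := @MVT_on (fun t => tot k t - k%:R * phase s TL t)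
  (fun t => \sum_(j < k) dphase s (T j) t - k%:R * dphase s TL t) a b ala ab bbe.
  have dL := is_deriveZ k%:R (is_derive_phase s kap0 (ellL It)).
  by have := is_deriveB (is_derive_total_phase k It) dL.
have Ic : al <= c <= be by rewrite (le_trans ala c1) (le_trans c2 bbe).
have -> : tot k b - tot k a - k%:R * (phase s TL b - phase s TL a) =
  tot k b - k%:R * phase s TL b - (tot k a - k%:R * phase s TL a) by ring.
move=> ->; rewrite normrM (ger0_norm (x := b - a)) ?subr_ge0 // ler_wpM2r ?subr_ge0 //.
have -> : \sum_(j < k) dphase s (T j) c - k%:R * dphase s TL c =
    \sum_(j < k) (dphase s (T j) c - dphase s TL c).
  by rewrite sumrB sumr_const card_ord mulr_natl.
apply: le_trans (ler_norm_sum _ _ _) _; apply: le_trans (sumle k c Ic) _.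
have : K%:R * C <= k%:R * (e / 2).
  rewrite -ler_pdivrMr ?divr_gt0 //; apply: ltW; apply: lt_le_trans (truncnS_gt _) _.
  by rewrite ler_nat.
lra.
Qed.

End PhaseIncrement.

(** * Zeros along a sequence of blocks *)

Section BlockClock.
Variables (R : realType) (M : nat -> 'M[{poly R}]_2) (L : 'M[{poly R}]_2).
Variables (V : nat -> 'cV[{poly R}]_2) (al be s kap : R).
Hypothesis tM : forall i l, poly_tame (fun k => M k i l) (L i l).
Hypothesis detM : forall k, det2 (M k) = 1.
Hypothesis VS : forall k, V k.+1 = M k *m V k.
Hypothesis s1 : s = 1 \/ s = -1.
Hypothesis kap0 : 0 < kap.
Hypothesis kap1 : kap <= 1.
Hypothesis ell : forall k t, al <= t <= be -> kap <= 1 - (half_trace (M k)).[t] ^+ 2.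
Hypothesis ellL : forall t, al <= t <= be -> kap <= 1 - (half_trace L).[t] ^+ 2.
Hypothesis mono : forall k t, al <= t <= be -> kap <= s * (half_trace (M k))^`().[t].
Hypothesis monoL : forall t, al <= t <= be -> kap <= s * (half_trace L)^`().[t].
Hypothesis albe : al <= be.
Hypothesis Vn0 : forall k t, ~ ((V k 0 0).[t] = 0 /\ (V k 1 0).[t] = 0).
Hypothesis interV : forall k E E', E < E' -> root (V k 1 0) E -> root (V k 1 0) E' ->
  exists2 t, E < t < E' & root (V k 0 0) t.

Local Notation T k := (half_trace (M k)).
Local Notation TL := (half_trace L).
Local Notation tot := (total_phase M s).

Lemma wy_sign k t t' : al <= t <= be -> al <= t' <= be ->
  wy M V s k t * wy M V s k t' < 0 -> (V k 1 0).[t] * (V k 1 0).[t'] < 0.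
Proof.
move=> It It'; rewrite /wy !(sin_phase s1 kap0 (ell k _)) //.
have /andP[h1 _] := elliptic_sqrt kap0 (ell k It).
have /andP[h2 _] := elliptic_sqrt kap0 (ell k It').
have {h1} := lt_le_trans kap0 h1; have {h2} := lt_le_trans kap0 h2.
set u := Num.sqrt _ => u0; set v := Num.sqrt _ => v0.
have -> y y' : - s * v * y * (- s * u * y') = s * s * (v * u) * (y * y') by ring.
have -> : s * s = 1 by case: s1 => ->; rewrite ?mulrNN mulr1.
by rewrite mul1r pmulr_rlt0 // mulr_gt0.
Qed.

Lemma root_wy k t : root (V k 1 0) t -> wy M V s k t = 0.
Proof. by move=> /eqP h; rewrite /wy h mulr0. Qed.

(** Two zeros of the second component are separated by a zero of the first one,
    where the two coordinates of the state are comparable. *)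
Lemma state_cone : exists2 C, 0 <= C & forall k E E', al <= E -> E < E' -> E' <= be ->
  root (V k 1 0) E -> root (V k 1 0) E' ->
  exists2 t, E < t < E' & `|wx M V k t| <= C * `|wy M V s k t|.
Proof.
have [B B0 hB] := poly_tame_bounded (tM 0 0) (bnd_ge0 al be).
have k0 := kap0.
exists ((1 + B) / kap) => [|k E E' alE EE' E'be rE rE'].
  by rewrite divr_ge0 ?(ltW kap0) // addr_ge0.
have [t /andP[Et tE'] /eqP rt] := interV EE' rE rE'.
have It : al <= t <= be by rewrite (le_trans alE (ltW Et)) (le_trans (ltW tE') E'be).
exists t; first by rewrite Et.
have h1 := hB k t (in_bnd It); have h2 := sin_phase_ge s1 kap0 (ell k It).
have /andP[h3 h4] := elliptic_itv kap0 (ell k It).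
rewrite /wx /wy rt mulr0 add0r !normrM mulrA ler_wpM2r //.
have h5 : `|(T k).[t] - (M k 0 0).[t]| <= 1 + B.
  apply: le_trans (ler_normB _ _) _; apply: lerD h1.
  by rewrite ler_norml; apply/andP; split; apply: ltW.
apply: le_trans h5 _; rewrite -mulrA ler_peMr ?addr_ge0 //.
by rewrite mulrC ler_pdivlMr // mul1r.
Qed.

Lemma continuous_dphase t : al <= t <= be -> {for t, continuous (dphase s TL)}.
Proof.
move=> It; apply: cvgM.
  by apply: cvgM; [exact: cvg_cst | exact: continuous_horner].
have /andP[h1 _] := elliptic_sqrt kap0 (ellL It).
apply: cvgV; first by rewrite gt_eqF // (lt_le_trans kap0).
apply: (@cvg_comp _ _ _ (fun x => 1 - TL.[x] ^+ 2) Num.sqrt); last exact: sqrt_continuous.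
apply: cvgB; first exact: cvg_cst.
rewrite expr2 (_ : (fun x => TL.[x] ^+ 2) = fun x => TL.[x] * TL.[x]); last first.
  by apply/funext => x; rewrite expr2.
by apply: cvgM; exact: continuous_horner.
Qed.

(** Between consecutive zeros the phase advances by half a turn, at the rate
    [k * dphase]. *)
Lemma block_clock (e : R) : 0 < e -> exists K, forall k E E' x, (K <= k)%N ->
  al <= E -> E < E' -> E' <= be -> E <= x <= E' ->
  root (V k 1 0) E -> root (V k 1 0) E' ->
  (forall t, E < t < E' -> ~~ root (V k 1 0) t) ->
  `|k%:R * (E' - E) - pi / dphase s TL x| <= e.
Proof.
move=> e0; have [C C0 hC] := state_cone; have pi0 := pi_gt0 R.
pose h : R := Num.min 1 (e * kap / 3).
have h0 : 0 < h by rewrite lt_min ltr01 divr_gt0 ?mulr_gt0.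
have hle1 : h <= 1 by rewrite ge_min lexx.
have hle2 : h <= e * kap / 3 by rewrite ge_min lexx orbT.
pose P : R := pi + 1; have P0 : 0 < P by rewrite addr_gt0.
pose e1 := e * kap / 3 / (P / kap).
have Pk : 0 < P / kap by rewrite divr_gt0.
have e10 : 0 < e1 by rewrite !divr_gt0 ?mulr_gt0.
have [K1 hK1] := half_turn_spacing kap0 C0
  (state_rotation tM detM VS s1 kap0 kap1 ell albe Vn0)
  (fun k t => @state_neq0 _ _ _ _ _ _ _ detM s1 kap0 kap1 ell Vn0 k t)
  (continuous_total_phase kap0 ell)
  (fun k a b => @total_phase_growth _ _ _ _ _ _ kap0 ell mono k a b)
  wy_sign root_wy hC h0.
have [K2 hK2] := phase_increment tM s1 kap0 ell ellL e10.
have [d d0 hd] := uniform_continuity_segment continuous_dphase e10.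
pose K3 := (Num.truncn (P / (kap * d))).+1.
exists (maxn K1 (maxn K2 K3)) => k E E' x; rewrite !geq_max => /and3P[k1 k2 k3].
move=> alE EE' E'be /andP[Ex xE'] rE rE' nr.
have := hK1 k E E' k1 alE EE' E'be rE rE' nr.
have := hK2 k E E' k2 alE (ltW EE') E'be.
have := total_phase_growth (s := s) kap0 ell mono k alE (ltW EE') E'be.
set D := _ - total_phase _ _ _ _ => gr inc half.
have /andP[half1 half2] : - h <= D - pi <= h by rewrite -ler_norml.
set y := k%:R * (E' - E).
have y0 : 0 <= y by rewrite mulr_ge0 // subr_ge0 ltW.
have yP : y <= P / kap.
  rewrite ler_pdivlMr // mulrC (_ : kap * y = kap * k%:R * (E' - E)) ?mulrA //.
  by apply: le_trans gr _; rewrite /P; lra.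
have kd : 0 < kap * d by rewrite mulr_gt0.
have short : E' - E <= d.
  have kk : P / (kap * d) < k%:R.
    by apply: lt_le_trans (truncnS_gt _) _; rewrite ler_nat.
  have kp : 0 < (k%:R : R) by apply: lt_trans kk; rewrite divr_gt0.
  rewrite -(ler_pM2l kp) -/y; apply: le_trans yP _.
  rewrite (_ : P / kap = P / (kap * d) * d); last by field; rewrite !gt_eqF.
  by rewrite ler_wpM2r ?(ltW d0) // ltW.
have [|c /andP[c1 c2] ec] := @MVT_on _ al be (phase s TL) (dphase s TL) E E' alE (ltW EE') E'be.
  by move=> t It; exact: (is_derive_phase s kap0 (ellL It)).
have Ix : al <= x <= be by rewrite (le_trans alE Ex) (le_trans xE' E'be).
have Ic : al <= c <= be by rewrite (le_trans alE c1) (le_trans c2 E'be).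
have gx := dphase_ge (s := s) kap0 (ellL Ix) (monoL Ix).
have gx0 := lt_le_trans kap0 gx.
have near : `|dphase s TL x - dphase s TL c| <= e1.
  apply: hd => //; rewrite ler_norml; apply/andP; split; lra.
have t1 : `|y * (dphase s TL x - dphase s TL c)| <= e * kap / 3.
  rewrite normrM (ger0_norm y0) (_ : e * kap / 3 = P / kap * e1).
    by apply: ler_pM.
  by rewrite /e1; field; rewrite !gt_eqF.
have t2 : `|D - y * dphase s TL c| <= e * kap / 3.
  have -> : y * dphase s TL c = k%:R * (phase s TL E' - phase s TL E).
    by rewrite ec /y; ring.
  apply: le_trans inc _; rewrite -mulrA -/y.
  rewrite (_ : e * kap / 3 = e1 * (P / kap)); last by rewrite /e1; field; rewrite !gt_eqF.
  by rewrite ler_wpM2l // ltW.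
have t3 : `|y * dphase s TL x - pi| <= e * kap.
  have {}t1 := t1; have {}t2 := t2.
  rewrite ler_norml in t1; rewrite ler_norml in t2; rewrite ler_norml.
  move/andP: t1 => [u1 u2]; move/andP: t2 => [v1 v2].
  rewrite mulrBr in u1 u2; apply/andP; split; lra.
have -> : y - pi / dphase s TL x = (y * dphase s TL x - pi) / dphase s TL x.
  by field; rewrite gt_eqF.
rewrite normrM normfV (gtr0_norm gx0) ler_pdivrMr //.
by apply: le_trans t3 _; rewrite ler_wpM2l // ltW.
Qed.

(** As every zero costs half a turn, the zeros between two energies are counted by
    the increment of the phase. *)
Lemma block_count (e : R) : 0 < e -> exists K, forall k a b (zs : seq R),
  (K <= k)%N -> al <= a -> a <= b -> b <= be ->
  sorted <%R zs -> (forall t, root (V k 1 0) t = (t \in zs)) ->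
  let m := ((nbelow zs b)%:R - (nbelow zs a)%:R : R) in
  `|k%:R * (phase s TL b - phase s TL a) - m * pi| <=
     e * k%:R * (b - a) + m * e + 5 * pi.
Proof.
move=> e0; have [C C0 hC] := state_cone.
have [K1 hK1] := phase_counts_roots kap0 C0
  (state_rotation tM detM VS s1 kap0 kap1 ell albe Vn0)
  (fun k t => @state_neq0 _ _ _ _ _ _ _ detM s1 kap0 kap1 ell Vn0 k t)
  (continuous_total_phase kap0 ell)
  (fun k a b => @total_phase_growth _ _ _ _ _ _ kap0 ell mono k a b)
  wy_sign root_wy hC e0.
have [K2 hK2] := phase_increment tM s1 kap0 ell ellL e0.
exists (maxn K1 K2) => k a b zs; rewrite geq_max => /andP[k1 k2] ala ab bbe szs rzs /=.
have := hK1 k a b zs k1 ala ab bbe szs rzs.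
have := hK2 k a b k2 ala ab bbe => /=.
rewrite distrC => i1 i2; apply: le_trans (_ : _ <= `|_| + `|_|) _; last first.
  by rewrite -addrA; apply: lerD i1 i2.
apply: le_trans _ (ler_normD _ _); rewrite le_eqVlt; apply/orP; left; apply/eqP.
by congr `|_|; ring.
Qed.

End BlockClock.

(** * Complements on polynomials *)

Lemma poly_ext_eq (R : realType) (q q' : {poly R}) :
  (forall x, q.[x] = q'.[x]) -> q = q'.
Proof.
move=> h; apply/eqP; rewrite -subr_eq0; apply/negPn/negP => d0.
have := @max_poly_roots R (q - q') [seq i%:R | i <- iota 0 (size (q - q'))] d0.
rewrite size_map size_iota ltnn => bad; suff : false by []; apply: bad.
  by apply/allP => x _; rewrite /root hornerD hornerN h subrr.
by rewrite map_inj_uniq ?iota_uniq // => i j /eqP; rewrite eqr_nat => /eqP.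
Qed.

Lemma poly_tame_shift (R : realType) (u : nat -> {poly R}) (q : {poly R}) m :
  poly_tame u q -> poly_tame (fun k => u (m + k)%N) q.
Proof.
move=> [[d hd] hi]; split; first by exists d => k.
move=> i; have [c [v0 [C hC]]] := hi i; split.
  rewrite (_ : (fun k => _) = fun k => (fun n => (u n)`_i) (k + m)%N).
    by move: c; rewrite -(cvg_shiftn m).
  by apply/funext => k; rewrite addnC.
split=> [k|]; first exact: normr_ge0.
exists C => n; apply: le_trans (hC (m + n)%N).
rewrite big_split_ord /=; apply: ler_wpDl; first by apply: sumr_ge0.
by apply: ler_sum => j _; rewrite addnS.
Qed.

(** * The Floquet phase and the discriminant *)

Section Rate.
Variables (R : realType) (p : nat) (a0 b0 : nat -> R).
Hypothesis p_gt0 : (0 < p)%N.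
Hypothesis a0_gt0 : forall n, 0 < a0 n.
Hypothesis a0_per : forall n, a0 (n + p)%N = a0 n.
Hypothesis b0_per : forall n, b0 (n + p)%N = b0 n.

Definition half_disc : {poly R} := half_trace (step_prod a0 b0 0 p).

Lemma half_trace_step_prod r : half_trace (step_prod a0 b0 r p) = half_disc.
Proof.
apply: poly_ext_eq => x; rewrite /half_disc /half_trace -!mxtrace2E !hornerM.
by rewrite !(mxtrace_step_prod p_gt0 a0_gt0 a0_per b0_per).
Qed.

Lemma half_discE x : discriminant a0 b0 p x = 2 * half_disc.[x].
Proof.
rewrite /half_disc /half_trace -mxtrace2E hornerM hornerC.
rewrite (mxtrace_step_prod p_gt0 a0_gt0 a0_per b0_per) mulrA divff ?mul1r //.
Qed.

Variables (gamma : R -> R) (alpha beta : R).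
Hypothesis gammaP : floquet_phase a0 b0 p gamma.
Hypothesis albe : alpha <= beta.
Hypothesis sub_bands : `[alpha, beta] `<=` bands_interior a0 b0 p.

Lemma half_disc_band x : bands_interior a0 b0 p x -> -1 < half_disc.[x] < 1.
Proof. by rewrite /bands_interior /= half_discE => /andP[? ?]; apply/andP; split; lra. Qed.

Lemma half_disc_itv x : alpha <= x <= beta -> -1 < half_disc.[x] < 1.
Proof. by move=> Ix; apply: half_disc_band; apply: sub_bands; rewrite /= in_itv. Qed.

Lemma floquet_derivable x : bands_interior a0 b0 p x -> derivable gamma x 1.
Proof. by move=> /gammaP[h _ _ _]; exact: (h 0%N). Qed.

Lemma floquet_cos x : bands_interior a0 b0 p x -> cos (gamma x) = half_disc.[x].
Proof. by move=> /gammaP[_ _ h _]; rewrite half_discE in h; lra. Qed.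

Lemma floquet_decreasing x : bands_interior a0 b0 p x -> gamma^`()%classic x < 0.
Proof. by move=> /gammaP[_ _ _ h]. Qed.

Lemma near_band x : bands_interior a0 b0 p x -> \near x, bands_interior a0 b0 p x.
Proof.
move=> /half_disc_band/andP[h1 h2].
have c : half_disc.[y] @[y --> x] --> half_disc.[x] by exact: continuous_horner.
near=> y; rewrite /bands_interior /= half_discE.
have l1 : half_disc.[y] < 1 by near: y; exact: (cvgr_lt _ c _ h2).
have l2 : -1 < half_disc.[y] by near: y; exact: (cvgr_gt _ c _ h1).
by apply/andP; split; lra.
Unshelve. all: by end_near. Qed.

Lemma floquet_deriv x : bands_interior a0 b0 p x ->
  half_disc^`().[x] = - sin (gamma x) * gamma^`()%classic x.
Proof.
move=> bx; have dg := floquet_derivable bx.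
have dc : is_derive x (1 : R) (cos \o gamma) (- sin (gamma x) * gamma^`()%classic x).
  apply: is_derive1_comp; rewrite derive1E; exact: derivableP.
have := @derive_val _ _ _ _ _ _ _ dc; rewrite -derive1E => <-.
rewrite derivE !derive1E; apply: near_eq_derive.
have := near_band bx; apply: filterS => y by_ /=.
by rewrite floquet_cos.
Qed.

(** Differentiating 2 cos gamma, where neither sin gamma nor the derivative of gamma
    vanishes inside a band. *)
Lemma half_disc_deriv_neq0 x : alpha <= x <= beta -> half_disc^`().[x] != 0.
Proof.
move=> Ix; have bx : bands_interior a0 b0 p x by apply: sub_bands; rewrite /= in_itv.
rewrite floquet_deriv //; apply: mulf_neq0; last by rewrite lt_eqF ?floquet_decreasing.
rewrite oppr_eq0.
apply/eqP => s0; have := cos2Dsin2 (gamma x); rewrite s0 floquet_cos //.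
have /andP[] := half_disc_band bx; rewrite !expr2; nra.
Qed.

Lemma half_disc_monotone : exists2 s : R, s = 1 \/ s = -1 &
  forall x, alpha <= x <= beta -> 0 < s * half_disc^`().[x].
Proof.
have Ia : alpha <= alpha <= beta by rewrite lexx.
have na := half_disc_deriv_neq0 Ia.
have same x : alpha <= x <= beta -> 0 < half_disc^`().[alpha] * half_disc^`().[x].
  move=> Ix; rewrite ltNge; apply/negP => neg; have /andP[ax xb] := Ix.
  have [z /[!in_itv]/= /andP[z1 z2] /eqP rz] := polyrcf.poly_ivt ax neg.
  have Iz : alpha <= z <= beta by rewrite z1 (le_trans z2).
  by have := half_disc_deriv_neq0 Iz; rewrite rz eqxx.
case: (ltrgt0P half_disc^`().[alpha]) na => [pos _|neg _|//].
  by exists 1; [left | move=> x /same; rewrite pmulr_rgt0 // mul1r].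
by exists (-1); [right | move=> x /same; rewrite nmulr_rgt0 // mulN1r oppr_gt0].
Qed.

(** Both sides are obtained by differentiating an angle with cosine half the
    discriminant: on one side the one given by the arc cosine, on the other the
    Floquet phase, which decreases. *)
Lemma floquet_speed s x : s = 1 \/ s = -1 -> alpha <= x <= beta ->
  0 < s * half_disc^`().[x] -> dphase s half_disc x = - gamma^`()%classic x.
Proof.
move=> s1 Ix sx; have bx : bands_interior a0 b0 p x by apply: sub_bands; rewrite /= in_itv.
have g0 := floquet_decreasing bx.
have e : 1 - half_disc.[x] ^+ 2 = sin (gamma x) ^+ 2.
  by have := cos2Dsin2 (gamma x); rewrite floquet_cos // => <-; ring.
rewrite /dphase e sqrtr_sqr floquet_deriv //; rewrite floquet_deriv // in sx.
set g := gamma^`()%classic x in g0 sx *; set u := sin _ in sx *.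
have su : 0 < s * u.
  have -> : s * u = (s * (- u * g)) * (- g)^-1 by field; rewrite lt_eqF.
  by rewrite mulr_gt0 // invr_gt0 oppr_gt0.
have u0 : u != 0 by apply: contraTneq su => ->; rewrite mulr0 ltxx.
have -> : `|u| = s * u.
  by case: s1 su => ->; rewrite ?mul1r ?mulN1r; [move/gtr0_norm | rewrite oppr_gt0 => /ltr0_norm].
have s0 : s != 0 by case: s1 => ->; rewrite ?oppr_eq0 oner_eq0.
by clearbody g u; field; rewrite s0 u0.
Qed.

End Rate.

(** * Zeros of the orthogonal polynomials in the bands *)

Section Assembly.
Variables (R : realType) (p : nat) (a0 b0 : nat -> R).
Hypothesis p_gt0 : (0 < p)%N.
Hypothesis a0_gt0 : forall n, 0 < a0 n.
Hypothesis a0_per : forall n, a0 (n + p)%N = a0 n.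
Hypothesis b0_per : forall n, b0 (n + p)%N = b0 n.
Variables (a b : nat -> R).
Hypothesis a_gt0 : forall n, 0 < a n.+1.
Hypothesis ab_lim : (fun n => `|a n - a0 n| + `|b n - b0 n|) @ \oo --> (0 : R).
Hypothesis ab_bv : (\sum_(1 <= n <oo)
        (`|a (n + p)%N - a n| + `|b (n + p)%N - b n|)%:E < +oo)%E.
Variables (alpha beta s : R).
Hypothesis albe : alpha <= beta.
Hypothesis s1 : s = 1 \/ s = -1.

Local Notation TL := (half_disc p a0 b0).
Local Notation rate := (dphase s TL).

Hypothesis disc_itv : forall x, alpha <= x <= beta -> -1 < TL.[x] < 1.
Hypothesis disc_mono : forall x, alpha <= x <= beta -> 0 < s * TL^`().[x].

Lemma poly_min_gt0 (q : {poly R}) : (forall x, alpha <= x <= beta -> 0 < q.[x]) ->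
  exists2 c, 0 < c & forall x, alpha <= x <= beta -> c <= q.[x].
Proof.
move=> q0; have [|c Ic hc] := @EVT_min _ (horner q) alpha beta albe.
  by apply: continuous_subspaceT; exact: continuous_horner.
exists q.[c]; first by apply: q0; rewrite in_itv in Ic.
by move=> x Ix; apply: hc; rewrite in_itv.
Qed.

Lemma elliptic_margin : exists kap : R, [/\ 0 < kap, kap <= 1 &
  forall x, alpha <= x <= beta ->
    2 * kap <= 1 - TL.[x] ^+ 2 /\ 2 * kap <= s * TL^`().[x]].
Proof.
have [x /disc_itv/andP[h1 h2]|c1 c10 h1] := @poly_min_gt0 (1 - TL ^+ 2).
  by rewrite hornerD hornerN hornerC horner_exp expr2; nra.
have [x /disc_mono h|c2 c20 h2] := @poly_min_gt0 (s *: TL^`()).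
  by rewrite hornerZ.
exists (Num.min 1 (Num.min c1 c2) / 2); split.
- by rewrite divr_gt0 // !lt_min ltr01 c10.
- by rewrite ler_pdivrMr // mul1r ge_min; apply/orP; left; lra.
move=> x Ix; rewrite mulrCA divff ?mulr1 //.
have := h1 x Ix; have := h2 x Ix.
rewrite hornerZ hornerD hornerN hornerC horner_exp => l2 l1.
by split; [apply: le_trans l1 | apply: le_trans l2]; rewrite !ge_min lexx ?orbT.
Qed.

(** Late blocks inherit ellipticity and monotonicity from the periodic ones, with
    half the margin; this is why the blocks are numbered from k0 on. *)
Lemma block_margin kap r : 0 < kap -> kap <= 1 ->
  (forall x, alpha <= x <= beta -> 2 * kap <= 1 - TL.[x] ^+ 2 /\ 2 * kap <= s * TL^`().[x]) ->
  exists k0, forall k x, alpha <= x <= beta ->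
    let T := half_trace (step_prod a b ((k0 + k) * p + r) p) in
    kap <= 1 - T.[x] ^+ 2 /\ kap <= s * T^`().[x].
Proof.
move=> kap0 kap1 hL.
have tM := poly_tame_step_prod p_gt0 a0_gt0 a0_per b0_per a_gt0 ab_lim ab_bv r p.
have tT := poly_tame_half_trace tM.
rewrite (half_trace_step_prod p_gt0 a0_gt0 a0_per b0_per) in tT.
have e0 : 0 < kap / 3 by rewrite divr_gt0.
have [K1 _ h1] := poly_tame_cvg (Num.max `|alpha| `|beta|) tT e0.
have [K2 _ h2] := poly_tame_cvg (Num.max `|alpha| `|beta|) (poly_tame_deriv tT) e0.
exists (K1 + K2)%N => k x Ix T; have xb := in_bnd Ix.
have {}h1 : `|T.[x] - TL.[x]| <= kap / 3.
  by apply: (h1 (K1 + K2 + k)%N) => //=; rewrite -addnA leq_addr.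
have {}h2 : `|T^`().[x] - TL^`().[x]| <= kap / 3.
  by apply: (h2 (K1 + K2 + k)%N) => //=; rewrite addnAC leq_addl.
have [l1 l2] := hL x Ix; have /andP[t1 t2] := disc_itv Ix.
move: h1 h2; rewrite !ler_norml => /andP[u1 u2] /andP[v1 v2]; split.
  have -> : T.[x] ^+ 2 = TL.[x] ^+ 2 + (T.[x] - TL.[x]) * (T.[x] + TL.[x]) by ring.
  have : `|(T.[x] - TL.[x]) * (T.[x] + TL.[x])| <= kap / 3 * 3.
    rewrite normrM; apply: ler_pM => //; rewrite ler_norml; apply/andP; split; lra.
  rewrite ler_norml => /andP[w1 w2]; lra.
by case: s1 l2 => ->; lra.
Qed.

(** Along the indices n = r modulo p the orthogonal polynomials are the components
    of a state transported by one-period blocks. *)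
Lemma residue_blocks r : exists kap k0, [/\ 0 < kap,
  forall x, alpha <= x <= beta -> kap <= rate x,
  forall e, 0 < e -> exists K, forall k E E' x,
    let q := orthopoly a b ((k0 + k) * p + r) in (K <= k)%N ->
    alpha <= E -> E < E' -> E' <= beta -> E <= x <= E' ->
    root q E -> root q E' -> (forall t, E < t < E' -> ~~ root q t) ->
    `|k%:R * (E' - E) - pi / rate x| <= e &
  forall e, 0 < e -> exists K, forall k x y, (K <= k)%N ->
    alpha <= x -> x <= y -> y <= beta ->
    let zs := zeros a b ((k0 + k) * p + r) in
    let m := ((nbelow zs y)%:R - (nbelow zs x)%:R : R) in
    `|k%:R * (phase s TL y - phase s TL x) - m * pi| <=
       e * k%:R * (y - x) + m * e + 5 * pi].
Proof.
have [kap [kap0 kap1 hL]] := elliptic_margin.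
have [k0 hM] := block_margin r kap0 kap1 hL.
pose M k := step_prod a b ((k0 + k) * p + r) p.
pose V k := ortho_vec a b ((k0 + k) * p + r).
have V0 k : V k 0 0 = a ((k0 + k) * p + r).+1 *: orthopoly a b ((k0 + k) * p + r).+1.
  by rewrite /V mxE.
have V1 k : V k 1 0 = orthopoly a b ((k0 + k) * p + r) by rewrite /V mxE.
have rL : half_trace (step_prod a0 b0 r p) = TL by exact: half_trace_step_prod.
have tM i l : poly_tame (fun k => M k i l) (step_prod a0 b0 r p i l).
  apply: (@poly_tame_shift _ (fun k => step_prod a b (k * p + r) p i l)).
  exact: poly_tame_step_prod.
have detM k : det2 (M k) = 1 by exact: det2_step_prod.
have VS k : V k.+1 = M k *m V k.
  rewrite /V /M -ortho_vec_prod //; congr (ortho_vec _ _ _).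
  by rewrite addnS mulSn; lia.
have ell k t : alpha <= t <= beta -> kap <= 1 - (half_trace (M k)).[t] ^+ 2.
  by move=> It; exact: (hM k t It).1.
have mono k t : alpha <= t <= beta -> kap <= s * (half_trace (M k))^`().[t].
  by move=> It; exact: (hM k t It).2.
have ellL t : alpha <= t <= beta -> kap <= 1 - (half_trace (step_prod a0 b0 r p)).[t] ^+ 2.
  by move=> It; rewrite rL; have [h _] := hL t It; lra.
have monoL t : alpha <= t <= beta -> kap <= s * (half_trace (step_prod a0 b0 r p))^`().[t].
  by move=> It; rewrite rL; have [_ h] := hL t It; lra.
have Vn0 k t : ~ ((V k 0 0).[t] = 0 /\ (V k 1 0).[t] = 0).
  rewrite V0 V1 hornerZ => -[h1 h2].
  apply: (@orthopoly_consecutive _ _ b a_gt0 ((k0 + k) * p + r) t); split=> //.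
  by apply/eqP; move/eqP: h1; rewrite mulf_eq0 gt_eqF.
have inter k E E' : E < E' -> root (V k 1 0) E -> root (V k 1 0) E' ->
    exists2 t, E < t < E' & root (V k 0 0) t.
  rewrite V0 V1 => EE' rE rE'; have [t tE rt] := root_between a_gt0 EE' rE rE'.
  by exists t => //; rewrite rootZ // gt_eqF.
exists kap, k0; split=> // [x Ix|e e0|e e0].
- by apply: dphase_ge => //; [move: (ellL x Ix) | move: (monoL x Ix)]; rewrite rL.
- have [K hK] := block_clock tM detM VS s1 kap0 kap1 ell ellL mono monoL albe Vn0 inter e0.
  by exists K => k E E' x /=; rewrite -rL -V1; exact: hK.
have [K hK] := block_count tM detM VS s1 kap0 kap1 ell ellL mono albe Vn0 inter e0.
exists K => k x y kK ax xy yb /=; rewrite -rL; apply: hK => //; first exact: zeros_sorted.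
by move=> t; rewrite V1 mem_zeros.
Qed.

(** With n = (k0 + k) p + r, the spacing is multiplied by p k in the main term; the
    bounded remaining part of n is harmless since the spacing is of order 1 / k. *)
Lemma phase_clock_residue r (e : R) : 0 < e -> exists N, forall n E E' x, (N <= n)%N ->
  (n %% p)%N = r ->
  alpha <= E -> E < E' -> E' <= beta -> E <= x <= E' ->
  root (orthopoly a b n) E -> root (orthopoly a b n) E' ->
  (forall t, E < t < E' -> ~~ root (orthopoly a b n) t) ->
  `|n%:R * (E' - E) - p%:R * pi / rate x| <= e.
Proof.
move=> e0; have [kap [k0 [kap0 rate_ge clock_block _]]] := residue_blocks r.
have p0 : 0 < (p%:R : R) by rewrite ltr0n.
pose e1 := Num.min 1 (e / 2 / p%:R).
have e10 : 0 < e1 by rewrite lt_min ltr01 !divr_gt0.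
have e11 : e1 <= 1 by rewrite ge_min lexx.
have e12 : p%:R * e1 <= e / 2.
  by rewrite mulrC -ler_pdivlMr // ge_min lexx orbT.
have [K hK] := clock_block e1 e10.
pose K1 := (Num.truncn ((k0 * p + r)%:R * ((pi / kap + 1) / (e / 2)))).+1.
exists ((k0 + maxn K K1) * p + r)%N => n E E' x nN nr alE EE' E'be Ix rE rE' nrt.
have ner : n = (n %/ p * p + r)%N by rewrite -nr -divn_eq.
have nk : (k0 + maxn K K1 <= n %/ p)%N.
  by move: nN; rewrite {1}ner leq_add2r leq_pmul2r.
pose k := (n %/ p - k0)%N.
have nE : n = ((k0 + k) * p + r)%N by rewrite subnKC // (leq_trans (leq_addr _ _) nk).
have kK : (maxn K K1 <= k)%N by rewrite leq_subRL // (leq_trans (leq_addr _ _) nk).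
move: kK; rewrite geq_max => /andP[kK kK1].
rewrite nE in rE rE' nrt.
have clock := hK k E E' x kK alE EE' E'be Ix rE rE' nrt.
have Ix' : alpha <= x <= beta.
  by move: Ix => /andP[x1 x2]; rewrite (le_trans alE) // (le_trans x2).
have gk := rate_ge x Ix'.
have g0 : 0 < rate x := lt_le_trans kap0 gk.
have pi0 := pi_gt0 R.
have pik : pi / rate x <= pi / kap by rewrite ler_pM2l // lef_pV2.
have ky : k%:R * (E' - E) <= pi / kap + 1.
  by move: clock; rewrite ler_norml => /andP[_ c2]; lra.
have kp : 0 < (k%:R : R) by rewrite ltr0n; apply: leq_trans kK1.
have tail : (k0 * p + r)%:R * (E' - E) <= e / 2.
  rewrite -(ler_pM2l kp) mulrCA; apply: le_trans (_ : (k0 * p + r)%:R * (pi / kap + 1) <= _).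
    by rewrite ler_wpM2l.
  have e20 : 0 < e / 2 by rewrite divr_gt0.
  rewrite -ler_pdivrMr // -mulrA; apply: ltW; apply: lt_le_trans (truncnS_gt _) _.
  by rewrite ler_nat.
have tail0 : 0 <= (k0 * p + r)%:R * (E' - E) by rewrite mulr_ge0 // subr_ge0 ltW.
have -> : n%:R * (E' - E) - p%:R * pi / rate x =
   p%:R * (k%:R * (E' - E) - pi / rate x) + (k0 * p + r)%:R * (E' - E).
  rewrite [in LHS]nE mulnDl -addnA addnCA natrD natrM; ring.
have {}clock : `|p%:R * (k%:R * (E' - E) - pi / rate x)| <= e / 2.
  by apply: le_trans e12; rewrite normrM (gtr0_norm p0) ler_wpM2l // ltW.
apply: le_trans (ler_normD _ _) _; rewrite (ger0_norm tail0); lra.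
Qed.

Lemma phase_clock (e : R) : 0 < e -> exists N, forall n E E' x, (N <= n)%N ->
  alpha <= E -> E < E' -> E' <= beta -> E <= x <= E' ->
  root (orthopoly a b n) E -> root (orthopoly a b n) E' ->
  (forall t, E < t < E' -> ~~ root (orthopoly a b n) t) ->
  `|n%:R * (E' - E) - p%:R * pi / rate x| <= e.
Proof.
move=> e0.
pose P n := forall E E' x,
    alpha <= E -> E < E' -> E' <= beta -> E <= x <= E' ->
    root (orthopoly a b n) E -> root (orthopoly a b n) E' ->
    (forall t, E < t < E' -> ~~ root (orthopoly a b n) t) ->
    `|n%:R * (E' - E) - p%:R * pi / rate x| <= e.
have res m : exists N, forall n, (N <= n)%N -> (n %% p < m)%N -> P n.
  elim: m => [|m [N1 h1]]; first by exists 0%N.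
  have [N2 h2] := phase_clock_residue m e0.
  exists (maxn N1 N2) => n; rewrite geq_max => /andP[n1 n2].
  rewrite ltnS leq_eqVlt; case/orP => [/eqP nm|nm]; last exact: h1.
  by move=> E E' x; exact: h2.
have [N hN] := res p; exists N => n E E' x Nn; apply: hN => //; by rewrite ltn_mod.
Qed.

(** Counting zeros along the multiples of the period identifies the increments of
    the integrated density of states. *)
Lemma ids_increment x y : alpha <= x -> x <= y -> y <= beta ->
  ids a b y - ids a b x = (pi * p%:R)^-1 * (phase s TL y - phase s TL x).
Proof.
move=> ax xy yb; have [kap [k0 [_ _ _ count]]] := residue_blocks 0.
have pi0 := pi_gt0 R.
have p0 : 0 < (p%:R : R) by rewrite ltr0n.
pose D := phase s TL y - phase s TL x.
pose w n := (nbelow (zeros a b n) y)%:R / n%:R - (nbelow (zeros a b n) x)%:R / n%:R : R.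
pose W := ids a b y - ids a b x.
have cw : w n @[n --> \oo] --> W.
  by apply: cvgB; apply: (cvg_ids p_gt0 a0_gt0 a0_per b0_per a_gt0 ab_lim).
have cwk : w ((k0 + k) * p + 0)%N @[k --> \oo] --> W.
  apply: (@cvg_comp _ _ _ (fun k => ((k0 + k) * p + 0)%N) w) cw.
  by move=> A [N _ hN]; exists N => // k /= Nk; apply: hN => /=; nia.
have inv0 : (k%:R^-1 : R) @[k --> \oo] --> (0 : R).
  have h := @cvg_harmonic R; rewrite -(cvg_shiftn 1).
  rewrite (_ : (fun _ => _) = harmonic) //; apply/funext => n.
  by rewrite /= addn1.
pose u k := w ((k0 + k) * p + 0)%N * (p%:R * (1 + k0%:R * k%:R^-1)).
have cu : u k @[k --> \oo] --> W * p%:R.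
  have -> : W * p%:R = W * (p%:R * (1 + k0%:R * 0)) by ring.
  apply: cvgM => //; apply: cvgM; first exact: cvg_cst.
  by apply: cvgD; [exact: cvg_cst | apply: cvgM => //; exact: cvg_cst].
have main e : 0 < e -> `|D - W * p%:R * pi| <= e * (y - x) + W * p%:R * e + 5 * pi * 0.
  move=> e0; have [K hK] := count e e0.
  have c1 : `|D - u k * pi| @[k --> \oo] --> `|D - W * p%:R * pi|.
    by apply: cvg_norm; apply: cvgB; [exact: cvg_cst | apply: cvgM => //; exact: cvg_cst].
  have c2 : e * (y - x) + u k * e + 5 * pi * k%:R^-1 @[k --> \oo] -->
      e * (y - x) + W * p%:R * e + 5 * pi * 0.
    by apply: cvgD; [apply: cvgD; [exact: cvg_cst | apply: cvgM => //; exact: cvg_cst]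
      | apply: cvgM => //; exact: cvg_cst].
  apply: (ler_cvg_to c1 c2); exists (maxn 1 K) => // k /=.
  rewrite geq_max => /andP[k1 Kk]; have := hK k x y Kk ax xy yb => /=.
  set m := _ - (nbelow _ x)%:R.
  have kp : 0 < (k%:R : R) by rewrite ltr0n.
  have mE : m = k%:R * u k.
    rewrite /u /w -mulrBl -[X in _ = _ * (X / _ * _)]/m; clearbody m.
    have k00 : 0 <= (k0%:R : R) by exact: ler0n.
    by rewrite addn0 natrM natrD; field; rewrite !gt_eqF //; lra.
  rewrite mE -/D => h; rewrite -(ler_pM2l kp) -[X in X * `|_|](gtr0_norm kp) -normrM.
  have -> : k%:R * (D - u k * pi) = k%:R * D - k%:R * u k * pi by ring.
  apply: le_trans h _; rewrite le_eqVlt; apply/orP; left; apply/eqP.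
  by field; rewrite gt_eqF.
have W0 : 0 <= W by rewrite subr_ge0; exact: (ids_homo p_gt0 a0_gt0 a0_per b0_per a_gt0 ab_lim).
pose Q := y - x + W * p%:R + 1.
have Wp : 0 <= W * p%:R by apply: mulr_ge0.
have Q0 : 0 < Q by rewrite /Q; lra.
have eqD : D = W * p%:R * pi.
  apply/eqP; rewrite -subr_eq0 -normr_le0; apply/ler_addgt0Pr => e e0; rewrite add0r.
  have := main (e / Q) (divr_gt0 e0 Q0).
  have -> : e / Q * (y - x) + W * p%:R * (e / Q) + 5 * pi * 0 = e / Q * (Q - 1).
    by rewrite /Q; ring.
  move/le_trans; apply; rewrite mulrBr mulr1 divfK ?gt_eqF // gerBl.
  by rewrite divr_ge0 // ltW.
have pp : pi * p%:R != 0 :> R by rewrite gt_eqF // mulr_gt0.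
by rewrite -/D eqD -mulrA [p%:R * pi]mulrC mulrCA mulVf // mulr1.
Qed.

End Assembly.

(** * Measures with a continuous density *)

Section Density.
Variables (R : realType) (nu : probability (measurableTypeR R) R).
Variables (G rho : R -> R) (al be : R).
Hypothesis nuG : forall x y, al <= x -> x <= y -> y <= be ->
  nu (`]x, y]%classic : set (measurableTypeR R)) = (G y - G x)%:E.
Hypothesis nu_al : nu ([set al] : set (measurableTypeR R)) = 0%E.
Hypothesis rho_ge0 : forall t, al <= t <= be -> 0 <= rho t.
Hypothesis rho_cont : {within `[al, be], continuous rho}.
Hypothesis dG : forall t, al <= t <= be -> is_derive t (1 : R) G (rho t).

Let D : set (measurableTypeR R) := `]al, be]%classic.
Let mD : measurable D. Proof. exact: measurable_itv. Qed.
Let f : measurableTypeR R -> \bar R := (EFin \o rho) \_ D.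

Let D_itv t : D t -> al <= t <= be.
Proof. by rewrite /D /= in_itv /= => /andP[/ltW-> ->]. Qed.

Let measurable_rho : measurable_fun D (EFin \o rho : measurableTypeR R -> \bar R).
Proof.
apply/measurable_EFinP.
apply: (@measurable_funS _ _ _ _ (`[al, be]%classic : set (measurableTypeR R))) => //.
exact: subspace_continuous_measurable_fun.
Qed.

Let measurable_f : measurable_fun setT f.
Proof. by apply/(measurable_restrict _ _ _).1 => //; rewrite setTI. Qed.

Let f_ge0 t : (0 <= f t)%E.
Proof.
rewrite /f /patch; case: ifPn => //; rewrite inE => /D_itv h.
by rewrite lee_fin rho_ge0.
Qed.

(** The integral over all of A of rho cut off to zero outside the half-open
    interval, so that it is a measure on the whole line. *)
Definition density_part (A : set (measurableTypeR R)) : \bar R :=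
  (\int[lebesgue_measure]_(x in A) f x)%E.

Let density_part0 : density_part set0 = 0%E.
Proof. by rewrite /density_part integral_set0. Qed.

Let density_part_ge0 A : (0 <= density_part A)%E.
Proof. by rewrite /density_part integral_ge0. Qed.

Let density_part_sigma_additive : semi_sigma_additive density_part.
Proof.
move=> /= F mF tF mUF; rewrite /density_part; apply: cvg_toP.
  apply: ereal_nondecreasing_is_cvgn => m n mn.
  by apply: lee_sum_nneg_natr => // k _ _; exact: integral_ge0.
rewrite ge0_integral_bigcup //=.
exact: measurable_funTS.
Qed.

HB.instance Definition _ := isMeasure.Build _ _ _
  density_part density_part0 density_part_ge0 density_part_sigma_additive.

Let density_partE A : density_part A = (\int[lebesgue_measure]_(x in A `&` D) (rho x)%:E)%E.
Proof. by rewrite /density_part /f -integral_mkcondr. Qed.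

Let density_itv x y : al <= x -> x < y -> y <= be ->
  (\int[lebesgue_measure]_(t in `]x, y]) (rho t)%:E)%E = (G y - G x)%:E.
Proof.
move=> alx xy ybe.
have I t : x <= t <= y -> al <= t <= be.
  by move=> /andP[h1 h2]; rewrite (le_trans alx h1) (le_trans h2).
have sub : `[x, y]%classic `<=` `[al, be]%classic.
  by move=> t; rewrite /= !in_itv; exact: I.
have cG t : x <= t <= y -> {for t, continuous G}.
  move=> /I It; apply: differentiable_continuous; apply/derivable1_diffP.
  by have [] := dG It.
rewrite integral_itv_obnd_cbnd; last first.
  apply: measurable_funS measurable_rho => //.
  by move=> t; rewrite /D /= !in_itv /= => /andP[h1 h2]; rewrite (le_lt_trans alx) // (le_trans h2).
rewrite (@continuous_FTC2 _ rho G) //.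
- exact: continuous_subspaceW sub rho_cont.
- split.
  + by move=> t; rewrite in_itv /= => /andP[/ltW h1 /ltW h2]; have [|] := dG (I t _); rewrite ?h1.
  + by apply: cvg_at_right_filter; apply: cG; rewrite lexx ltW.
  + by apply: cvg_at_left_filter; apply: cG; rewrite lexx ltW.
move=> t; rewrite in_itv /= => /andP[/ltW h1 /ltW h2]; rewrite derive1E.
by have [|_ ->] := dG (I t _); rewrite ?h1.
Qed.

Let density_part_itv x y :
  density_part `]x, y]%classic = nu ((`]x, y]%classic : set (measurableTypeR R)) `&` D).
Proof.
rewrite density_partE; have -> : `]x, y]%classic `&` D = `]Num.max x al, Num.min y be]%classic.
  by apply/seteqP; split=> t; rewrite /D /= !in_itv /= gt_max le_min;
    [move=> [/andP[-> ->] /andP[-> ->]] | move=> /andP[/andP[-> ->] /andP[-> ->]]].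
have lo : al <= Num.max x al by rewrite le_max lexx orbT.
have hi : Num.min y be <= be by rewrite ge_min lexx orbT.
case: (ltP (Num.max x al) (Num.min y be)) => h.
  by rewrite density_itv // nuG // ltW.
by rewrite set_itv_ge ?integral_set0 ?measure0 // bnd_simp -leNgt.
Qed.

Let density_partP A : measurable A -> density_part A = nu (A `&` D).
Proof.
move=> mA.
apply: (@measure_unique _ R (measurableTypeR R) (@ocitv R)
  (fun n => `]- n%:R, n%:R]%classic) erefl (@ocitvI R) _ _ density_part (mrestr nu mD)) => //.
- by move=> i; exact: is_ocitv.
- exact: (bigcup_itvT false false).
- by move=> _ [[x y] _ <-]; exact: density_part_itv.
move=> k; pose I : set (measurableTypeR R) := `]- k%:R, k%:R]%classic.
have : (density_part I <= 1)%E.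
  by rewrite density_part_itv; apply: probability_le1; exact: measurableI.
by move/le_lt_trans; apply; exact: ltry.
Qed.

(** A measure on an interval is determined by its values on half-open
    subintervals, where the fundamental theorem of calculus applies. *)
Lemma has_density_of_primitive : has_density_on nu `[al, be]%classic rho.
Proof.
move=> A mA Asub.
have AD : A `\` [set al] = A `&` D.
  apply/seteqP; split=> t /=.
    move=> [At ta]; split=> //; have := Asub t At; rewrite /D /= !in_itv /= => /andP[h1 ->].
    by rewrite andbT lt_def h1 andbT; apply/eqP.
  by rewrite /D /= in_itv /= => -[At /andP[h _]]; split=> // ta; rewrite ta ltxx in h.
have m1 : measurable ([set al] : set (measurableTypeR R)) by exact: measurable_set1.
have z : nu (A `&` [set al]) = 0%E.
  apply/eqP; rewrite eq_le measure_ge0 andbT -nu_al; apply: le_measure; rewrite ?inE //.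
  exact: measurableI.
have e : nu A = (nu (A `\` [set al]) + nu (A `&` [set al]))%E by exact: measureDI.
rewrite e z AD adde0 -density_partP // density_partE -AD.
apply/esym/ge0_negligible_integral => //.
- apply/measurable_EFinP.
  apply: (@measurable_funS _ _ _ _ (`[al, be]%classic : set (measurableTypeR R))) => //.
  exact: subspace_continuous_measurable_fun.
- by move=> t /Asub; rewrite /= in_itv /= lee_fin; exact: rho_ge0.
exact: lebesgue_measure_set1.
Qed.

End Density.

(** * The density of states *)

Section DensityOfStates.
Variables (R : realType) (p : nat) (a0 b0 : nat -> R).
Hypothesis p_gt0 : (0 < p)%N.
Hypothesis a0_gt0 : forall n, 0 < a0 n.
Hypothesis a0_per : forall n, a0 (n + p)%N = a0 n.
Hypothesis b0_per : forall n, b0 (n + p)%N = b0 n.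
Variables (a b : nat -> R).
Hypothesis abP : jacobi_parameters a b.
Hypothesis ab_lim : (fun n => `|a n - a0 n| + `|b n - b0 n|) @ \oo --> (0 : R).

Let a_gt0 : forall n, 0 < a n.+1. Proof. by case: abP. Qed.

Lemma ids_bounds : exists2 K : R, 0 < K & [/\ forall x, x <= - K -> ids a b x = 0,
  forall x, K <= x -> ids a b x = 1 &
  forall n x, x \in zeros a b n -> - K <= x < K].
Proof.
have [_ [M hM]] := abP.
have aM n : `|a n.+1| <= M by have [] := hM n.
have bM n : `|b n.+1| <= M by have [] := hM n.
have M0 : 0 < M by apply: lt_le_trans (aM 0%N); rewrite normr_gt0 gt_eqF.
have cv := cvg_ids p_gt0 a0_gt0 a0_per b0_per a_gt0 ab_lim.
exists (3 * M); first by rewrite mulr_gt0.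
split=> [x h|x h|n x h].
- apply: (cvg_unique _ (cv x)) => //.
  rewrite (_ : (fun n => _) = cst 0); first exact: cvg_cst.
  by apply/funext => n; rewrite (nbelow_zeros_left a_gt0 aM bM) // mul0r.
- apply: (cvg_unique _ (cv x)) => //.
  apply: cvg_near_cst; exists 1%N => // n /= n1.
  by rewrite (nbelow_zeros_right a_gt0 aM bM) // divff // pnatr_eq0 -lt0n.
exact: zeros_bounded a_gt0 aM bM _ _ h.
Qed.

Lemma ids_cumulative : exists F : cumulativeBounded (0 : R) (1 : R),
  (F : R -> R) = ids a b.
Proof.
have [K K0 [h0 h1 _]] := ids_bounds.
have cont := continuous_ids p_gt0 a0_gt0 a0_per b0_per a_gt0 ab_lim.
have homo := ids_homo p_gt0 a0_gt0 a0_per b0_per a_gt0 ab_lim.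
have rc : right_continuous (ids a b) by exact: right_continuousW.
have c0 : ids a b @ -oo --> (0 : R).
  by apply: cvg_near_cst; exists (- K); split=> [|x /ltW /h0 //]; exact: num_real.
have c1 : ids a b @ +oo --> (1 : R).
  by apply: cvg_near_cst; exists K; split=> [|x /ltW /h1 //]; exact: num_real.
pose F : cumulativeBounded (0 : R) (1 : R) := HB.pack (ids a b)
  (isCumulative.Build R _ R (ids a b) homo rc)
  (isCumulativeBounded.Build R 0 1 (ids a b) c0 c1).
by exists F.
Qed.

(** The density of states is the Stieltjes measure of the limit of the counting
    functions. *)
Lemma density_of_states_ids : exists2 nu : probability (measurableTypeR R) R,
  density_of_states a b nu &
  forall x y, x <= y ->
    nu (`]x, y]%classic : set (measurableTypeR R)) = (ids a b y - ids a b x)%:E.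
Proof.
have [K K0 [h0 h1 hz]] := ids_bounds; have [F FE] := ids_cumulative.
pose nu : probability (measurableTypeR R) R := lebesgue_stieltjes_measure F.
have FNK : F (- K) = 0 by rewrite FE h0.
have FK : F K = 1 by rewrite FE h1.
exists nu => [f cf bf|x y xy].
  apply: (weak_limit_zero_measure a_gt0 K0 hz FNK FK) => // x.
  by rewrite FE; exact: cvg_ids p_gt0 a0_gt0 a0_per b0_per a_gt0 ab_lim x.
by rewrite -FE; exact: lebesgue_stieltjes_itv.
Qed.

Lemma ids_no_atom (nu : probability (measurableTypeR R) R) (x : R) :
  (forall x y, x <= y ->
    nu (`]x, y]%classic : set (measurableTypeR R)) = (ids a b y - ids a b x)%:E) ->
  nu ([set x] : set (measurableTypeR R)) = 0%E.
Proof.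
move=> nuE; apply/eqP; rewrite eq_le measure_ge0 andbT; apply/lee_addgt0Pr => e e0.
rewrite add0e.
have c : ids a b y @[y --> x] --> ids a b x.
  exact: (continuous_ids p_gt0 a0_gt0 a0_per b0_per a_gt0 ab_lim).
move/cvgrPdist_le: c => /(_ e e0) [d /= d0 hd].
have lt1 : x - d / 2 < x by rewrite ltrBlDr ltrDl divr_gt0.
pose I : set (measurableTypeR R) := `]x - d / 2, x]%classic.
apply: (@le_trans _ _ (nu I)).
  have Ix : [set x] `<=` I by move=> _ ->; rewrite /I /= in_itv /= lt1 lexx.
  apply: le_measure => //=; first by rewrite inE; exact: measurable_set1.
  by rewrite inE; exact: measurable_itv.
rewrite /I nuE ?(ltW lt1) // lee_fin; apply: le_trans (ler_norm _) _.
apply: hd; rewrite /ball /= opprB addrC subrK ger0_norm ?divr_ge0 ?ltW //; lra.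
Qed.

End DensityOfStates.

(** When S n is empty its supremum is 0 by convention. *)
Lemma sup_cvg0 (R : realType) (S : nat -> set R) :
  (forall n r, S n r -> 0 <= r) ->
  (forall e, 0 < e -> exists N, forall n r, (N <= n)%N -> S n r -> r <= e) ->
  (fun n => sup (S n)) @ \oo --> (0 : R).
Proof.
move=> S0 Se; apply/cvgrPdist_le => e e0; have [N hN] := Se e e0.
exists N => // n /= Nn; rewrite sub0r normrN.
have [->|/set0P[r Sr]] := eqVneq (S n) set0; first by rewrite sup0 normr0 ltW.
rewrite ger0_norm.
  by apply: ge_sup => [|x Sx]; [exists r | exact: hN Sx].
apply: le_trans (S0 n r Sr) _; apply: ub_le_sup => //; exists e => x Sx; exact: hN Sx.
Qed.

(** * Uniform clock behavior *)

Theorem theorem3p6 (R : realType) (p : nat) (a0 b0 a b : nat -> R)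
    (gamma : R -> R) (p_ge1 : (1 <= p)%N)
    (a0_gt0 : forall n, 0 < a0 n)
    (a0_per : forall n, a0 (n + p)%N = a0 n)
    (b0_per : forall n, b0 (n + p)%N = b0 n)
    (gammaP : floquet_phase a0 b0 p gamma)
    (abP : jacobi_parameters a b)
    (ab_lim : (fun n => `|a n - a0 n| + `|b n - b0 n|) @ \oo --> (0 : R))
    (ab_bv : (\sum_(1 <= n <oo)
        (`|a (n + p)%N - a n| + `|b (n + p)%N - b n|)%:E < +oo)%E)
    (alpha beta : R) (alpha_le_beta : alpha <= beta)
    (sub_bands : `[alpha, beta] `<=` bands_interior a0 b0 p) :
  uniform_clock_behavior a b alpha beta
    (fun E => - (pi * p%:R)^-1 * gamma^`()%classic E).
Proof.
have a_gt0 : forall n, 0 < a n.+1 by case: abP.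
have pi0 := pi_gt0 R; have p0 : 0 < (p%:R : R) by rewrite ltr0n.
have band x : alpha <= x <= beta -> bands_interior a0 b0 p x.
  by move=> Ix; apply: sub_bands; rewrite /= in_itv.
have disc_itv x : alpha <= x <= beta -> -1 < (half_disc p a0 b0).[x] < 1.
  exact: (half_disc_itv p_ge1 a0_gt0 a0_per b0_per sub_bands).
have [s s1 mono] := half_disc_monotone p_ge1 a0_gt0 a0_per b0_per gammaP alpha_le_beta sub_bands.
have speed x : alpha <= x <= beta ->
    dphase s (half_disc p a0 b0) x = - gamma^`()%classic x.
  by move=> Ix; exact: (floquet_speed p_ge1 a0_gt0 a0_per b0_per gammaP sub_bands s1 Ix (mono x Ix)).
set rho := (fun E => _).
have rhoE x : alpha <= x <= beta ->
    rho x = (pi * p%:R)^-1 * dphase s (half_disc p a0 b0) x.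
  by move=> Ix; rewrite /rho speed // mulNr mulrN.
have rho_gt0 x : alpha <= x <= beta -> 0 < rho x.
  move=> Ix; rewrite rhoE // speed // mulr_gt0 ?invr_gt0 ?mulr_gt0 // oppr_gt0.
  have h := floquet_decreasing gammaP (band x Ix).
  exact h.
have rho_cont : {within `[alpha, beta], continuous rho}.
  apply: continuous_in_subspaceT => x; rewrite inE /= in_itv /= => Ix.
  apply: cvgM; first exact: cvg_cst.
  have [/(_ 1%N) dg _ _ _] := gammaP _ (band x Ix).
  by apply: differentiable_continuous; apply/derivable1_diffP.
have [nu dos nuE] := density_of_states_ids p_ge1 a0_gt0 a0_per b0_per abP ab_lim.
exists nu; split=> //.
- pose G x := (pi * p%:R)^-1 * phase s (half_disc p a0 b0) x.
  apply: (has_density_of_primitive (G := G)) => //.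
  + move=> x y ax xy yb; rewrite nuE //.
    rewrite (ids_increment p_ge1 a0_gt0 a0_per b0_per a_gt0 ab_lim ab_bv alpha_le_beta
      s1 disc_itv mono) //.
    by rewrite mulrBr.
  + exact: (ids_no_atom p_ge1 a0_gt0 a0_per b0_per abP ab_lim alpha nuE).
  + by move=> t It; exact: ltW (rho_gt0 t It).
  move=> t It; rewrite rhoE //.
  have [kap [kap0 _ hk]] := elliptic_margin alpha_le_beta disc_itv mono.
  have k2 : 0 < 2 * kap by rewrite mulr_gt0.
  have dph := is_derive_phase s k2 (hk t It).1.
  exact: (is_deriveZ _ dph).
- by move=> E; rewrite in_itv /= => IE; rewrite gt_eqF // rho_gt0.
apply: sup_cvg0 => [n r [E [E' [_ ->]]] //|e e0].
have [N hN] := phase_clock p_ge1 a0_gt0 a0_per b0_per a_gt0 ab_lim ab_bv alpha_le_beta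
  s1 disc_itv mono e0.
exists N => n r Nn [E [E' [[[/= IE IE' rE rE' EE'] nr] ->]]].
rewrite !in_itv /= in IE IE'.
have -> : (rho E)^-1 = p%:R * pi / dphase s (half_disc p a0 b0) E.
  by rewrite rhoE // invfM invrK [pi * _]mulrC.
have /andP[aE Eb] := IE; have /andP[aE' E'b] := IE'.
case: (ltgtP E E') EE' => // lt _.
  rewrite [`|E - E'|]distrC [`|E' - E|]ger0_norm ?subr_ge0 ?(ltW lt) //; apply: hN => //.
    by rewrite lexx ltW.
  by move=> t tE; apply: nr; rewrite (min_idPl (ltW lt)) (max_idPr (ltW lt)).
rewrite [`|E - E'|]ger0_norm ?subr_ge0 ?(ltW lt) //; apply: hN => //.
  by rewrite lexx ltW.
by move=> t tE; apply: nr; rewrite (min_idPr (ltW lt)) (max_idPl (ltW lt)).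
Qed.
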